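(* Let $Q$ be a finite quiver, $q\in(\mathbb{C}^\times)^{Q_0}$, $\theta\in\mathbb{Z}^{Q_0}$. If $\alpha$ is the dimension vector of a $\theta$-stable representation of $\Lambda^q(Q)$, then one of the following three cases must hold: (1) $\alpha\in\Sigma_{q,\theta}$; (2) $\alpha\in\mathbb{N}_{\ge2}\cdot\Sigma^{\mathrm{iso}}_{q,\theta}$; (3) $\alpha$ is obtained by admissible reflections from an element in the fundamental region $\mathcal{F}(Q)$ having only decompositions of type (b2) (and none of type (b1)).
   Context: Quivers and roots. $Q$ has vertex set $Q_0$ and arrow set $Q_1$; $h(a),t(a)$ are the head and tail of an arrow. $\mathbb{N}=\{0,1,\dots\}$, $e_i$ is the coordinate vector at $i$. $\langle\alpha,\beta\rangle=\sum_{i\in Q_0}\alpha_i\beta_i-\sum_{a\in Q_1}\alpha_{t(a)}\beta_{h(a)}$, $(\alpha,\beta)=\langle\alpha,\beta\rangle+\langle\beta,\alpha\rangle$, $p(\alpha)=1-\langle\alpha,\alpha\rangle$. The fundamental region $\mathcal{F}(Q)$ is the set of nonzero $\alpha\in\mathbb{N}^{Q_0}$ with connected support and $(\alpha,e_i)\le0$ for all $i$. At a loopfree vertex $i$ the reflection is $s_i(\alpha)=\alpha-(\alpha,e_i)e_i$. Real (resp. imaginary) roots are the vectors obtained from coordinate vectors at loopfree vertices (resp. from $\pm$ elements of $\mathcal{F}(Q)$) by sequences of reflections at loopfree vertices; $R^+$ is the set of positive roots. $q^\alpha=\prod_iq_i^{\alpha_i}$, $N_{q,\theta}=\{\alpha\in\mathbb{N}^{Q_0}\mid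 q^\alpha=1,\ \theta\cdot\alpha=0\}$, $R^+_{q,\theta}=R^+\cap N_{q,\theta}$, and $\Sigma_{q,\theta}$ is the set of $\alpha\in R^+_{q,\theta}$ with $p(\alpha)>\sum_{i=1}^rp(\beta^{(i)})$ for every decomposition $\alpha=\beta^{(1)}+\dots+\beta^{(r)}$, $r\ge2$, $\beta^{(i)}\in R^+_{q,\theta}$. $\Sigma^{\mathrm{iso}}_{q,\theta}$ is the set of isotropic imaginary roots ($p=1$) in $\Sigma_{q,\theta}$; $\mathbb{N}_{\ge2}\cdot X=\{m\beta\mid m\ge2,\beta\in X\}$. Reflections of parameters. For a loopfree vertex $v$: $u_v(q)_w=q_v^{-(e_v,e_w)}q_w$ and $r_v(\theta)_w=\theta_w-(e_v,e_w)\theta_v$. The reflection $(q,\theta,\alpha)\mapsto(u_v(q),r_v(\theta),s_v(\alpha))$ is admissible if $q_v\ne1$ or $\theta_v\ne0$. Decompositions (b1), (b2). For $\gamma\in\mathcal{F}(Q)$ with parameters $(q,\theta)$ (in case (3): the parameters transported by the reflections), consider the situation where the support of $\gamma$ is a disjoint union $J\sqcup K$ such that there is exactly one arrow of the doubled quiver $\overline{Q}$ from a vertex of $J$ to a vertex of $K$, say from $j\in J$ to $k\in K$, and $\gamma_k=1$. It is of type (b1) if $\gamma_j=1$ and $\gamma|_J\in R^+_{q,\theta}$; it is of type (b2) if $Q|_J$ is affine Dynkin, $\gamma|_J=m\delta$ for some $m\ge2$ with $\delta\in R^+_{q,\theta}$ the indivisible imaginary root, and $j$ is an extending vertex of $Q|_J$.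 Multiplicative preprojective algebra. $\overline{Q}$ is obtained by adding $a^*$ opposite to each $a\in Q_1$, with $(a^* )^*=a$; $\varepsilon(a)=1$ for $a\in Q_1$ and $-1$ for $a\in\overline{Q}_1\setminus Q_1$. $\Lambda^q(Q)$ is the quotient of the localisation of $\mathbb{C}\overline{Q}$ making all $1+aa^*$ ($a\in\overline{Q}_1$) invertible by the relation $\prod^{<}_{a\in\overline{Q}_1}(1+aa^* )^{\varepsilon(a)}=\sum_iq_ie_i$ (any fixed ordering). A finite-dimensional representation $M$ with $\theta\cdot\underline{\dim}M=0$ is $\theta$-stable if $\theta\cdot\underline{\dim}N<0$ for all nonzero proper submodules $N$. *)

(* Defs.v *)
From HB Require Import structures.
From mathcomp Require Import all_boot all_order all_algebra.
From mathcomp Require Import generic_quotient boolp.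
From mathcomp Require Export reals complex.

Set Implicit Arguments.
Unset Strict Implicit.
Unset Printing Implicit Defensive.

Import Order.TTheory GRing.Theory Num.Theory.
Local Open Scope ring_scope.
Local Open Scope quotient_scope.

Record quiver := Quiver {
  vert : finType;
  arr : finType;
  atail : arr -> vert;
  ahead : arr -> vert }.

Notation lattice Q := {ffun vert Q -> int}.

Section Roots.
Variable Q : quiver.
Implicit Types (a b c : lattice Q) (v w : vert Q).

Definition coord_vec v : lattice Q := [ffun w => (w == v)%:Z].

Definition euler a b : int :=
  \sum_v a v * b v - \sum_(x : arr Q) a (atail x) * b (ahead x).

Definition symf a b : int := euler a b + euler b a.

Definition pfun a : int := 1 - euler a a.

Definition supp a : {set vert Q} := [set v | a v != 0].

Definition nonneg a : Prop := forall v, 0 <= a v.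

Definition adjacent : rel (vert Q) := fun v w =>
  [exists x : arr Q, ((atail x == v) && (ahead x == w))
                     || ((atail x == w) && (ahead x == v))].

Definition connected_in (A : {set vert Q}) : Prop :=
  forall v w, v \in A -> w \in A ->
  connect (fun v' w' => [&& v' \in A, w' \in A & adjacent v' w']) v w.

Definition loopfree v : Prop := forall x : arr Q, ~ (atail x = v /\ ahead x = v).

Definition reflection v a : lattice Q :=
  [ffun w => a w - symf a (coord_vec v) * coord_vec v w].

Inductive reflected_from a : lattice Q -> Prop :=
| reflected_nil : reflected_from a a
| reflected_step b v :
    reflected_from a b -> loopfree v -> reflected_from a (reflection v b).

Definition fundamental a : Prop :=
  [/\ a != 0, nonneg a, connected_in (supp a)
    & forall v, symf a (coord_vec v) <= 0].

Definition real_root a : Prop :=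
  exists v, loopfree v /\ reflected_from (coord_vec v) a.

Definition imaginary_root a : Prop :=
  exists b, fundamental b /\ (reflected_from b a \/ reflected_from (- b) a).

Definition positive_root a : Prop :=
  (real_root a \/ imaginary_root a) /\ nonneg a.

Definition indivisible a : Prop :=
  forall (m : nat) b, a = b *+ m -> m = 1%N.

Definition dotp a b : int := \sum_v a v * b v.

Section WithParams.
Variable K : fieldType.
Implicit Types (q : {ffun vert Q -> K}) (th : lattice Q).

Definition qpow q a : K := \prod_v q v ^ a v.

Definition Nqt q th a : Prop := [/\ nonneg a, qpow q a = 1 & dotp th a = 0].

Definition Rqt q th a : Prop := positive_root a /\ Nqt q th a.

Definition Sigma q th a : Prop :=
  Rqt q th a /\
  forall s : seq (lattice Q), (2 <= size s)%N ->
    (forall b, b \in s -> Rqt q th b) -> a = \sum_(b <- s) b ->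
    \sum_(b <- s) pfun b < pfun a.

Definition Sigma_iso q th a : Prop :=
  [/\ Sigma q th a, imaginary_root a & pfun a = 1].

Definition proper_multiples (X : lattice Q -> Prop) a : Prop :=
  exists m b, [/\ (2 <= m)%N, X b & a = b *+ m].

Definition reflect_q v q : {ffun vert Q -> K} :=
  [ffun w => q v ^ (- symf (coord_vec v) (coord_vec w)) * q w].

Definition reflect_th v th : lattice Q :=
  [ffun w => th w - symf (coord_vec v) (coord_vec w) * th v].

Inductive admissibly_reflected_from q th a :
  {ffun vert Q -> K} -> lattice Q -> lattice Q -> Prop :=
| admissible_nil : admissibly_reflected_from q th a q th a
| admissible_step q' th' a' v :
    admissibly_reflected_from q th a q' th' a' ->
    loopfree v -> (q' v != 1 \/ th' v != 0) ->
    admissibly_reflected_from q th a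
      (reflect_q v q') (reflect_th v th') (reflection v a').

End WithParams.
End Roots.

(* [AffA n], [AffD n], [AffE6], ... stand for the extended Dynkin diagrams of
   types A_n (n >= 0), D_(n+4), E_6, ...; A_0 is one vertex with a loop and A_1
   is two vertices joined by a double edge. *)
Variant affine_type :=
  AffA of nat | AffD of nat | AffE6 | AffE7 | AffE8.

Definition affine_order (T : affine_type) : nat :=
  match T with
  | AffA n => n.+1 | AffD n => n.+4.+1 | AffE6 => 7 | AffE7 => 8 | AffE8 => 9
  end.

Definition affine_edges (T : affine_type) : seq (nat * nat) :=
  match T with
  | AffA n => [seq (i, i.+1 %% n.+1)%N | i <- iota 0 n.+1]
  | AffD n => [:: (0, 2); (1, 2)] ++ [seq (i, i.+1) | i <- iota 2 n]
              ++ [:: (n.+2, n.+3); (n.+2, n.+4)]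
  | AffE6 => [:: (0, 1); (1, 2); (0, 3); (3, 4); (0, 5); (5, 6)]
  | AffE7 => [:: (0, 1); (0, 2); (2, 3); (3, 4); (0, 5); (5, 6); (6, 7)]
  | AffE8 => [:: (0, 1); (0, 2); (2, 3); (0, 4); (4, 5); (5, 6); (6, 7); (7, 8)]
  end%N.

Definition affine_dynkin (Q : quiver) : Prop :=
  exists (T : affine_type) (f : 'I_(affine_order T) -> vert Q),
    bijective f /\
    forall i j : 'I_(affine_order T),
      #|[set x : arr Q | ((atail x == f i) && (ahead x == f j))
                         || ((atail x == f j) && (ahead x == f i))]| =
      count (fun e => (e == (i : nat, j : nat)) || (e == (j : nat, i : nat)))
            (affine_edges T).

Section Subquiver.
Variables (Q : quiver) (J : {set vert Q}).

Definition sub_vert : finType := {v : vert Q | v \in J}.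
Definition sub_arr : finType :=
  {x : arr Q | (atail x \in J) && (ahead x \in J)}.
Definition sub_tail (x : sub_arr) : sub_vert :=
  Sub (atail (val x)) (proj1 (andP (valP x))).
Definition sub_head (x : sub_arr) : sub_vert :=
  Sub (ahead (val x)) (proj2 (andP (valP x))).
Definition subquiver : quiver := Quiver sub_tail sub_head.

Definition restrict (a : lattice Q) : lattice subquiver := [ffun v => a (val v)].

Definition extend0 (b : lattice subquiver) : lattice Q :=
  [ffun v => if insub v is Some w then b w else 0].

End Subquiver.

Section Double.
Variable Q : quiver.

(* [inl x] is the arrow x of Q and [inr x] is its opposite x^*. *)
Definition double_quiver : quiver :=
  @Quiver (vert Q) (arr Q + arr Q)%type
    (fun b => match b with inl x => atail x | inr x => ahead x end)
    (fun b => match b with inl x => ahead x | inr x => atail x end).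

Definition star (b : arr double_quiver) : arr double_quiver :=
  match b with inl x => inr x | inr x => inl x end.

End Double.

Section Decompositions.
Variable Q : quiver.
Implicit Types (c : lattice Q) (J L : {set vert Q}) (j k : vert Q).

Definition one_arrow_split c J L j k : Prop :=
  [/\ supp c = J :|: L, [disjoint J & L],
      exists b : arr (double_quiver Q),
        [/\ atail b = j, ahead b = k, j \in J, k \in L
          & forall b' : arr (double_quiver Q),
              atail b' \in J -> ahead b' \in L -> b' = b]
    & c k = 1].

Variable K : fieldType.
Implicit Types (q : {ffun vert Q -> K}) (th : lattice Q).

Definition has_b1 q th c : Prop :=
  exists J L j k, [/\ one_arrow_split c J L j k, c j = 1
    & Rqt q th (extend0 (restrict J c))].

(* An extending vertex of an affine Dynkin quiver is one at which the
   indivisible positive imaginary root takes the value 1. *)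
Definition has_b2 q th c : Prop :=
  exists J L j k, [/\ one_arrow_split c J L j k, affine_dynkin (subquiver J)
    & exists (m : nat) (delta : lattice (subquiver J)),
      [/\ (2 <= m)%N,
          imaginary_root delta /\ indivisible delta,
          Rqt q th (extend0 delta),
          restrict J c = delta *+ m
        & exists jJ : j \in J, delta (Sub j jJ) = 1]].

End Decompositions.

Inductive aterm (K G : Type) : Type :=
| TScal of K
| TGen of G
| TAdd of aterm K G & aterm K G
| TMul of aterm K G & aterm K G.
Arguments TScal {K G}.
Arguments TGen {K G}.

HB.instance Definition _ K G := gen_eqMixin (aterm K G).
HB.instance Definition _ K G := gen_choiceMixin (aterm K G).

Section Presented.
Variables (K : fieldType) (G : Type).
Local Notation tm := (aterm K G).
Variable rels : tm -> tm -> Prop.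

(* The least congruence that contains [rels] and makes the terms a K-algebra. *)
Inductive acong : tm -> tm -> Prop :=
| cong_rel s t : rels s t -> acong s t
| cong_refl t : acong t t
| cong_sym s t : acong s t -> acong t s
| cong_trans s t u : acong s t -> acong t u -> acong s u
| cong_add s s' t t' : acong s s' -> acong t t' -> acong (TAdd s t) (TAdd s' t')
| cong_mul s s' t t' : acong s s' -> acong t t' -> acong (TMul s t) (TMul s' t')
| cong_addA s t u : acong (TAdd s (TAdd t u)) (TAdd (TAdd s t) u)
| cong_addC s t : acong (TAdd s t) (TAdd t s)
| cong_add0 t : acong (TAdd (TScal 0) t) t
| cong_mulA s t u : acong (TMul s (TMul t u)) (TMul (TMul s t) u)
| cong_1mul t : acong (TMul (TScal 1) t) t
| cong_mulDl s t u : acong (TMul (TAdd s t) u) (TAdd (TMul s u) (TMul t u))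
| cong_mulDr s t u : acong (TMul s (TAdd t u)) (TAdd (TMul s t) (TMul s u))
| cong_scalD k l : acong (TScal (k + l)) (TAdd (TScal k) (TScal l))
| cong_scalM k l : acong (TScal (k * l)) (TMul (TScal k) (TScal l))
| cong_scalC k t : acong (TMul (TScal k) t) (TMul t (TScal k))
| cong_0mul t : acong (TMul (TScal 0) t) (TScal 0).

Definition acongb : rel tm := fun s t => `[< acong s t >].

Lemma acongb_refl : reflexive acongb.
Proof. by move=> t; apply/asboolP; apply: cong_refl. Qed.
Lemma acongb_sym : symmetric acongb.
Proof. by move=> s t; apply/asboolP/asboolP; apply: cong_sym. Qed.
Lemma acongb_trans : transitive acongb.
Proof.
move=> t s u /asboolP st /asboolP tu; apply/asboolP; exact: cong_trans st tu.
Qed.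
Canonical acongb_equiv := EquivRel acongb acongb_refl acongb_sym acongb_trans.

Definition presented : Type := {eq_quot acongb}.
HB.instance Definition _ := Choice.on presented.
HB.instance Definition _ := EqQuotient.on presented.

Definition cls (t : tm) : presented := \pi_presented t.

Lemma cls_eq s t : acong s t -> cls s = cls t.
Proof. by move=> st; apply/eqP; rewrite eqmodE; apply/asboolP. Qed.

Lemma cls_surj (x : presented) : exists t, x = cls t.
Proof. by exists (repr x); rewrite /cls reprK. Qed.

Definition padd (x y : presented) := cls (TAdd (repr x) (repr y)).
Definition pmul (x y : presented) := cls (TMul (repr x) (repr y)).
Definition popp (x : presented) := cls (TMul (TScal (-1)) (repr x)).
Definition pscale (k : K) (x : presented) := cls (TMul (TScal k) (repr x)).

Lemma acong_repr t : acong (repr (cls t)) t.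
Proof.
by apply/asboolP; rewrite -[`[< _ >]]/(acongb_equiv _ _) -eqmodE reprK.
Qed.

Lemma cls_add s t : padd (cls s) (cls t) = cls (TAdd s t).
Proof. by apply: cls_eq; apply: cong_add; apply: acong_repr. Qed.
Lemma cls_mul s t : pmul (cls s) (cls t) = cls (TMul s t).
Proof. by apply: cls_eq; apply: cong_mul; apply: acong_repr. Qed.
Lemma cls_opp t : popp (cls t) = cls (TMul (TScal (-1)) t).
Proof. by apply: cls_eq; apply: cong_mul; [apply: cong_refl|apply: acong_repr]. Qed.
Lemma cls_scale k t : pscale k (cls t) = cls (TMul (TScal k) t).
Proof. by apply: cls_eq; apply: cong_mul; [apply: cong_refl|apply: acong_repr]. Qed.

Local Definition clsE := (cls_add, cls_mul, cls_opp, cls_scale).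

Lemma paddA : associative padd.
Proof.
move=> x y z; have [[[s ->] [t ->]] [u ->]] := (cls_surj x, cls_surj y, cls_surj z).
by rewrite !clsE; apply: cls_eq; apply: cong_addA.
Qed.
Lemma paddC : commutative padd.
Proof.
move=> x y; have [[s ->] [t ->]] := (cls_surj x, cls_surj y).
by rewrite !clsE; apply: cls_eq; apply: cong_addC.
Qed.
Lemma padd0 : left_id (cls (TScal 0)) padd.
Proof.
by move=> x; have [s ->] := cls_surj x; rewrite !clsE; apply: cls_eq; apply: cong_add0.
Qed.
Lemma pmulA : associative pmul.
Proof.
move=> x y z; have [[[s ->] [t ->]] [u ->]] := (cls_surj x, cls_surj y, cls_surj z).
by rewrite !clsE; apply: cls_eq; apply: cong_mulA.
Qed.
Lemma p1mul : left_id (cls (TScal 1)) pmul.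
Proof.
by move=> x; have [s ->] := cls_surj x; rewrite !clsE; apply: cls_eq; apply: cong_1mul.
Qed.
Lemma pmul1 : right_id (cls (TScal 1)) pmul.
Proof.
move=> x; have [s ->] := cls_surj x; rewrite !clsE; apply: cls_eq.
exact: cong_trans (cong_sym (cong_scalC _ _)) (cong_1mul _).
Qed.
Lemma pmulDl : left_distributive pmul padd.
Proof.
move=> x y z; have [[[s ->] [t ->]] [u ->]] := (cls_surj x, cls_surj y, cls_surj z).
by rewrite !clsE; apply: cls_eq; apply: cong_mulDl.
Qed.
Lemma pmulDr : right_distributive pmul padd.
Proof.
move=> x y z; have [[[s ->] [t ->]] [u ->]] := (cls_surj x, cls_surj y, cls_surj z).
by rewrite !clsE; apply: cls_eq; apply: cong_mulDr.
Qed.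
Lemma pscaleDl (x : presented) k l :
  pscale (k + l) x = padd (pscale k x) (pscale l x).
Proof.
have [s ->] := cls_surj x; rewrite !clsE; apply: cls_eq.
exact: cong_trans (cong_mul (cong_scalD _ _) (cong_refl _)) (cong_mulDl _ _ _).
Qed.
Lemma pscale1 x : pscale 1 x = x.
Proof. by have [s ->] := cls_surj x; rewrite !clsE; apply: cls_eq; apply: cong_1mul. Qed.
Lemma paddN : left_inverse (cls (TScal 0)) popp padd.
Proof.
move=> x; rewrite -[popp x]/(pscale (-1) x) -{2}[x]pscale1 -pscaleDl addNr.
by have [s ->] := cls_surj x; rewrite !clsE; apply: cls_eq; apply: cong_0mul.
Qed.

HB.instance Definition _ := GRing.isPzRing.Build presented
  paddA paddC padd0 paddN pmulA p1mul pmul1 pmulDl pmulDr.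

Lemma pscaleA k l (x : presented) : pscale k (pscale l x) = pscale (k * l) x.
Proof.
have [s ->] := cls_surj x; rewrite !clsE; apply: cls_eq.
exact: cong_trans (cong_mulA _ _ _)
  (cong_mul (cong_sym (cong_scalM _ _)) (cong_refl _)).
Qed.
Lemma pscaleDr : right_distributive pscale (+%R : presented -> _).
Proof.
move=> k x y; have [[s ->] [t ->]] := (cls_surj x, cls_surj y).
rewrite -![(_ + _)%R]/(padd _ _) !clsE; apply: cls_eq; exact: cong_mulDr.
Qed.

HB.instance Definition _ := GRing.Zmodule_isLmodule.Build K presented
  pscaleA pscale1 pscaleDr (fun x k l => pscaleDl x k l).

Definition gen (g : G) : presented := cls (TGen g).

End Presented.

(* Generators: the trivial paths, the arrows of the doubled quiver, and formal
   inverses of the elements 1 + b b^*. *)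
Variant mpa_gen (Q : quiver) : Type :=
| Triv of vert Q
| Arr of arr (double_quiver Q)
| Loc of arr (double_quiver Q).

Section MPA.
Variables (K : fieldType) (Q : quiver).
Local Notation tm := (aterm K (mpa_gen Q)).

Definition tsum (s : seq tm) : tm := foldr (@TAdd _ _) (TScal 0) s.
Definition tprod (s : seq tm) : tm := foldr (@TMul _ _) (TScal 1) s.

Definition triv_t (v : vert Q) : tm := TGen (Triv v).
Definition arr_t (b : arr (double_quiver Q)) : tm := TGen (Arr b).
Definition loc_t (b : arr (double_quiver Q)) : tm := TGen (Loc b).

Definition one_plus_t (b : arr (double_quiver Q)) : tm :=
  TAdd (TScal 1) (TMul (arr_t b) (arr_t (star b))).

(* The factor 1 + b b^* raised to the power 1 if b is in Q, -1 otherwise. *)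
Definition factor_t (b : arr (double_quiver Q)) : tm :=
  match b with inl _ => one_plus_t b | inr _ => loc_t b end.

(* Paths are composed like functions: b b^* is a cycle at the head of b. *)
Inductive mpa_rel (ord : seq (arr (double_quiver Q))) (q : {ffun vert Q -> K}) :
  tm -> tm -> Prop :=
| rel_idem v : mpa_rel ord q (TMul (triv_t v) (triv_t v)) (triv_t v)
| rel_orth v w : v != w ->
    mpa_rel ord q (TMul (triv_t v) (triv_t w)) (TScal 0)
| rel_unit : mpa_rel ord q (tsum [seq triv_t v | v <- enum (vert Q)]) (TScal 1)
| rel_head (b : arr (double_quiver Q)) :
    mpa_rel ord q (TMul (triv_t (@ahead (double_quiver Q) b)) (arr_t b)) (arr_t b)
| rel_tail (b : arr (double_quiver Q)) :
    mpa_rel ord q (TMul (arr_t b) (triv_t (@atail (double_quiver Q) b))) (arr_t b)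
| rel_locl b : mpa_rel ord q (TMul (loc_t b) (one_plus_t b)) (TScal 1)
| rel_locr b : mpa_rel ord q (TMul (one_plus_t b) (loc_t b)) (TScal 1)
| rel_mult : mpa_rel ord q
    (tprod [seq factor_t b | b <- ord])
    (tsum [seq TMul (TScal (q v)) (triv_t v) | v <- enum (vert Q)]).

Definition mpa ord q : Type := presented (@mpa_rel ord q).
HB.instance Definition _ ord q := GRing.PzRing.on (mpa ord q).
HB.instance Definition _ ord q := GRing.Lmodule.on (mpa ord q).

Definition mpa_triv ord q (v : vert Q) : mpa ord q := gen _ (Triv v).

Record mpa_mod ord q := MpaMod {
  mod_space :> vectType K;
  mod_act : {linear mpa ord q -> 'End(mod_space)};
  _ : mod_act 1 = \1%VF;
  _ : forall x y, mod_act (x * y) = (mod_act x \o mod_act y)%VF }.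

Section Modules.
Variables (ord : seq (arr (double_quiver Q))) (q : {ffun vert Q -> K}).
Variable M : mpa_mod ord q.

Definition submodule (N : {vspace M}) : Prop :=
  forall x, (mod_act M x @: N <= N)%VS.

Definition dim_vec (N : {vspace M}) : lattice Q :=
  [ffun v => (\dim (mod_act M (mpa_triv ord q v) @: N))%:Z].

(* As for simple modules, a stable module is required to be nonzero: otherwise
   the zero module would vacuously be stable. *)
Definition theta_stable (th : lattice Q) : Prop :=
  [/\ fullv != 0%VS :> {vspace M}, dotp th (dim_vec fullv) = 0
    & forall N : {vspace M}, submodule N -> N != 0%VS -> N != fullv ->
        dotp th (dim_vec N) < 0].

End Modules.
End MPA.

(* Main.v *)
Require Import Defs.
From mathcomp Require Import all_boot all_order all_algebra.
From mathcomp Require Import zify ring lra.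
From mathcomp Require Import boolp.
From HB Require Import structures.

Set Implicit Arguments.
Unset Strict Implicit.
Unset Printing Implicit Defensive.

(* Let alpha be the dimension vector of a stable representation.  If the
   reflection at a loopfree vertex v is not admissible, then (alpha, e_v) <= 0
   unless alpha = e_v; hence admissible reflections, applied as long as they
   lower the height, lead to a vector gamma that is fundamental or a coordinate
   vector.  Stability forces q^gamma = 1 and, by taking determinants over the
   vertices of J, rules out decompositions of type (b1).

   Kac's identity gives (beta, gamma - beta) <= 0 for 0 < beta < gamma.  If this
   pairing is < -1 for all such beta in N_{q,theta}, then gamma is in Sigma,
   because p(gamma) = p(beta) + p(gamma - beta) - 1 - (beta, gamma - beta).  If
   gamma is orthogonal to all the vertices of its support, then it is a multiple
   of an isotropic element of Sigma.  Otherwise the pairing is -1 for some beta,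
   and beta can be lowered by reflections at vertices orthogonal to gamma until
   (beta, e_i) <= 0 for all i.  Then a single arrow j - k leaves the support J of
   beta, with beta_j = gamma_k = 1.  If gamma = beta on J, this is (b1).  If not,
   gamma - beta restricted to J is either proportional to beta, in which case
   beta is radical on the affine Dynkin quiver Q|_J and this is (b2), or it
   drives a unit electric current through J, with conductances
   -(e_i, e_l) beta_i beta_l, from j to another vertex where beta is 1; the
   latter is impossible. *)

(** * Affine diagrams *)

(** The relation at v is a product of factors 1 + p_i c_i, with c_i the arrows into v and p_i their
    opposites, so reflecting a representation is not a linear construction at sight. Expanding the
    product as 1 + sum h_i c_i makes it linear: the c_i and the h_i form block maps C and H whose
    composite is q_v - 1 on the space at v, and the new space is a kernel of C or a cokernel of H.
    If q_v differs from 1, then C is onto by this identity; if q_v = 1, stability makes C onto or H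
    injective according to the sign of theta_v. Moving Sigma along reflections requires that every
    root is positive or negative. For real roots this comes from the same reflections, applied over
    the rationals to simple modules with generic parameters. While beta is lowered, gamma stays
    fixed but the parameters move. The stable representation therefore moves along, so that (b1) is
    excluded for the parameters reached at the end, the same for which (b2) is found. The equality
    beta_j = 1 has two uses: it makes j an extending vertex, and it gives the classification of
    affine diagrams a vertex of weight 1 to start from. *)

Section AffineGraph.
Variables (T : finType) (E : T -> T -> nat) (d : T -> nat).
Hypothesis EC : forall u v, E u v = E v u.
Hypothesis d_gt0 : forall u, 0 < d u.
(** Here [E] counts a loop once, although a loop lowers the Cartan entry by 2; the extra term
    [E u u * d u] restores the difference, so that [d] is a radical vector of the symmetric form. *)
Hypothesis harm : forall u, \sum_v E u v * d v + E u u * d u = 2 * d u.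
Hypothesis conn : forall u v, connect (fun u' v' => 0 < E u' v') u v.

Definition edge_count (es : seq (nat * nat)) i l :=
  count (fun e => (e == (i, l)) || (e == (l, i))) es.

Definition realizes (A : affine_type) : Prop :=
  exists f : 'I_(affine_order A) -> T, bijective f /\
    forall i l, E (f i) (f l) = edge_count (affine_edges A) i l.

(** As [d] is positive, the harmonic equation at [f i] bounds the total weight of its edges. Once
    the edges counted by [F] use up this bound, there is no room for another edge inside the image
    or leaving it; the image is closed under adjacency, hence everything. All diagrams below are
    recognised by this test. *)
Lemma saturated n (f : 'I_n -> T) (F : nat -> nat -> nat) : 0 < n -> injective f ->
  (forall i l : 'I_n, F i l <= E (f i) (f l)) ->
  (forall i : 'I_n, 2 * d (f i) <= \sum_(l < n) F i l * d (f l) + F i i * d (f i)) ->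
  bijective f /\ forall i l, E (f i) (f l) = F i l.
Proof.
move=> n0 finj FE le; pose im := [set f l | l : 'I_n].
have imE (G : T -> nat) : \sum_(t in im) G t = \sum_(l < n) G (f l).
  by rewrite big_imset //= => i l _ _; apply: finj.
have sat (i : 'I_n) : (\sum_(l < n) (E (f i) (f l) - F i l) * d (f l) == 0)
    && (\sum_(t | t \notin im) E (f i) t * d t == 0).
  have := le i; rewrite -harm (bigID (mem im)) /= imE.
  have -> : \sum_(l < n) E (f i) (f l) * d (f l) =
      \sum_(l < n) F i l * d (f l) + \sum_(l < n) (E (f i) (f l) - F i l) * d (f l).
    by rewrite -big_split; apply: eq_bigr => l _ /=; rewrite -mulnDl subnKC.
  have := leq_mul (FE i i) (leqnn (d (f i))).
  move: (\sum_(l < n) F i l * _) (\sum_(l < n) (_ - _) * _) (\sum_(t | _) _) => s1 s2 s3.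
  by move: (F i i * _) (E _ _ * _) => s4 s5; lia.
have EF i l : E (f i) (f l) = F i l.
  have /andP[/eqP + _] := sat i; move/eqP; rewrite sum_nat_eq0 => /forallP/(_ l) /=.
  by rewrite muln_eq0 subn_eq0 eqn0Ngt d_gt0 orbF => le'; apply/eqP; rewrite eqn_leq le' FE.
have out i t : t \notin im -> E (f i) t = 0.
  move=> ti; have /andP[_ +] := sat i; rewrite sum_nat_eq0 => /forallP/(_ t).
  by rewrite ti /= muln_eq0 [d t == 0]eqn0Ngt d_gt0 orbF => /eqP.
split=> //; apply: inj_card_bij => //; rewrite card_ord.
have cl : closed (fun u v => 0 < E u v) (mem im).
  apply: intro_closed; first by apply: sym_connect_sym => u v; rewrite /= EC.
  move=> u v /= uv /imsetP[i _ ui]; apply: contraLR uv => vi; rewrite ui out //.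
have -> : #|T| = #|im|.
  apply: eq_card => v; symmetry.
  by rewrite -(closed_connect cl (conn (f (Ordinal n0)) v)) /= imset_f.
by rewrite card_imset // card_ord.
Qed.

(** This form of the neighbour sum reduces on an explicit edge list, so that for the exceptional
    diagrams the saturation test is decided by evaluation. *)
Definition weight_sum (es : seq (nat * nat)) (w : seq nat) i :=
  sumn [seq (e.1 == i) * nth 0 w e.2 + (e.2 == i) * nth 0 w e.1 | e <- es].

Lemma edge_count_le1 es i l : uniq es -> all (fun e => e.1 < e.2) es ->
  edge_count es i l <= (((i, l) \in es) || ((l, i) \in es)).
Proof.
move=> ues lt; have gen i' l' : i' < l' -> edge_count es i' l' <= ((i', l') \in es).
  move=> il; rewrite -count_uniq_mem // /edge_count leq_eqVlt; apply/orP; left; apply/eqP.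
  apply: eq_in_count => -[x y] /(allP lt) /= xy; case: eqP => //= _.
  by apply/eqP => -[e1 e2]; lia.
have sym : edge_count es i l = edge_count es l i.
  by apply: eq_count => e; rewrite orbC.
have [il|li|e] := ltngtP i l.
- by apply: leq_trans (gen _ _ il) _; case: ((i, l) \in es).
- by rewrite sym; apply: leq_trans (gen _ _ li) _; case: ((l, i) \in es); rewrite ?orbT.
rewrite -e orbb /edge_count -[leqLHS]/(count _ _).
have -> : count (fun e0 => (e0 == (i, i)) || (e0 == (i, i))) es = 0.
  apply/eqP; rewrite -leqn0 leqNgt -has_count; apply/hasPn => -[x y] /(allP lt) /= xy.
  by rewrite orbb; apply/eqP => -[e1 e2]; lia.
by [].
Qed.

Lemma edge_count_sum es (w : seq nat) i : all (fun e => e.1 < e.2 < size w) es ->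
  \sum_(l < size w) edge_count es i l * nth 0 w l = weight_sum es w i.
Proof.
rewrite /weight_sum; elim: es => [|[x y] es IH] /=; first by rewrite big1.
case/andP=> /andP[xy yn] /IH <-.
have -> : (x == i) * nth 0 w y + (y == i) * nth 0 w x =
    \sum_(l < size w) (((x, y) == (i, l : nat)) || ((x, y) == (l : nat, i))) * nth 0 w l.
  pose oy := Ordinal yn; pose ox := Ordinal (ltn_trans xy yn).
  transitivity (\sum_(l < size w) ((x == i) && (l == oy)) * nth 0 w l
     + \sum_(l < size w) ((y == i) && (l == ox)) * nth 0 w l).
    congr addn.
      rewrite (bigD1 oy) //= eqxx andbT big1 ?addn0 // => l /negbTE ->; by rewrite andbF.
    rewrite (bigD1 ox) //= eqxx andbT big1 ?addn0 // => l /negbTE ->; by rewrite andbF.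
  rewrite -big_split; apply: eq_bigr => l _ /=; rewrite -mulnDl; congr (_ * _).
  rewrite !xpair_eqE -!val_eqE /= [_ == y]eq_sym [_ == x]eq_sym.
  case: (x =P i) => [xi|_]; case: (y =P i) => [yi|_] //=; rewrite ?andbF ?orbF ?addn0 ?andbT //.
  by have := xy; rewrite xi yi ltnn.
by rewrite -big_split; apply: eq_bigr => l _ /=; rewrite -mulnDl.
Qed.

Lemma diagram (s : seq T) es : 0 < size s -> uniq s -> uniq es ->
  all (fun e => e.1 < e.2 < size s) es ->
  (forall x0 e, e \in es -> 0 < E (nth x0 s e.1) (nth x0 s e.2)) ->
  all (fun i => 2 * nth 0 (map d s) i <= weight_sum es (map d s) i) (iota 0 (size s)) ->
  exists f : 'I_(size s) -> T, bijective f /\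
    forall i l, E (f i) (f l) = edge_count es i l.
Proof.
case: s => // x0 s'; set s := x0 :: s' => s0 us ues lt adj wt.
exists (fun i => nth x0 s i); apply: saturated => //.
- by move=> i l /eqP; rewrite nth_uniq // => /eqP /val_inj.
- move=> i l; apply: leq_trans (edge_count_le1 _ _ ues _) _.
    by apply: sub_all lt => e /andP[].
  have [/orP[/(adj x0)//|/(adj x0)]|//] := boolP (_ || _).
  by rewrite EC.
move=> i; have /(allP wt) : (i : nat) \in iota 0 (size s) by rewrite mem_iota add0n ltn_ord.
rewrite (nth_map x0) // => /leq_trans; apply; apply: leq_trans (leq_addr _ _).
rewrite -edge_count_sum ?size_map //; apply: leq_sum => l _; rewrite (nth_map x0) //.
Qed.


Lemma realizes_of A (s : seq T) es : size s = affine_order A ->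
  (forall i l, edge_count es i l = edge_count (affine_edges A) i l) ->
  (exists f : 'I_(size s) -> T, bijective f /\
     forall i l, E (f i) (f l) = edge_count es i l) -> realizes A.
Proof.
by move=> sA eE; rewrite sA => -[f [bf Ef]]; exists f; split=> // i l; rewrite Ef eE.
Qed.

Lemma nbr_sum u s : uniq s -> all (fun v => 0 < E u v) s -> sumn (map d s) <= 2 * d u.
Proof.
move=> us /allP adj; rewrite -harm sumnE big_map big_uniq //=.
apply: leq_trans (leq_addr _ _); rewrite [leqRHS](bigID (mem s)) /=.
apply: leq_trans (leq_addr _ _); apply: leq_sum => v vs.
by rewrite leq_pmull // adj.
Qed.

Lemma nbr_le u v : E u v * d v <= 2 * d u.
Proof. by rewrite -harm (bigD1 v) //= -addnA leq_addr. Qed.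

Lemma realizes_loop u : 0 < E u u -> exists A, realizes A.
Proof.
move=> uu; exists (AffA 0).
exists (fun=> u); apply: (@saturated 1 _ (edge_count (affine_edges (AffA 0)))) => //.
- by move=> i l _; rewrite !ord1.
- by move=> i l; rewrite !ord1.
- by move=> i; rewrite ord1 big_ord1 !mul1n mul2n -addnn.
Qed.

Lemma realizes_double u v : u != v -> 1 < E u v -> exists A, realizes A.
Proof.
move=> uv E2; exists (AffA 1).
have dd : d u = d v.
  have := nbr_le u v; have := nbr_le v u; rewrite [E v u]EC.
  have := leq_mul E2 (leqnn (d u)); have := leq_mul E2 (leqnn (d v)); lia.
pose f (i : 'I_2) := nth u [:: u; v] i.
exists f; apply: (@saturated 2 f (edge_count (affine_edges (AffA 1)))) => //.
- move=> i l /eqP; rewrite nth_uniq // => [/eqP/val_inj //|]; by rewrite /= inE uv.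
- by case=> [[|[|i]] ?] [[|[|l]] ?] //=; rewrite /f /= // EC.
- by case=> [[|[|i]] ?] //=; rewrite !big_ord_recl big_ord0 /f /= ?dd; lia.
Qed.

Section Simple.
Hypothesis E_le1 : forall u v, E u v <= 1.
Hypothesis E_uu : forall u, E u u = 0.

Lemma adj_neq u v : 0 < E u v -> u != v.
Proof. by apply: contraTneq => ->; rewrite E_uu. Qed.

(** Weight missing from the bound [2 * d u] must come from a further neighbour [w]. The upper bound
    on [d w] is the harmonic condition at [u], the lower bound the one at [w], which has [u] as a
    neighbour. These two bounds drive the whole case analysis. *)
Lemma rest u s : uniq s -> all (fun v => 0 < E u v) s -> sumn (map d s) < 2 * d u ->
  exists w, [/\ w \notin s, 0 < E u w, sumn (map d s) + d w <= 2 * d u & d u <= 2 * d w].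
Proof.
move=> us adj lt; have [w /andP[ws uw]] : exists w, (w \notin s) && (0 < E u w).
  apply/existsP; apply: contraLR lt => /existsPn none; rewrite -leqNgt -harm E_uu addn0.
  rewrite (bigID (mem s)) /= [X in _ + X]big1 ?addn0 => [|v vs].
    rewrite sumnE big_map big_uniq //=; apply: leq_sum => v _.
    by rewrite -[leqRHS]mul1n leq_mul2r E_le1 orbT.
  by have := none v; rewrite vs /= -eqn0Ngt => /eqP ->.
exists w; split=> //; first by rewrite addnC (@nbr_sum u (w :: s)) //= ?ws ?uw.
by have := @nbr_sum w [:: u]; rewrite /= addn0 andbT EC uw; apply.
Qed.

Lemma path_weight c w m n i : (forall k, m <= k <= m + n -> nth 0 w k = c) ->
  weight_sum [seq (k, k.+1) | k <- iota m n] w i =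
    c * ((m <= i < m + n) + (m < i <= m + n)).
Proof.
rewrite /weight_sum; elim: n m => [|n IH] m wc /=.
  have -> : (m <= i < m + 0) + (m < i <= m + 0) = 0 by lia.
  by rewrite muln0.
rewrite IH => [|k /andP[mk kn]]; last by apply: wc; lia.
by rewrite !wc; lia.
Qed.

Lemma uniq_path_edges m n : uniq [seq (k, k.+1) | k <- iota m n].
Proof. by rewrite map_inj_uniq ?iota_uniq // => k l []. Qed.

Lemma weight_sum_cat es es' w i :
  weight_sum (es ++ es') w i = weight_sum es w i + weight_sum es' w i.
Proof. by rewrite /weight_sum map_cat sumn_cat. Qed.

Lemma weight_sum_cons x y es w i : weight_sum ((x, y) :: es) w i =
  (x == i) * nth 0 w y + (y == i) * nth 0 w x + weight_sum es w i.
Proof. by []. Qed.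

Lemma edge_count_AffA n i l :
  edge_count ([seq (k, k.+1) | k <- iota 0 n] ++ [:: (0, n)]) i l =
  edge_count (affine_edges (AffA n)) i l.
Proof.
rewrite /edge_count /affine_edges -[in RHS]addn1 iotaD map_cat !count_cat.
congr addn; last by rewrite /= !xpair_eqE addn1 modnn; lia.
congr count; apply/eq_in_map => k; rewrite mem_iota add0n => /andP[_ kn].
by rewrite modn_small // addn1.
Qed.

Lemma size_lt_card (s : seq T) w : uniq s -> w \notin s -> size s < #|T|.
Proof.
move=> us ws; have uw : uniq (w :: s) by rewrite cons_uniq ws.
by rewrite -[(size s).+1]/(size (w :: s)) -(card_uniqP uw) max_card.
Qed.

(* The two path neighbours of an inner vertex already exhaust its harmonic
   condition when the weight is constant along the path. *)
Lemma path_chord c x y p w : uniq [:: x, y & p] -> all (fun u => d u == c) [:: x, y & p] ->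
  sorted (fun u v => 0 < E u v) [:: x, y & p] -> w \in p -> 0 < E x w ->
  exists p1, p = rcons p1 w /\ 0 < E w (last y p1).
Proof.
move=> up dp sp wp xw; case/splitPr: p / wp up dp sp => p1 [|z p2] up dp sp.
  exists p1; rewrite cats1; split=> //; move: sp; rewrite /= cat_path /= => /and4P[_ _ + _].
  by rewrite EC.
have dE u : u \in [:: x, y & p1 ++ [:: w, z & p2]] -> d u = c by move/(allP dp)/eqP.
move: sp; rewrite /= cat_path /= => /and5P[_ _ lw wz _].
have lp : last y p1 \in y :: p1 by exact: mem_last.
have [lx lz xz] : [/\ x != last y p1, last y p1 != z & x != z].
  move: up; rewrite -[[:: x, y & _]]/(x :: ((y :: p1) ++ [:: w, z & p2])) cons_uniq cat_uniq.
  case/andP=> + /and3P[_ /hasPn H _].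
  rewrite mem_cat !inE !negb_or => /andP[/andP[xy xp] /and3P[_ xz _]].
  split=> //; first by apply: contraTneq lp => <-; rewrite inE negb_or xy.
  by apply: contraTneq lp => ->; apply: H; rewrite !inE eqxx orbT.
have dxyz : [/\ d w = c, d x = c, d (last y p1) = c & d z = c].
  split; apply: dE; rewrite -[[:: x, y & _]]/(x :: ((y :: p1) ++ [:: w, z & p2])) inE mem_cat ?lp ?orbT //.
  - by rewrite !inE eqxx !orbT.
  - by rewrite eqxx.
  - by rewrite !inE eqxx !orbT.
have [dw dx dl dz] := dxyz; have c0 : 0 < c by rewrite -dw d_gt0.
have := @nbr_sum w [:: x; last y p1; z].
rewrite /uniq !inE negb_or lx lz xz /all wz [E w x]EC xw [E w _]EC lw /= dw dx dl dz.
by move/(_ isT isT); move: c0; clear; lia.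
Qed.

(** The path grows at its head, where the weight bound leaves room for one more neighbour, of weight
    1. A new vertex prolongs the path; a vertex of the path must be its last one by [path_chord],
    and the cycle closes. *)
Lemma realizes_cycle s : 1 < size s -> uniq s -> all (fun u => d u == 1) s ->
  sorted (fun u v => 0 < E u v) s -> exists A, realizes A.
Proof.
have [m] := ubnP (#|T| - size s); elim: m s => // m IH s.
case: s => [|x [|y s]] // lem _ us ds ps.
have [xy pys] := andP ps.
have dx : d x = 1 by case/andP: ds => /eqP.
have dy : d y = 1 by case/and3P: ds => _ /eqP.
have [||w [wy xw dw dw']] := @rest x [:: y] isT; first by rewrite /= xy.
  by rewrite /= dy dx.
have {dw dw'}dw : d w = 1 by move: dw dw'; rewrite /= dy dx; lia.
have [ws|ws] := boolP (w \in x :: y :: s); last first.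
  apply: (IH (w :: x :: y :: s)) => //=.
  - by have := size_lt_card us ws; move: lem; rewrite /=; lia.
  - by rewrite ws.
  - by rewrite dw eqxx.
  - by rewrite EC xw xy.
set t := x :: y :: s in us ds ps ws *.
have wx : w != x by rewrite eq_sym adj_neq.
have ws' : w \in s.
  by move: ws; rewrite /t !inE (negbTE wx) /=; move: wy; rewrite inE => /negbTE ->.
have [s1 [sE _]] := path_chord us ds ps ws' xw.
have s0 : 0 < size s by rewrite sE size_rcons.
have wE x0 : nth x0 t (size s).+1 = w.
  by rewrite /t sE /= -last_nth last_rcons.
(* At this point [s] is the path without its first two vertices, so the cycle [t] has [size s + 2]
   vertices. *)
exists (AffA (size s).+1); apply: (realizes_of (s := t)); first by [].
  by move=> i l; exact: edge_count_AffA.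
apply: diagram => //.
- rewrite cats1 rcons_uniq uniq_path_edges andbT; apply/mapP => -[k' _ [<- e]]; by rewrite e in s0.
- rewrite cats1 all_rcons; apply/andP; split; first by rewrite /t /=.
  by apply/allP => _ /mapP[k' + ->]; rewrite mem_iota /t /=; lia.
- move=> x0 e; rewrite mem_cat mem_seq1 => /orP[/mapP[k' + ->] /=|/eqP ->].
    by rewrite mem_iota => /andP[_ kn]; have /(pathP x0)/(_ k') := ps; apply.
  by rewrite -[_.1]/0 -[_.2]/(size s).+1 wE.
have -> : map d t = nseq (size s).+2 1.
  by have := ds; rewrite -(@eq_all _ (preim d (pred1 1))) // -all_map => /all_pred1P ->; rewrite size_map.
have nn k' : nth 0 (nseq (size s).+2 1) k' = (k' < (size s).+2) by rewrite nth_nseq; case: ltnP.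
apply/allP => i; rewrite mem_iota => /andP[_ iN].
rewrite weight_sum_cat (@path_weight 1) => [|k' kk]; last by rewrite nn; lia.
rewrite weight_sum_cons !nn {1}/weight_sum /sumn /=; move: iN; rewrite add0n /t [size _]/=; lia.
Qed.

Lemma realizes_fork x p a b j l : uniq (x :: p) -> all (fun u => d u == 2) (x :: p) ->
  sorted (fun u v => 0 < E u v) (x :: p) -> uniq [:: a; b; j; l] ->
  all (fun u => d u == 1) [:: a; b; j; l] -> 0 < E a x -> 0 < E b x ->
  0 < E (last x p) j -> 0 < E (last x p) l -> realizes (AffD (size p)).
Proof.
move=> up dp sp ut dt ax bx cj cl; set n := size p.
pose s := [:: a; b] ++ (x :: p) ++ [:: j; l].
have ss : size s = n.+4.+1 by rewrite /s /= size_cat /= addn2.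
have inpath e : e \in [seq (k, k.+1) | k <- iota 2 n] -> e.2 = e.1.+1 /\ 2 <= e.1 < n.+2.
  by case/mapP => k + ->; rewrite mem_iota add2n.
apply: (realizes_of (s := s)) => //.
have wE : map d s = [:: 1; 1] ++ nseq n.+1 2 ++ [:: 1; 1].
  move: dt => /and5P[/eqP da /eqP db /eqP dj /eqP dl _].
  rewrite /s /= da db map_cat /= dj dl.
  move: dp; rewrite -(@eq_all _ (preim d (pred1 2))) // -all_map => /all_pred1P /= [-> pE].
  by rewrite {1}pE size_map.
have nthw k : nth 0 (map d s) k = if k < 2 then 1 else if k < n.+3 then 2 else k < n.+4.+1.
  rewrite wE nth_cat [size _]/=; case: ltnP => [|k2]; first by case: k => [|[]].
  rewrite nth_cat size_nseq nth_nseq.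
  case: ltnP => kn; first by case: ltnP => //; lia.
  have -> : (k < n.+3) = false by lia.
  have [e|[e|e]] : k - 2 - n.+1 = 0 \/ k - 2 - n.+1 = 1 \/ 2 <= k - 2 - n.+1 by lia.
  - by rewrite e /=; lia.
  - by rewrite e /=; lia.
  - by rewrite nth_default //; lia.
apply: diagram.
- by rewrite ss.
- rewrite /s uniq_catCA cat_uniq up -[[:: a; b] ++ _]/[:: a; b; j; l] ut andbT.
  apply/hasPn => u /(allP dt)/eqP du; apply/negP => /(allP dp); by rewrite du.
- rewrite /affine_edges !cat_uniq uniq_path_edges; apply/and3P; split=> //.
    rewrite has_cat negb_or; apply/andP; split; last first.
      by apply/hasPn => e; rewrite !inE => /orP[] /eqP ->.
    by apply/hasPn => -[e1 e2] /inpath /= [_ ?]; rewrite !inE !xpair_eqE; lia.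
  rewrite andTb; apply/andP; split; last by rewrite /= mem_seq1 xpair_eqE eqxx !eqSS (ltn_eqF (ltnSn _)).
  by apply/hasPn => e; rewrite !inE => /orP[] /eqP -> /=; apply/negP => /inpath /= [? ?]; lia.
- rewrite ss /affine_edges !all_cat; apply/and3P; split=> //; last by rewrite /=; lia.
  by apply/allP => e /inpath [-> /andP[_ en]] /=; rewrite ltnSn /= ltnS ltnW // ltnW // ltnW.
- move=> x0 e; rewrite /affine_edges !mem_cat => /or3P[].
  + by rewrite !inE => /orP[] /eqP -> /=.
  + case/mapP => k; rewrite mem_iota => kr -> /=; rewrite /s /=.
    case: k kr => [|[|k]] // kr; rewrite /= -cat_cons !nth_cat /=.
    have kn : k < size p by case/andP: kr.
    have k1 : k < (size p).+1 by exact: ltnW.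
    by rewrite kn k1; have /(pathP x0)/(_ k) := sp; apply.
  have nx : nth x0 s n.+2 = last x p.
    by rewrite /s /= -cat_cons nth_cat /= ltnSn -/n (last_nth x0).
  have nj : nth x0 s n.+3 = j by rewrite /s /= nth_cat ltnn subnn.
  have nl : nth x0 s n.+4 = l by rewrite /s /= nth_cat -/n ltnNge leqnSn subSnn.
  by rewrite !inE => /orP[] /eqP ->; rewrite ?nx ?nj ?nl.
apply/allP => i; rewrite ss mem_iota => /andP[_ iN].
rewrite /affine_edges !weight_sum_cat !weight_sum_cons (@path_weight 2) => [|k kk].
  have wn2 : nth 0 (map d s) n.+2 = 2 by rewrite nthw /= ltnSn.
  have wn3 : nth 0 (map d s) n.+3 = 1 by rewrite nthw /= ltnn leqnSn.
  have wn4 : nth 0 (map d s) n.+4 = 1 by rewrite nthw /= ltnNge leqnSn ltnSn.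
  rewrite wn2 wn3 wn4 [weight_sum _ _ _]/= nthw [nth 0 _ 0]nthw [nth 0 _ 1]nthw [nth 0 _ 2]nthw.
  case: (ltnP i 2) => i2; first by case: i i2 iN => [|[]] //=; lia.
  case: (ltnP i n.+3) => i3; rewrite /=; lia.
by rewrite nthw; do 2?[case: ifP]; lia.
Qed.

(** The end of the path already has its two leaves, so only the head can grow. The known neighbours
    [K] of the head use weight 2 out of 4; the rest is two vertices of weight 1, which complete the
    second fork, or one vertex of weight 2, which prolongs the path. *)
Lemma realizes_D x p j l : uniq (x :: p) -> all (fun u => d u == 2) (x :: p) ->
  sorted (fun u v => 0 < E u v) (x :: p) -> j != l -> d j = 1 -> d l = 1 ->
  0 < E (last x p) j -> 0 < E (last x p) l -> exists A, realizes A.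
Proof.
have [m] := ubnP (#|T| - size p); elim: m x p => // m IH x p lem up dp sp jl dj dl cj cl.
have dx : d x = 2 by case/andP: dp => /eqP.
have out u : d u = 1 -> 0 < E (last x p) u -> p != [::] -> E u x = 0.
  move=> du cu pn; apply/eqP; rewrite -leqn0 leqNgt; apply/negP => ux.
  have lx : last x p != x.
    case: p {IH lem cj cl cu} up dp sp pn => // y p up _ _ _.
    by apply: contraTneq up => /= e; rewrite -[in x \in _]e mem_last.
  have := @nbr_sum u [:: x; last x p]; rewrite /= inE eq_sym lx ux EC cu du dx.
  have /(allP dp)/eqP -> := mem_last x p.
  by move/(_ isT isT).
have [K [uK aK sK K0 Ky]] : exists K, [/\ uniq K, all (fun v => 0 < E x v) K,
    sumn (map d K) = 2, p = [::] -> K = [:: j; l] & forall y p', p = y :: p' -> K = [:: y]].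
  case: p {IH lem} up dp sp cj cl out => [|y p] up dp sp cj cl out.
    exists [:: j; l]; split=> //=; first by rewrite inE jl.
      by rewrite cj cl.
    by rewrite dj dl.
  exists [:: y]; split=> //=; first by case/andP: sp => ->.
    by have /and3P[_ /eqP -> _] := dp.
  by move=> y' p' [->].
have [|w [wK xw dw dw']] := rest uK aK; first by rewrite sK dx.
have aC u : d u = 1 -> u \notin K -> 0 < E x u -> u != j /\ u != l.
  move=> du uK' xu; have [p0|pn] := eqVneq p [::].
    by move: uK'; rewrite K0 // !inE negb_or => /andP.
  by split; apply: contraTneq xu => ->; rewrite EC out.
have [dw1|dw2] : d w = 1 \/ d w = 2 by move: dw dw'; rewrite sK dx; lia.
  have [|||z [zK xz dz dz']] := @rest x (w :: K).
  - by rewrite /= wK.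
  - by rewrite /= xw.
  - by rewrite /= dw1 sK dx.
  have dz1 : d z = 1 by move: dz dz'; rewrite /= dw1 sK dx; lia.
  move: zK; rewrite inE negb_or => /andP[zw zK].
  have [wj wl] := aC w dw1 wK xw; have [zj zl] := aC z dz1 zK xz.
  exists (AffD (size p)); apply: (@realizes_fork x p w z j l) => //=.
  - by rewrite !inE !negb_or eq_sym zw wj wl zj zl jl.
  - by rewrite dw1 dz1 dj dl.
  - by rewrite EC.
  - by rewrite EC.
have [wp|wp] := boolP (w \in x :: p); last first.
  apply: (IH w (x :: p)) => //=.
  - by have := size_lt_card up wp; move: lem; rewrite /=; lia.
  - by rewrite wp.
  - by rewrite dw2.
  - by rewrite EC xw.
(* A chord from the head could only end at the last vertex, whose neighbours would then have weight
   at least 2 + 2 + 1 + 1, more than 4. *)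
have wx := adj_neq xw; exfalso.
case: p => [|y p] in lem up dp sp cj cl out K0 Ky aC wp *.
  by move: wp; rewrite mem_seq1 eq_sym (negbTE wx).
move: wK; rewrite (Ky y p) // mem_seq1 => wy.
have wp' : w \in p.
  by move: wp wy; rewrite !inE eq_sym (negbTE wx) /= => /orP[->|].
have [p1 [pE wl]] := path_chord up dp sp wp' xw.
have lE : last x (y :: p) = w by rewrite /= pE last_rcons.
rewrite lE in cj cl.
have nd u v : d u = 2 -> d v = 1 -> u != v by move=> du dv; apply/eqP => uv; rewrite uv dv in du.
have l1p : last y p1 \in y :: p by rewrite pE -rcons_cons mem_rcons inE mem_last orbT.
have d1 : d (last y p1) = 2 by apply/eqP/(allP dp); rewrite inE l1p orbT.
have xl : x != last y p1.
  by move: up; rewrite cons_uniq => /andP[+ _]; apply: contraNneq => ->.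
have := @nbr_sum w [:: x; last y p1; j; l].
rewrite /uniq !inE !negb_or xl jl !(nd _ _ _ dj) ?(nd _ _ _ dl) //.
rewrite /all EC xw wl cj cl /map /sumn /foldr dx d1 dj dl dw2.
by move/(_ isT isT).
Qed.

(** The neighbours of [u] other than [v] have total weight n + 2, and each has at least half the
    weight of [u], which excludes three of them for n > 1. If there are two, the heavier one [b] has
    [2 * d b > n + 1] and needs a neighbour [x] besides [u]. *)
Lemma chain_step u v n : 1 < n -> 0 < E u v -> d u = n.+1 -> d v = n ->
  (exists2 w, 0 < E u w & d w = n.+2) \/
  exists a b x, [/\ a != b, a != v, b != v, 0 < E u a & 0 < E u b] /\
    [/\ d a <= d b, d a + d b = n.+2, n.+1 <= 2 * d a &
       [/\ x != u, 0 < E b x, d x + n.+1 <= 2 * d b & d b <= 2 * d x]].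
Proof.
move=> n1 uv du dv; have [|||w [wv uw dw dw']] := @rest u [:: v].
- by [].
- by rewrite /= uv.
- by rewrite /= du dv; lia.
rewrite mem_seq1 in wv; rewrite /= dv du addn0 in dw dw'.
have [e|ne] := eqVneq (d w) n.+2; first by left; exists w.
right; have [|||z [zw uz dz dz']] := @rest u [:: v; w].
- by rewrite /= inE eq_sym wv.
- by rewrite /= uv uw.
- by rewrite /= du dv; lia.
move: zw; rewrite /= dv du addn0 in dz dz' *; rewrite !inE negb_or => /andP[zv zw].
have dwz : d w + d z = n.+2.
  apply/eqP; rewrite eqn_leq; apply/andP; split; first by lia.
  rewrite leqNgt; apply/negP => lt.
  have [|||t [_ _ dt dt']] := @rest u [:: v; w; z].
  - by rewrite /= !inE !negb_or [v == w]eq_sym [v == z]eq_sym [w == z]eq_sym wv zv zw.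
  - by rewrite /= uv uw uz.
  - by rewrite /= du dv; lia.
  by rewrite /= du dv in dt dt'; lia.
have ext b : 0 < E u b -> n.+1 < 2 * d b -> exists x,
    [/\ x != u, 0 < E b x, d x + n.+1 <= 2 * d b & d b <= 2 * d x].
  move=> ub lt; have [|||x [xu bx dx dx']] := @rest b [:: u].
  - by [].
  - by rewrite /= EC ub.
  - by rewrite /= du addn0.
  by exists x; rewrite /= du addn0 addnC mem_seq1 in xu dx *.
have [wz|zw'] := leqP (d w) (d z).
  have [|x [*]] := ext z uz; first by lia.
  by exists w, z, x; rewrite eq_sym zw.
have [|x [*]] := ext w uw; first by lia.
by exists z, w, x; split=> //; split=> //; lia.
Qed.

(** For n > 5 the inequalities of a fork contradict each other, so the weights would increase
    forever; the distance to the maximal weight is the measure. *)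
Lemma chain_bounded u v n : 5 < n -> 0 < E u v -> d u = n.+1 -> d v = n -> False.
Proof.
have [m] := ubnP (\max_w d w - n); elim: m u v n => // m IH u v n lem n5 uv du dv.
have [|[w uw dw]|[a [b [x [_ [? ? ? [_ _ ? ?]]]]]]] := chain_step _ uv du dv; try lia.
apply: (IH w u n.+1); [|lia|by rewrite EC|by []|by []].
have : d u <= \max_w d w by exact: leq_bigmax.
by move: lem; rewrite du; move: (\max_w d w) => M; lia.
Qed.

Lemma dneq u v : d u != d v -> u != v.
Proof. by apply: contraNneq => ->. Qed.

(* The chain of weights 1, 2, 3, ... starting at an extending vertex can fork only
   at weight 3, 4 or 6, which gives E6, E7 and E8. *)
Lemma realizes_E v1 v2 v3 : d v1 = 1 -> d v2 = 2 -> d v3 = 3 -> 0 < E v1 v2 -> 0 < E v2 v3 ->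
  exists A, realizes A.
Proof.
move=> d1 d2 d3 e12 e23; have e32 := e23; rewrite EC in e32.
have e21 := e12; rewrite EC in e21.
have [[v4 e34 d4]|] := @chain_step v3 v2 2 isT e32 d3 d2; last first.
  case=> a [b [x [[ab a2 b2 e3a e3b] [le sum lea [x3 ebx dx dx']]]]].
  have [da db] : d a = 2 /\ d b = 2 by lia.
  have {}dx : d x = 1 by lia.
  have [|||y [y3 eay dy dy']] := @rest a [:: v3].
  - by [].
  - by rewrite /= EC e3a.
  - by rewrite /= d3 da.
  have {dy'}dy : d y = 1 by rewrite /= d3 da in dy dy'; lia.
  exists AffE6; pose s := [:: v3; a; y; b; x; v2; v1].
  have yx : y != x.
    apply/eqP => yx; have := @nbr_sum y [:: a; b]; rewrite /= inE ab EC eay yx EC ebx da db dx.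
    by move/(_ isT isT).
  have y1 : y != v1.
    apply/eqP => yv; have := @nbr_sum v1 [:: a; v2]; rewrite /= inE a2 -{1}yv EC eay e12 da d2 d1.
    by move/(_ isT isT).
  have x1 : x != v1.
    apply/eqP => xv; have := @nbr_sum v1 [:: b; v2]; rewrite /= inE b2 -{1}xv EC ebx e12 db d2 d1.
    by move/(_ isT isT).
  have D := (d1, d2, d3, da, db, dx, dy).
  apply: (@realizes_of AffE6 s (affine_edges AffE6)) => //; apply: diagram => //.
  - rewrite /= !inE !negb_or ab a2 b2 yx y1 x1.
    by do ![apply/andP; split] => //; apply: dneq; rewrite !D.
  - by move=> x0 e; rewrite !inE => /or4P[|||/or3P[]] /eqP -> //=.
  - by rewrite /s /= !D.
have e43 := e34; rewrite EC in e43.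
have [[v5 e45 d5]|] := @chain_step v4 v3 3 isT e43 d4 d3; last first.
  case=> a [b [x [[ab a3 b3 e4a e4b] [le sum lea [x4 ebx dx dx']]]]].
  have [da db] : d a = 2 /\ d b = 3 by lia.
  have {}dx : d x = 2 by lia.
  have [|||y [yb exy dy dy']] := @rest x [:: b].
  - by [].
  - by rewrite /= EC ebx.
  - by rewrite /= db dx.
  have {dy'}dy : d y = 1 by rewrite /= db dx in dy dy'; lia.
  exists AffE7; pose s := [:: v4; a; b; x; y; v3; v2; v1].
  have D := (d1, d2, d3, d4, da, db, dx, dy).
  have ax : a != x.
    apply/eqP => ax; have := @nbr_sum a [:: v4; b]; rewrite /= inE EC e4a {1}ax EC ebx dneq ?D //.
    by move/(_ isT isT).
  have a2 : a != v2.
    apply/eqP => av; have := @nbr_sum v2 [:: v4; v3]; rewrite /= inE -{1}av EC e4a e23 dneq ?D //.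
    by move/(_ isT isT).
  have x2 : x != v2.
    apply/eqP => xv; have := @nbr_sum v2 [:: b; v3]; rewrite /= inE b3 -{1}xv EC ebx e23 ?D //.
    by move/(_ isT isT).
  have y1 : y != v1.
    apply/eqP => yv; have := @nbr_sum v1 [:: x; v2]; rewrite /= inE x2 -{1}yv EC exy e12 ?D //.
    by move/(_ isT isT).
  apply: (@realizes_of AffE7 s (affine_edges AffE7)) => //; apply: diagram => //.
  - rewrite /= !inE !negb_or ax a2 b3 x2 y1.
    by do ![apply/andP; split] => //; apply: dneq; rewrite !D.
  - by move=> x0 e; rewrite !inE => /or4P[|||/or4P[]] /eqP -> //=.
  - by rewrite /s /= !D.
have e54 := e45; rewrite EC in e54.
have [[v6 e56 d6]|] := @chain_step v5 v4 4 isT e54 d5 d4; last first.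
  (* A fork at weight 5 would have two branches of weight 3, and [x] would have weight at most 1,
     less than half of [d b]. *)
  by case=> a [b [x [_ [? ? ? [_ _ ? ?]]]]]; exfalso; lia.
have e65 := e56; rewrite EC in e65.
have [[v7 e67 d7]|] := @chain_step v6 v5 5 isT e65 d6 d5.
  by exfalso; apply: (@chain_bounded v7 v6 6) => //; rewrite EC.
case=> a [b [x [[ab a5 b5 e6a e6b] [le sum lea [x6 ebx dx dx']]]]].
have [da db] : d a = 3 /\ d b = 4 by lia.
have {}dx : d x = 2 by lia.
exists AffE8; pose s := [:: v6; a; b; x; v5; v4; v3; v2; v1].
have D := (d1, d2, d3, d4, d5, d6, da, db, dx).
have a3 : a != v3.
  apply/eqP => av; have := @nbr_sum v3 [:: v6; v4]; rewrite /= inE -{1}av EC e6a e34 dneq ?D //.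
  by move/(_ isT isT).
have b4 : b != v4.
  apply/eqP => bv; have := @nbr_sum v4 [:: v6; v5]; rewrite /= inE -{1}bv EC e6b e45 dneq ?D //.
  by move/(_ isT isT).
have x2 : x != v2.
  apply/eqP => xv; have := @nbr_sum v2 [:: b; v3]; rewrite /= inE -{1}xv EC ebx e23 dneq ?D //.
  by move/(_ isT isT).
apply: (@realizes_of AffE8 s (affine_edges AffE8)) => //; apply: diagram => //.
- rewrite /= !inE !negb_or a3 b4 x2.
  by do ![apply/andP; split] => //; apply: dneq; rewrite !D.
- by move=> x0 e; rewrite !inE => /or4P[|||/or4P[|||/orP[]]] /eqP -> //=.
- by rewrite /s /= !D.
Qed.

(** The neighbours of [j] have total weight 2. One of weight 1 begins a cycle. At a neighbour [c] of
    weight 2 a weight of 3 remains: it contains a second leaf, which makes a fork, or is a single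
    vertex of weight 3, which begins the chain of type E. *)
Lemma realizes_simple j : d j = 1 -> exists A, realizes A.
Proof.
move=> dj; have [|||c [_ jc dc _]] := @rest j [::] => //; first by rewrite /= dj.
have cj : 0 < E c j by rewrite EC.
have [c1|c2] : d c = 1 \/ d c = 2 by have := d_gt0 c; rewrite /= dj in dc; lia.
  by apply: (@realizes_cycle [:: c; j]) => //=; rewrite ?c1 ?dj ?cj // inE adj_neq.
have [|||w [wj cw dw _]] := @rest c [:: j] => //; first by rewrite /= cj.
  by rewrite /= dj c2.
rewrite mem_seq1 eq_sym in wj; rewrite /= dj c2 in dw.
have [w1|[w2|w3]] : d w = 1 \/ d w = 2 \/ d w = 3 by have := d_gt0 w; lia.
- by apply: (@realizes_D c [::] j w) => //=; rewrite c2.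
- have [|||z [zw cz dz _]] := @rest c [:: j; w].
  + by rewrite /= inE wj.
  + by rewrite /= cj cw.
  + by rewrite /= dj w2 c2.
  have z1 : d z = 1 by have := d_gt0 z; rewrite /= dj w2 c2 in dz; lia.
  apply: (@realizes_D c [::] j z) => //=; first by rewrite c2.
  by move: zw; rewrite !inE negb_or eq_sym => /andP[].
exact: (@realizes_E j c w).
Qed.

End Simple.

Theorem affine_classification j : d j = 1 -> exists A, realizes A.
Proof.
move=> dj; have [/existsP[u]|/existsPn nl] := boolP [exists u, 0 < E u u].
  exact: realizes_loop.
have [/existsP[u /existsP[v /andP[]]]|/existsPn nd] := boolP [exists u, exists v, (u != v) && (1 < E u v)].
  exact: realizes_double.
have E0 u : E u u = 0 by have := nl u; rewrite -eqn0Ngt => /eqP.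
apply: realizes_simple dj => // u v; have [->|uv] := eqVneq u v; first by rewrite E0.
by have /existsPn/(_ v) := nd u; rewrite uv /= -leqNgt.
Qed.

End AffineGraph.

Import Order.TTheory GRing.Theory Num.Theory.
Local Open Scope ring_scope.

(** * The root lattice *)

Section Lattice.
Variable Q : quiver.
Implicit Types (a b c x y : lattice Q) (v w i j : vert Q).

Definition narr v w : int := \sum_(x : arr Q) ((atail x == v) && (ahead x == w))%:Z.

(** The symmetric generalised Cartan matrix, that is, the form on coordinate vectors. A loop is
    subtracted twice, so that the diagonal entry is 2 at loopfree vertices and at most 0
    elsewhere. *)
Definition cart v w : int := (v == w)%:Z *+ 2 - (narr v w + narr w v).

Lemma cartC v w : cart v w = cart w v.
Proof. by rewrite /cart eq_sym [narr w v + _]addrC. Qed.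

Lemma narr_ge0 v w : 0 <= narr v w.
Proof. exact: sumr_ge0. Qed.

Lemma cart_le0 v w : v != w -> cart v w <= 0.
Proof.
move=> vw; rewrite /cart (negbTE vw) mul0rn sub0r oppr_le0.
by apply: addr_ge0; exact: narr_ge0.
Qed.

Lemma cart_diag v : cart v v = (1 - narr v v) *+ 2.
Proof. by rewrite /cart eqxx mulrnBl !mulr2n. Qed.

Lemma cart_diag_le2 v : cart v v <= 2.
Proof. have := narr_ge0 v v; rewrite cart_diag; lia. Qed.

Lemma sum_delta (F : vert Q -> int) v : \sum_w F w * (v == w)%:Z = F v.
Proof.
rewrite (bigD1 v) //= eqxx mulr1 big1 ?addr0 // => w wv.
by rewrite eq_sym (negbTE wv) mulr0.
Qed.

Lemma sum_narr a b :
  \sum_(x : arr Q) a (atail x) * b (ahead x) = \sum_v \sum_w a v * b w * narr v w.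
Proof.
under [RHS]eq_bigr => v _ do under eq_bigr => w _ do rewrite mulr_sumr.
under [RHS]eq_bigr => v _ do rewrite exchange_big.
rewrite exchange_big; apply: eq_bigr => x _ /=.
rewrite (bigD1 (atail x)) //= (bigD1 (ahead x)) //= !eqxx /= mulr1.
rewrite big1 ?addr0 => [|w wx]; last by rewrite [_ == w]eq_sym (negbTE wx) mulr0.
rewrite big1 ?addr0 // => w wx; apply: big1 => w' _.
by rewrite [_ == w]eq_sym (negbTE wx) mulr0.
Qed.

Lemma symfE a b : symf a b = \sum_v \sum_w a v * b w * cart v w.
Proof.
rewrite /symf /euler !sum_narr [X in _ + (_ - X)]exchange_big.
have -> : \sum_v b v * a v = \sum_v a v * b v by apply: eq_bigr => v _; rewrite mulrC.
set A := \sum_v a v * b v; set B := \sum_v \sum_w _; set C := \sum_v \sum_w _.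
suff -> : \sum_v \sum_w a v * b w * cart v w = A *+ 2 - (B + C).
  by rewrite mulr2n; lia.
rewrite -sumrMnl -big_split -sumrB; apply: eq_bigr => v _ /=.
rewrite -big_split /= -[a v * b v](sum_delta (fun w => a v * b w)) -sumrMnl -sumrB.
by apply: eq_bigr => w _; rewrite /cart; ring.
Qed.

Lemma euler_symf a : euler a a *+ 2 = symf a a.
Proof. by rewrite /symf mulr2n. Qed.

Lemma symfC a b : symf a b = symf b a.
Proof. by rewrite /symf addrC. Qed.

Lemma coordE v w : coord_vec v w = (v == w)%:Z.
Proof. by rewrite ffunE eq_sym. Qed.

Lemma symf_coordr a v : symf a (coord_vec v) = \sum_w a w * cart w v.
Proof.
rewrite symfE; apply: eq_bigr => w _.
under eq_bigr => u _ do rewrite coordE mulrAC.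
by rewrite (sum_delta (fun u => a w * cart w u)).
Qed.

Lemma symf_coord v w : symf (coord_vec v) (coord_vec w) = cart v w.
Proof.
rewrite symf_coordr; under eq_bigr => u _ do rewrite coordE mulrC.
by rewrite (sum_delta (fun u => cart u w)).
Qed.

Lemma symf_sumr a b : symf a b = \sum_v b v * symf a (coord_vec v).
Proof.
rewrite symfE exchange_big; apply: eq_bigr => v _.
rewrite symf_coordr mulr_sumr; apply: eq_bigr => w _; ring.
Qed.

Lemma symfDl a b c : symf (a + b) c = symf a c + symf b c.
Proof.
rewrite !symfE -big_split; apply: eq_bigr => v _ /=.
by rewrite -big_split; apply: eq_bigr => w _ /=; rewrite ffunE; ring.
Qed.

Lemma symfDr a b c : symf c (a + b) = symf c a + symf c b.
Proof. by rewrite symfC symfDl !(symfC c). Qed.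

Lemma symfNl a c : symf (- a) c = - symf a c.
Proof.
rewrite !symfE -sumrN; apply: eq_bigr => v _.
by rewrite -sumrN; apply: eq_bigr => w _ /=; rewrite ffunE; ring.
Qed.

Lemma symfNr a c : symf c (- a) = - symf c a.
Proof. by rewrite symfC symfNl symfC. Qed.

Lemma symfBl a b c : symf (a - b) c = symf a c - symf b c.
Proof. by rewrite symfDl symfNl. Qed.

Lemma symfBr a b c : symf c (a - b) = symf c a - symf c b.
Proof. by rewrite symfDr symfNr. Qed.

Lemma symf0l c : symf 0 c = 0.
Proof. by rewrite -(subrr (0 : lattice Q)) symfBl subrr. Qed.

Lemma symf_suml (I : eqType) (s : seq I) (P : pred I) (F : I -> lattice Q) c :
  symf (\sum_(k <- s | P k) F k) c = \sum_(k <- s | P k) symf (F k) c.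
Proof. by apply: (big_morph (fun u => symf u c)) => [u w|]; rewrite ?symfDl ?symf0l. Qed.

Lemma symfZl a c (n : int) : symf (a *~ n) c = n * symf a c.
Proof.
rewrite !symfE mulr_sumr; apply: eq_bigr => v _.
rewrite mulr_sumr; apply: eq_bigr => w _ /=.
by rewrite ffunMzE /= -mulrzl intz; ring.
Qed.

Lemma symf_even a : exists k : int, symf a a = k *+ 2.
Proof. by exists (euler a a); rewrite euler_symf. Qed.

Lemma pfun_symf a : pfun a *+ 2 = 2 - symf a a.
Proof. by rewrite /pfun -euler_symf; lia. Qed.

Lemma narr_gt0 v w : reflect (exists x : arr Q, atail x = v /\ ahead x = w) (0 < narr v w).
Proof.
apply: (iffP idP) => [|[x [tx hx]]].
  case: (pickP (fun x : arr Q => (atail x == v) && (ahead x == w))) => [x /andP[/eqP tx /eqP hx] _|no].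
    by exists x.
  by rewrite /narr big1 // => x _; rewrite no.
rewrite /narr (bigD1 x) //= tx hx !eqxx; apply: ltr_pwDl => //.
exact: sumr_ge0.
Qed.

Lemma loopfree_cart v : loopfree v <-> cart v v = 2.
Proof.
rewrite cart_diag; split=> [lf | c2 x [tx hx]].
  suff n0 : ~ 0 < narr v v by have := narr_ge0 v v; lia.
  by case/narr_gt0 => x /lf.
have : 0 < narr v v by apply/narr_gt0; exists x.
lia.
Qed.

Lemma cart_gt0 v : 0 < cart v v -> cart v v = 2.
Proof. have := narr_ge0 v v; rewrite cart_diag; lia. Qed.

Lemma adjacent_cart v w : v != w -> adjacent v w = (cart v w < 0).
Proof.
move=> vw; rewrite /cart (negbTE vw) mul0rn sub0r oppr_lt0.
apply/existsP/idP => [[x /orP[]/andP[/eqP tx /eqP hx]]|].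
- have : 0 < narr v w by apply/narr_gt0; exists x.
  have := narr_ge0 w v; lia.
- have : 0 < narr w v by apply/narr_gt0; exists x.
  have := narr_ge0 v w; lia.
- have := narr_ge0 v w; have := narr_ge0 w v => n1 n2 np.
  have [/narr_gt0[x [tx hx]]|n] := boolP (0 < narr v w).
    by exists x; rewrite tx hx !eqxx.
  have /narr_gt0[x [tx hx]] : 0 < narr w v by lia.
  by exists x; rewrite tx hx !eqxx orbT.
Qed.

Lemma adjacentC v w : adjacent v w = adjacent w v.
Proof. by apply/existsP/existsP => -[x hx]; exists x; rewrite orbC. Qed.

Lemma nonneg_symf_coord_le a v : nonneg a -> symf a (coord_vec v) <= a v * cart v v.
Proof.
move=> a0; rewrite symf_coordr (bigD1 v) //= gerDl; apply: sumr_le0 => w wv.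
exact: mulr_ge0_le0 (a0 w) (cart_le0 wv).
Qed.

Lemma nonneg_symf_coord_out a v : nonneg a -> a v = 0 -> symf a (coord_vec v) <= 0.
Proof. by move=> a0 av; have := nonneg_symf_coord_le v a0; rewrite av mul0r. Qed.

Lemma reflectionE v a : reflection v a = a - coord_vec v *~ symf a (coord_vec v).
Proof. by apply/ffunP => w; rewrite !ffunE ffunMzE ffunE -mulrzr mulrC intz. Qed.

Lemma reflection_neq v a w : w != v -> reflection v a w = a w.
Proof. by move=> wv; rewrite !ffunE (negbTE wv) mulr0 subr0. Qed.

Lemma reflection_eq v a : reflection v a v = a v - symf a (coord_vec v).
Proof. by rewrite !ffunE eqxx mulr1. Qed.

Lemma reflectionD v a b : reflection v (a + b) = reflection v a + reflection v b.
Proof. by rewrite !reflectionE symfDl mulrzDr opprD addrACA. Qed.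

Lemma reflectionN v a : reflection v (- a) = - reflection v a.
Proof. by rewrite !reflectionE symfNl mulrNz opprD. Qed.

Lemma reflection0 v : reflection v 0 = 0.
Proof. by rewrite reflectionE symf0l mulr0z subr0. Qed.

Lemma reflection_sum v (s : seq (lattice Q)) :
  reflection v (\sum_(b <- s) b) = \sum_(b <- map (reflection v) s) b.
Proof.
elim: s => [|b s IH]; first by rewrite !big_nil reflection0.
by rewrite /= !big_cons reflectionD IH.
Qed.

Lemma reflectionMn v a n : reflection v (a *+ n) = reflection v a *+ n.
Proof. by elim: n => [|n IH]; rewrite ?mulr0n ?reflection0 // !mulrS reflectionD IH. Qed.

Lemma reflection_symf v a b : loopfree v ->
  symf (reflection v a) (reflection v b) = symf a b.
Proof.
move=> /loopfree_cart cv; rewrite !reflectionE symfBl !symfBr !symfZl.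
rewrite ![symf _ (_ *~ _)]symfC !symfZl symf_coord cv.
rewrite (symfC a b) ![symf (coord_vec v) _]symfC. ring.
Qed.

Lemma reflectionK v : loopfree v -> involutive (reflection v).
Proof.
move=> /loopfree_cart cv a; rewrite [in LHS]reflectionE.
have -> : symf (reflection v a) (coord_vec v) = - symf a (coord_vec v).
  rewrite reflectionE symfBl symfZl symf_coord cv; ring.
by rewrite reflectionE mulrNz opprK subrK.
Qed.

Lemma reflection_pfun v a : loopfree v -> pfun (reflection v a) = pfun a.
Proof.
by move=> lv; have := pfun_symf (reflection v a); have := pfun_symf a;
  rewrite reflection_symf //; lia.
Qed.

Lemma reflection_fix v a : symf a (coord_vec v) = 0 -> reflection v a = a.
Proof. by move=> s0; rewrite reflectionE s0 mulr0z subr0. Qed.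

Lemma reflection_coord v : loopfree v -> reflection v (coord_vec v) = - coord_vec v.
Proof.
move=> /loopfree_cart cv; rewrite reflectionE symf_coord cv mulrz_nat mulr2n.
by rewrite opprD addNKr.
Qed.

Lemma coord_nonneg v : nonneg (coord_vec v).
Proof. by move=> w; rewrite coordE. Qed.

Lemma coord_neq0 v : coord_vec v != 0.
Proof. by apply/eqP => /ffunP/(_ v); rewrite coordE ffunE eqxx. Qed.

Definition height a : int := \sum_v a v.

Lemma height_ge0 a : nonneg a -> 0 <= height a.
Proof. by move=> a0; apply: sumr_ge0 => v _; exact: a0. Qed.

Lemma height_eq0 a : nonneg a -> height a = 0 -> a = 0.
Proof.
move=> a0 h0; apply/ffunP => v; rewrite ffunE; apply/eqP.
have : height a == 0 by rewrite h0.
rewrite psumr_eq0 => [/allP/(_ v)/implyP|w _]; last exact: a0.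
by rewrite mem_index_enum; apply.
Qed.

Lemma heightD a b : height (a + b) = height a + height b.
Proof. by rewrite /height -big_split; apply: eq_bigr => v _; rewrite ffunE. Qed.

Lemma height_reflection v a : height (reflection v a) = height a - symf a (coord_vec v).
Proof.
have h1 : height (coord_vec v) = 1.
  rewrite /height -[RHS](sum_delta (fun=> 1) v).
  by apply: eq_bigr => w _; rewrite coordE mul1r.
have := heightD (reflection v a) (coord_vec v *~ symf a (coord_vec v)).
rewrite {1}reflectionE subrK => ->.
suff -> : height (coord_vec v *~ symf a (coord_vec v)) = symf a (coord_vec v) by lia.
rewrite -[RHS]mulr1 -h1 mulr_sumr; apply: eq_bigr => w _.
by rewrite ffunMzE -mulrzl intz.
Qed.

Lemma supp_gt0 a v : nonneg a -> (v \in supp a) = (0 < a v).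
Proof. by move=> a0; rewrite inE lt_def a0 andbT. Qed.

Lemma neq0_supp a : a != 0 -> exists v, a v != 0.
Proof.
move=> a0; case: (pickP (fun v => a v != 0)) => [v|no]; first by exists v.
by case/eqP: a0; apply/ffunP => v; rewrite ffunE; apply/eqP/negbFE/no.
Qed.

Lemma connected_in_ind (A : {set vert Q}) (P : vert Q -> Prop) v w :
  connected_in A -> v \in A -> w \in A -> P v ->
  (forall i l, i \in A -> l \in A -> adjacent i l -> P i -> P l) -> P w.
Proof.
move=> cA vA wA Pv step; have /connectP[p pth ->] := cA v w vA wA.
elim: p v vA Pv pth {cA wA w} => //= l p IH v vA Pv /andP[/and3P[_ lA vl] pth].
exact: IH (step _ _ vA lA vl Pv) pth.
Qed.

Section Params.
Variable K : fieldType.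
Implicit Types (q : {ffun vert Q -> K}) (th : lattice Q).

Lemma qpowD q a b : (forall v, q v != 0) -> qpow q (a + b) = qpow q a * qpow q b.
Proof. by move=> q0; rewrite -big_split; apply: eq_bigr => v _; rewrite ffunE expfzDr. Qed.

Lemma qpowN q a : qpow q (- a) = (qpow q a)^-1.
Proof. by rewrite -prodfV; apply: eq_bigr => v _; rewrite ffunE -invr_expz. Qed.

Lemma qpow_coord q v : qpow q (coord_vec v) = q v.
Proof.
rewrite /qpow (bigD1 v) //= coordE eqxx expr1z big1 ?mulr1 // => w wv.
by rewrite coordE eq_sym (negbTE wv) expr0z.
Qed.

Lemma dotpDr th a b : dotp th (a + b) = dotp th a + dotp th b.
Proof. by rewrite -big_split; apply: eq_bigr => v _; rewrite ffunE mulrDr. Qed.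

Lemma dotpNr th a : dotp th (- a) = - dotp th a.
Proof. by rewrite -sumrN; apply: eq_bigr => v _; rewrite ffunE mulrN. Qed.

Lemma qpowMz q a (n : int) : qpow q (a *~ n) = qpow q a ^ n.
Proof.
rewrite /qpow (big_morph (fun u : K => u ^ n) (fun s t : K => expfzMl s t n) (exp1rz _ n)).
by apply: eq_bigr => w _; rewrite ffunMzE -mulrzr intz exprz_exp.
Qed.

Lemma dotpMz th a (n : int) : dotp th (a *~ n) = dotp th a * n.
Proof.
rewrite /dotp mulr_suml; apply: eq_bigr => w _.
by rewrite ffunMzE -mulrzr intz mulrA.
Qed.

Lemma dotp_coord th v : dotp th (coord_vec v) = th v.
Proof. by rewrite -[RHS](sum_delta th v); apply: eq_bigr => w _; rewrite coordE. Qed.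

Lemma reflect_qE v q w : reflect_q v q w = q v ^ (- cart v w) * q w.
Proof. by rewrite ffunE symf_coord. Qed.

Lemma reflect_thE v th w : reflect_th v th w = th w - cart v w * th v.
Proof. by rewrite ffunE symf_coord. Qed.

Lemma reflect_q_neq0 v q : (forall w, q w != 0) -> forall w, reflect_q v q w != 0.
Proof. by move=> q0 w; rewrite reflect_qE mulf_neq0 // expfz_neq0. Qed.

Lemma reflect_qK v q : loopfree v -> (forall w, q w != 0) ->
  reflect_q v (reflect_q v q) = q.
Proof.
move=> /loopfree_cart cv q0; apply/ffunP => w; rewrite !reflect_qE cv.
rewrite mulrA -[X in (_ * X) ^ _]expr1z -expfzDr // exprz_exp -expfzDr //.
by rewrite -[RHS]mul1r; congr (_ * _); rewrite (_ : _ + _ = 0) ?expr0z //; ring.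
Qed.

Lemma reflect_thK v th : loopfree v -> reflect_th v (reflect_th v th) = th.
Proof.
by move=> /loopfree_cart cv; apply/ffunP => w; rewrite !reflect_thE cv; ring.
Qed.

Lemma qpow_reflect v q a : (forall w, q w != 0) -> loopfree v ->
  qpow (reflect_q v q) (reflection v a) = qpow q a.
Proof.
move=> q0 lv; have cv := (loopfree_cart v).1 lv.
have E (b : lattice Q) : qpow (reflect_q v q) b = q v ^ (- symf b (coord_vec v)) * qpow q b.
  rewrite /qpow symf_coordr -sumrN.
  rewrite (big_morph (exprz (q v)) (fun m n => expfzDr m n (q0 v)) (expr0z _)).
  rewrite -big_split; apply: eq_bigr => w _ /=.
  by rewrite reflect_qE expfzMl exprz_exp cartC; congr (_ ^ _ * _); ring.
rewrite E [in X in _ * X]reflectionE qpowD // qpowN.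
have -> : qpow q (coord_vec v *~ symf a (coord_vec v)) = q v ^ symf a (coord_vec v).
  by rewrite qpowMz qpow_coord.
have -> : symf (reflection v a) (coord_vec v) = - symf a (coord_vec v).
  by rewrite reflectionE symfBl symfZl symf_coord cv; ring.
by rewrite opprK mulrCA mulrV ?mulr1 // unitfE expfz_neq0.
Qed.

Lemma dotp_reflect v th a : loopfree v ->
  dotp (reflect_th v th) (reflection v a) = dotp th a.
Proof.
move=> lv; have cv := (loopfree_cart v).1 lv.
have E (b : lattice Q) : dotp (reflect_th v th) b = dotp th b - symf b (coord_vec v) * th v.
  rewrite /dotp symf_coordr mulr_suml -sumrB; apply: eq_bigr => w _.
  by rewrite reflect_thE cartC; ring.
have -> : dotp (reflect_th v th) (reflection v a)
    = dotp th (reflection v a) - symf (reflection v a) (coord_vec v) * th v by exact: E.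
have -> : symf (reflection v a) (coord_vec v) = - symf a (coord_vec v).
  by rewrite reflectionE symfBl symfZl symf_coord cv; ring.
rewrite reflectionE dotpDr dotpNr.
have -> : dotp th (coord_vec v *~ symf a (coord_vec v)) = th v * symf a (coord_vec v).
  by rewrite dotpMz dotp_coord.
ring.
Qed.

Lemma Nqt_sub q th a b : (forall v, q v != 0) -> Nqt q th a -> Nqt q th b ->
  nonneg (a - b) -> Nqt q th (a - b).
Proof.
move=> q0 [_ qa ta] [_ qb tb] ab; split=> //; first by rewrite qpowD // qpowN qa qb divr1.
by rewrite dotpDr dotpNr ta tb subr0.
Qed.

Lemma Nqt_reflect q th a v : (forall w, q w != 0) -> loopfree v ->
  nonneg (reflection v a) -> Nqt q th a ->
  Nqt (reflect_q v q) (reflect_th v th) (reflection v a).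
Proof. by move=> q0 lv ra [_ qa ta]; split; rewrite ?qpow_reflect ?dotp_reflect. Qed.

End Params.
End Lattice.

(** * Matrix representations *)

HB.instance Definition _ (K : fieldType) n :=
  Monoid.isLaw.Build 'M[K]_n 1%:M mulmx (@mulmxA K n n n n) (@mul1mx K n n) (@mulmx1 K n n).

Section MatrixLemmas.
Variable K : fieldType.

(** Sylvester's identity: both sides are the determinant of the block matrix with rows 1, -A and B,
    1, from which the unipotent [L] is split off on the left or on the right. *)
Lemma det_1Dmulmx_comm m n (A : 'M[K]_(m, n)) (B : 'M[K]_(n, m)) :
  \det (1%:M + A *m B) = \det (1%:M + B *m A).
Proof.
pose L := block_mx 1%:M 0 B 1%:M : 'M[K]_(m + n).
have E1 : block_mx 1%:M (- A) 0 (1%:M + B *m A) = invmx L *m block_mx 1%:M (- A) B 1%:M.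
  have uL : L \in unitmx by rewrite unitmxE det_lblock !det1 mulr1 unitr1.
  apply: (canRL (mulKmx uL)); rewrite mulmx_block !(mul1mx, mul0mx, mulmx1) !addr0.
  by rewrite mulmxN [1%:M + _]addrC addKr.
have E2 : block_mx (1%:M + A *m B) (- A) 0 1%:M *m L = block_mx 1%:M (- A) B 1%:M.
  by rewrite mulmx_block !(mul1mx, mul0mx, mulmx1, mulmx0) !add0r mulNmx addrK.
have dL : \det L = 1 by rewrite det_lblock !det1 mulr1.
have := congr1 determinant E1; rewrite -E2 !det_mulmx det_inv dL !det_ublock !det1.
by rewrite invr1 !mul1r !mulr1 => ->.
Qed.

Lemma unitmx_1Dmulmx_comm m n (A : 'M[K]_(m, n)) (B : 'M[K]_(n, m)) :
  (1%:M + A *m B \in unitmx) = (1%:M + B *m A \in unitmx).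
Proof. by rewrite !unitmxE det_1Dmulmx_comm. Qed.

Lemma invmx_comm n (A B : 'M[K]_n) : A *m B = B *m A -> A *m invmx B = invmx B *m A.
Proof.
move=> AB; have [uB|nB] := boolP (B \in unitmx); last by rewrite invmx_out.
by rewrite -[RHS](mulmxK uB) -(mulmxA _ A B) AB mulmxA mulVmx // mul1mx.
Qed.

Lemma invmxP n (A B : 'M[K]_n) : A *m B = 1%:M -> invmx A = B /\ A \in unitmx.
Proof.
by move=> AB; have [uA uB] := mulmx1_unit AB; split=> //; rewrite -[RHS](mulKmx uA) AB mulmx1.
Qed.

Lemma invmx_1Dmulmx m n (A : 'M[K]_(m, n)) (B : 'M[K]_(n, m)) :
  1%:M + A *m B \in unitmx ->
  invmx (1%:M + B *m A) = 1%:M - B *m invmx (1%:M + A *m B) *m A.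
Proof.
move=> uAB; apply: proj1 (invmxP _); rewrite mulmxBr mulmx1.
suff -> : (1%:M + B *m A) *m (B *m invmx (1%:M + A *m B) *m A) = B *m A by rewrite addrK.
have -> : (1%:M + B *m A) *m (B *m invmx (1%:M + A *m B) *m A)
   = B *m ((1%:M + A *m B) *m invmx (1%:M + A *m B)) *m A.
  by rewrite !mulmxA mulmxDl mul1mx mulmxDr mulmx1 !mulmxA.
by rewrite mulmxV // mulmx1.
Qed.

(** In finite dimension an invertible map that sends a subspace into itself sends it onto itself.
    Hence invariance under the localised elements never has to be required separately. *)
Lemma submx_invmx m n (U : 'M[K]_(m, n)) (A : 'M[K]_n) :
  A \in unitmx -> (U *m A <= U)%MS -> (U *m invmx A <= U)%MS.
Proof.
move=> uA UA; have : (U <= U *m A)%MS.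
  by have := mxrank_leqif_sup UA; move/leqifP; rewrite mxrankMfree ?row_free_unit //; case: ifP => //; rewrite ltnn.
by move=> /(submxMr (invmx A)); rewrite mulmxK.
Qed.

End MatrixLemmas.

(** * Representations by matrices and the change of orientation *)

Section Rep.
Variables (K : fieldType) (Q : quiver).
Local Notation D := (double_quiver Q).
Local Notation tl b := (@atail D b : vert Q).
Local Notation hd b := (@ahead D b : vert Q).
Implicit Types (b : arr D) (v w : vert Q) (eps : arr D -> bool).

Lemma starK : involutive (@star Q). Proof. by case. Qed.
Lemma tl_star b : tl (star b) = hd b. Proof. by case: b. Qed.
Lemma hd_star b : hd (star b) = tl b. Proof. by case: b. Qed.

Definition antisym eps := forall b, eps (star b) = ~~ eps b.

Definition std_sign b : bool := if b is inl _ then true else false.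
Lemma std_sign_antisym : antisym std_sign. Proof. by case. Qed.

Section Ambient.
Variable N : nat.
Implicit Types (E U : vert Q -> 'M[K]_N) (X : arr D -> 'M[K]_N).

Definition gfac eps X b : 'M[K]_N :=
  let F := 1%:M + X (star b) *m X b in if eps b then F else invmx F.

(* The spaces of the representation are the row spaces of the idempotents
   [E v], which need not be independent inside the ambient space; matrices act
   on row vectors, so that composition is read from left to right.  The signs
   [eps] allow an orientation other than that of the quiver. *)
Record is_rep (ord : seq (arr D)) eps (q : {ffun vert Q -> K}) E X : Prop := IsRep {
  rep_idem : forall v, E v *m E v = E v;
  rep_tl : forall b, E (tl b) *m X b = X b;
  rep_hd : forall b, X b *m E (hd b) = X b;
  rep_unit : forall b, 1%:M + X (star b) *m X b \in unitmx;
  rep_rel : forall v,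
    E v *m \big[mulmx/1%:M]_(b <- ord | hd b == v) gfac eps X b = q v *: E v }.

Definition subrep E X U : Prop :=
  (forall v, (U v <= E v)%MS) /\ (forall b, (U (tl b) *m X b <= U (hd b))%MS).

Definition dvec E : lattice Q := [ffun v => (\rank (E v))%:Z].

Definition stable_rep (th : lattice Q) E X : Prop :=
  [/\ dvec E != 0, dotp th (dvec E) = 0
    & forall U, subrep E X U -> (exists v, U v != 0) ->
        (exists v, ~~ (E v <= U v)%MS) -> dotp th (dvec U) < 0].

(** Only an arrow that passes from positive to negative is altered. The replacement turns 1 + X b* X
    b into its inverse, so that the factor [gfac] of each arrow stays the same under the new
    signs. *)
Definition flip eps eps' X b : 'M[K]_N :=
  if eps b && ~~ eps' b then - (invmx (1%:M + X b *m X (star b)) *m X b) else X b.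

Lemma flip_unit_inv X b : 1%:M + X b *m X (star b) \in unitmx ->
  1%:M - invmx (1%:M + X b *m X (star b)) *m X b *m X (star b)
    = invmx (1%:M + X b *m X (star b)).
Proof.
move=> u; rewrite -mulmxA.
rewrite -{2}[X b *m X (star b)](addKr 1%:M) mulmxDr mulVmx // mulmxN mulmx1.
by rewrite opprD opprK addrCA subrr addr0.
Qed.

Lemma flip_rep ord eps eps' q E X : antisym eps -> antisym eps' ->
  is_rep ord eps q E X -> is_rep ord eps' q E (flip eps eps' X).
Proof.
move=> ae ae' rX; have uX b : 1%:M + X b *m X (star b) \in unitmx.
  by rewrite unitmx_1Dmulmx_comm (rep_unit rX).
have FF b : 1%:M + flip eps eps' X (star b) *m flip eps eps' X b =
    if eps b == eps' b then 1%:M + X (star b) *m X b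
    else invmx (1%:M + X (star b) *m X b).
  rewrite /flip ae ae'; case: (eps b); case: (eps' b) => //=.
    by rewrite mulmxN mulmxA -invmx_1Dmulmx.
  rewrite starK mulNmx.
  by have := @flip_unit_inv X (star b); rewrite starK => -> //; rewrite (rep_unit rX).
have GG b : gfac eps' (flip eps eps' X) b = gfac eps X b.
  by rewrite /gfac FF; case: (eps b); case: (eps' b) => //=; rewrite invmxK.
split=> [v|b|b|b|v]; first exact: (rep_idem rX).
- rewrite /flip; case: ifP => _; last exact: (rep_tl rX).
  rewrite mulmxN mulmxA invmx_comm -?mulmxA ?(rep_tl rX) //.
  rewrite mulmxDl mulmxDr mul1mx mulmx1 mulmxA (rep_tl rX).
  by congr (_ + _); rewrite -[RHS]mulmxA -(hd_star b) (rep_hd rX).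
- rewrite /flip; case: ifP => _; last exact: (rep_hd rX).
  by rewrite mulNmx -mulmxA (rep_hd rX).
- by rewrite FF; case: ifP => _; rewrite ?unitmx_inv (rep_unit rX).
- by under eq_bigr => b _ do rewrite GG; exact: (rep_rel rX).
Qed.

(** The space [U] at the tail is invariant under the inverse of 1 + X b X b*, by the flipped maps,
    hence under this operator itself; composing it with the flipped map recovers [X b] up to
    sign. *)
Lemma flip_subrep ord eps eps' q E X U : antisym eps -> antisym eps' ->
  is_rep ord eps q E X -> subrep E (flip eps eps' X) U -> subrep E X U.
Proof.
move=> ae ae' rX [UE UX]; split=> // b; have uX : 1%:M + X b *m X (star b) \in unitmx.
  by rewrite unitmx_1Dmulmx_comm (rep_unit rX).
have UXb := UX b; have UXs := UX (star b); rewrite tl_star hd_star in UXs.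
have [/andP[eb eb']|ne] := boolP (eps b && ~~ eps' b); last by rewrite /flip (negbTE ne) in UXb.
have Fb : flip eps eps' X b = - (invmx (1%:M + X b *m X (star b)) *m X b).
  by rewrite /flip eb eb'.
have Fs : flip eps eps' X (star b) = X (star b) by rewrite /flip ae eb.
have UW : (U (tl b) *m invmx (1%:M + X b *m X (star b)) <= U (tl b))%MS.
  rewrite -flip_unit_inv // mulmxBr mulmx1 addmx_sub // -mulmxN -mulNmx -Fb -Fs mulmxA.
  exact: submx_trans (submxMr _ UXb) UXs.
have {}UW : (U (tl b) *m (1%:M + X b *m X (star b)) <= U (tl b))%MS.
  by have := submx_invmx _ UW; rewrite invmxK unitmx_inv; apply.
have -> : X b = - ((1%:M + X b *m X (star b)) *m flip eps eps' X b).
  by rewrite Fb mulmxN opprK mulmxA mulmxV // mul1mx.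
rewrite mulmxN eqmx_opp mulmxA; exact: submx_trans (submxMr _ UW) UXb.
Qed.

Lemma flip_stable ord eps eps' q th E X : antisym eps -> antisym eps' ->
  is_rep ord eps q E X -> stable_rep th E X -> stable_rep th E (flip eps eps' X).
Proof.
move=> ae ae' rX [d0 t0 st]; split=> // U UF; exact: st (flip_subrep ae ae' rX UF).
Qed.

End Ambient.

Definition has_stable (ord : seq (arr D)) (q : {ffun vert Q -> K}) (th a : lattice Q) :=
  exists N (E : vert Q -> 'M[K]_N) X,
    [/\ is_rep ord std_sign q E X, stable_rep th E X & dvec E = a].

Lemma has_stable_sign ord eps q th a : antisym eps ->
  has_stable ord q th a <->
  exists N (E : vert Q -> 'M[K]_N) X,
    [/\ is_rep ord eps q E X, stable_rep th E X & dvec E = a].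
Proof.
move=> ae; have as_ := std_sign_antisym.
split=> -[N [E [X [rX sX dE]]]].
  exists N, E, (flip std_sign eps X); split=> //; first exact: flip_rep.
  exact: flip_stable rX sX.
exists N, E, (flip eps std_sign X); split=> //; first exact: flip_rep.
exact: flip_stable rX sX.
Qed.

End Rep.

Section DoubleSums.
Variable Q : quiver.
Local Notation D := (double_quiver Q).
Local Notation tl b := (@atail D b : vert Q).
Local Notation hd b := (@ahead D b : vert Q).
Variable ord : seq (arr D).
Hypothesis ord_enum : perm_eq ord (enum (arr D)).

Lemma mem_ord b : b \in ord.
Proof. by rewrite (perm_mem ord_enum) mem_enum. Qed.

Lemma ord_uniq : uniq ord.
Proof. by rewrite (perm_uniq ord_enum) enum_uniq. Qed.

Lemma sum_double v (f : vert Q -> int) :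
  \sum_(b <- ord | hd b == v) f (tl b) = \sum_w (narr v w + narr w v) * f w.
Proof.
rewrite (perm_big _ ord_enum) /= big_enum_cond /=.
transitivity (\sum_(b : arr Q + arr Q) if hd b == v then f (tl b) else 0).
  by rewrite big_mkcond.
rewrite big_sumType /=; under [RHS]eq_bigr => w _ do rewrite mulrDl.
rewrite big_split addrC; congr (_ + _).
- under [RHS]eq_bigr => w _ do rewrite mulr_suml.
  rewrite exchange_big; apply: eq_bigr => x _ /=; case: eqP => _ /=; last first.
    by rewrite big1 // => w _; rewrite mul0r.
  rewrite -[LHS](sum_delta f (ahead x)); apply: eq_bigr => w _.
  by rewrite mulrC.
- under [RHS]eq_bigr => w _ do rewrite mulr_suml.
  rewrite exchange_big; apply: eq_bigr => x _ /=; case: eqP => hx /=; last first.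
    by rewrite big1 // => w _; rewrite andbF mul0r.
  rewrite -[LHS](sum_delta f (atail x)); apply: eq_bigr => w _.
  by rewrite andbT mulrC.
Qed.

Lemma sum_double_cart v (f : vert Q -> int) : loopfree v ->
  \sum_(b <- ord | hd b == v) f (tl b) = \sum_(w | w != v) - cart v w * f w.
Proof.
move=> /loopfree_cart cv; rewrite sum_double (bigD1 v) //=.
have -> : narr v v + narr v v = 0 by have := cart_diag v; lia.
rewrite mul0r add0r; apply: eq_bigr => w wv.
by rewrite /cart eq_sym (negbTE wv) mul0rn sub0r opprK.
Qed.

Lemma prod_double (K : fieldType) v w (x : K) : x != 0 -> v != w ->
  \prod_(b <- ord | hd b == w) (if tl b == v then x else 1) = x ^ (- cart v w).
Proof.
move=> x0 vw; have : - cart v w = \sum_(b <- ord | hd b == w) (tl b == v)%:Z.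
  rewrite (sum_double w (fun u => (u == v)%:Z)).
  under eq_bigr => u _ do rewrite [u == v]eq_sym.
  by rewrite sum_delta /cart (negbTE vw) mul0rn sub0r opprK addrC.
move=> ->; rewrite (big_morph (exprz x) (fun m n => expfzDr m n x0) (expr0z _)).
by apply: eq_bigr => b _; case: (tl b == v); rewrite ?expr1z ?expr0z.
Qed.

End DoubleSums.

Section MoreMatrix.
Variable K : fieldType.

Lemma invmx_ublock1 m n (A : 'M[K]_m) : A \in unitmx ->
  invmx (block_mx A 0 0 (1%:M : 'M_n)) = block_mx (invmx A) 0 0 1%:M.
Proof.
move=> uA; apply: proj1 (invmxP _).
by rewrite mulmx_block !(mul0mx, mulmx0, mul1mx) !(addr0, add0r) mulmxV // -scalar_mx_block.
Qed.

Lemma unitmx_ublock1 m n (A : 'M[K]_m) :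
  (block_mx A 0 0 (1%:M : 'M_n) \in unitmx) = (A \in unitmx).
Proof. by rewrite !unitmxE det_ublock det1 mulr1. Qed.

Lemma unitmx_dblock1 m n (A : 'M[K]_n) :
  (block_mx (1%:M : 'M_m) 0 0 A \in unitmx) = (A \in unitmx).
Proof. by rewrite !unitmxE det_ublock det1 mul1r. Qed.

Lemma idem_unit n (E : 'M[K]_n) (s : K) : E *m E = E -> s != 0 ->
  (1%:M + (s - 1) *: E) *m (1%:M + (s^-1 - 1) *: E) = 1%:M.
Proof.
move=> EE s0; rewrite mulmxDl mul1mx mulmxDr mulmx1 -scalemxAl -scalemxAr EE.
rewrite -[RHS]addr0 -addrA; congr (_ + _); rewrite addrC -addrA scalerA -!scalerDl.
by rewrite (_ : _ + _ = 0) ?scale0r //; field.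
Qed.

(** The recurrence is solved by h_i = (product of the factors before i) p_i. It is stated for any
    [h] that satisfies it, because for the reflected representation [h] is known first and [p] is
    derived from it. *)
Lemma prod_expand r N n (p h : 'I_n -> 'M[K]_(r, N)) (c : 'I_n -> 'M[K]_(N, r)) :
  (forall i, h i = p i + \sum_(l < n | (l < i)%N) h l *m (c l *m p i)) ->
  \big[mulmx/1%:M]_(i < n) (1%:M + p i *m c i) = 1%:M + \sum_(i < n) h i *m c i.
Proof.
elim: n p h c => [|n IH] p h c hE; first by rewrite !big_ord0 addr0.
have wE (i : 'I_n) F : \sum_(l < n.+1 | (l < i)%N) F l
    = \sum_(l < n | (l < i)%N) F (widen_ord (leqnSn n) l) :> 'M[K]_(r, N).
  rewrite big_mkcond big_ord_recr /= ltnNge ltnW ?ltn_ord //= addr0.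
  by rewrite [RHS]big_mkcond.
have := IH (fun i => p (widen_ord (leqnSn n) i)) (fun i => h (widen_ord (leqnSn n) i))
  (fun i => c (widen_ord (leqnSn n) i)); rewrite /= => {}IH.
rewrite !big_ord_recr /=.  rewrite IH => [|i]; last by rewrite hE wE.
rewrite mulmxDr mulmx1 -addrA; congr (_ + (_ + _)); rewrite mulmxA mulmxDl mul1mx.
congr (_ *m _); rewrite hE; congr (_ + _).
rewrite [RHS]big_mkcond big_ord_recr /= ltnn addr0 mulmx_suml.
by apply: eq_bigr => l _; rewrite ltn_ord mulmxA.
Qed.

Lemma prod_expand_ex r N n (p : 'I_n -> 'M[K]_(r, N)) (c : 'I_n -> 'M[K]_(N, r)) :
  exists h : 'I_n -> 'M[K]_(r, N),
    forall i, h i = p i + \sum_(l < n | (l < i)%N) h l *m (c l *m p i).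
Proof.
pose ext A (f : 'I_n -> A) (d : A) k := if insub k is Some i then f i else d.
have extE A (f : 'I_n -> A) d (i : 'I_n) : ext A f d i = f i by rewrite /ext valK.
pose p' := ext _ p 0; pose c' := ext _ c 0.
pose H k := \big[mulmx/1%:M]_(0 <= l < k) (1%:M + p' l *m c' l).
have HE k : H k = 1%:M + \sum_(0 <= l < k) H l *m p' l *m c' l.
  elim: k => [|k IH]; first by rewrite /H !big_geq // addr0.
  by rewrite {1}/H !big_nat_recr //= -/(H k) mulmxDr mulmx1 {1}IH -!addrA mulmxA.
exists (fun i : 'I_n => H i *m p i) => i; rewrite {1}HE mulmxDl mul1mx; congr (_ + _).
rewrite big_mkord (big_ord_widen n (fun l => H l *m p' l *m c' l)) 1?ltnW ?ltn_ord //.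
rewrite mulmx_suml; apply: eq_bigr => l _.
by rewrite /p' /c' !extE !mulmxA.
Qed.

End MoreMatrix.

(** * Reflection of representations *)

Section Reflect.
Variables (K : fieldType) (Q : quiver).
Local Notation D := (double_quiver Q).
Local Notation tl b := (@atail D b : vert Q).
Local Notation hd b := (@ahead D b : vert Q).
Variable ord : seq (arr D).
Hypothesis ord_enum : perm_eq ord (enum (arr D)).
Variable v : vert Q.
Hypothesis lfv : loopfree v.

(** With all arrows at [v] oriented towards [v], the relation at [v] is a product of factors 1 + p c
    without inverses. *)
Definition sink_sign (b : arr D) : bool :=
  if hd b == v then true else if tl b == v then false else std_sign b.

Lemma loopfree_double (b : arr D) : hd b = v -> tl b != v.
Proof.
case: b => x /= hx; apply/eqP => tx; apply: (lfv (x := x)); by split.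
Qed.

Lemma sink_sign_antisym : antisym sink_sign.
Proof.
move=> b; rewrite /sink_sign hd_star tl_star; case: (eqVneq (hd b) v) => hb.
  by rewrite (negbTE (loopfree_double hb)).
by case: ifP => // _; exact: std_sign_antisym.
Qed.

Section Ambient.
Variables (N : nat) (q : {ffun vert Q -> K}) (E : vert Q -> 'M[K]_N) (X : arr D -> 'M[K]_N).
Hypothesis qv0 : q v != 0.
Hypothesis rX : is_rep ord sink_sign q E X.
Local Notation s := (q v)^-1.

Variables (r : nat) (c' : arr D -> 'M[K]_(N, r)) (p' : arr D -> 'M[K]_(r, N)).
Hypothesis c'_tl : forall b, hd b = v -> E (tl b) *m c' b = c' b.
Hypothesis p'_tl : forall b, hd b = v -> p' b *m E (tl b) = p' b.
Hypothesis cp' : forall b, hd b = v ->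
  c' b *m p' b = s *: (X b *m X (star b)) + (s - 1) *: E (tl b).
Hypothesis prod' :
  \big[mulmx/1%:M]_(b <- ord | hd b == v) (1%:M + p' b *m c' b) = s%:M.

(** The new space at [v] has no natural place in the old ambient space and gets a block of its
    own. *)
Definition refl_E w : 'M[K]_(N + r) :=
  if w == v then block_mx 0 0 0 1%:M else block_mx (E w) 0 0 0.

Definition refl_X b : 'M[K]_(N + r) :=
  if hd b == v then block_mx 0 (c' b) 0 0
  else if tl b == v then block_mx 0 0 (p' (star b)) 0
  else block_mx (X b) 0 0 0.

Let simpb := (mulmx_block, mul0mx, mulmx0, mul1mx, mulmx1, addr0, add0r).

Lemma refl_unit_tl b : hd b = v ->
  1%:M + c' b *m p' b = (1%:M + X b *m X (star b)) *m (1%:M + (s - 1) *: E (tl b)).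
Proof.
move=> hb; rewrite cp' // mulmxDl mul1mx mulmxDr mulmx1 -scalemxAr -mulmxA.
have -> : X (star b) *m E (tl b) = X (star b) by rewrite -hd_star (rep_hd rX).
rewrite -!addrA; congr (_ + _); rewrite addrC; congr (_ + _).
by rewrite scalerBl scale1r addrC subrK.
Qed.

Lemma refl_unitP b : hd b = v -> 1%:M + c' b *m p' b \in unitmx.
Proof.
move=> hb; rewrite refl_unit_tl // unitmx_mul unitmx_1Dmulmx_comm (rep_unit rX) /=.
have s0 : s != 0 by rewrite invr_eq0.
by have /mulmx1_unit[] := idem_unit (rep_idem rX (tl b)) s0.
Qed.

Lemma refl_FE b : 1%:M + refl_X (star b) *m refl_X b =
  if hd b == v then block_mx 1%:M 0 0 (1%:M + p' b *m c' b)
  else if tl b == v then block_mx (1%:M + c' (star b) *m p' (star b)) 0 0 1%:M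
  else block_mx (1%:M + X (star b) *m X b) 0 0 1%:M.
Proof.
rewrite /refl_X hd_star tl_star starK scalar_mx_block.
case: (eqVneq (hd b) v) => hb; first by rewrite (negbTE (loopfree_double hb)) !simpb add_block_mx !simpb.
by case: ifP => _; rewrite !simpb add_block_mx !simpb.
Qed.

Lemma gfac_comm w b : hd b = w -> E w *m gfac sink_sign X b = gfac sink_sign X b *m E w.
Proof.
move=> <-; have comm : E (hd b) *m (1%:M + X (star b) *m X b)
    = (1%:M + X (star b) *m X b) *m E (hd b).
  rewrite mulmxDl mulmxDr mul1mx mulmx1 -(mulmxA _ (X b)) (rep_hd rX).
  by congr (_ + _); rewrite mulmxA -{1}tl_star (rep_tl rX).
by rewrite /gfac; case: (sink_sign b) => //; exact: invmx_comm.
Qed.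

Lemma refl_gfac w b : w != v -> hd b = w ->
  refl_E w *m gfac sink_sign refl_X b =
  block_mx ((if tl b == v then q v else 1) *: (E w *m gfac sink_sign X b)) 0 0 0.
Proof.
move=> wv hb; rewrite /refl_E (negbTE wv) /gfac refl_FE /sink_sign hb (negbTE wv).
case: (eqVneq (tl b) v) => tb.
  have hs : hd (star b) = v by rewrite hd_star.
  rewrite invmx_ublock1 ?refl_unitP // !simpb refl_unit_tl // starK tl_star hb.
  congr block_mx; set F := 1%:M + X (star b) *m X b; set G := 1%:M + _ *: _.
  have s0 : s != 0 by rewrite invr_eq0.
  have [iG uG] := invmxP (idem_unit (rep_idem rX w) s0).
  have [_ uF'] := mulmx1_unit (mulmxV (rep_unit rX b)).
  have iFG : invmx (F *m G) = invmx G *m invmx F.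
    apply: proj1 (invmxP _); rewrite -mulmxA (mulmxA G) mulmxV // mul1mx mulmxV //.
    exact: rep_unit rX b.
  rewrite iFG iG mulmxA invrK mulmxDr mulmx1 -scalemxAr (rep_idem rX).
  by rewrite scalerBl scale1r addrC subrK -scalemxAl.
case: (std_sign b); first by rewrite !simpb scale1r.
by rewrite invmx_ublock1 ?(rep_unit rX) // !simpb scale1r.
Qed.

Lemma refl_idem w : refl_E w *m refl_E w = refl_E w.
Proof. by rewrite /refl_E; case: ifP => _; rewrite !simpb ?(rep_idem rX). Qed.

Lemma refl_rel w : w != v -> refl_E w *m \big[mulmx/1%:M]_(b <- ord | hd b == w) gfac sink_sign refl_X b
  = block_mx (\prod_(b <- ord | hd b == w) (if tl b == v then q v else 1)
      *: (E w *m \big[mulmx/1%:M]_(b <- ord | hd b == w) gfac sink_sign X b)) 0 0 0.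
Proof.
move=> wv; elim: ord => [|b t IH].
  by rewrite !big_nil !mulmx1 scale1r /refl_E (negbTE wv).
rewrite !big_cons; case: eqP => // hb.
rewrite mulmxA refl_gfac // gfac_comm //.
set u := if _ then _ else _; set G := gfac _ _ _; rewrite mulmxA.
have -> : block_mx (u *: (G *m E w)) 0 0 0
    = block_mx (u *: G) 0 0 0 *m refl_E w :> 'M_(N + r).
  by rewrite /refl_E (negbTE wv) !simpb -scalemxAl.
rewrite -mulmxA IH !simpb gfac_comm // -/G.
by rewrite -scalemxAl -scalemxAr scalerA -!mulmxA.
Qed.

Lemma refl_is_rep : is_rep ord sink_sign (reflect_q v q) refl_E refl_X.
Proof.
split=> [w|b|b|b|w]; first exact: refl_idem.
- rewrite /refl_E /refl_X; case: (eqVneq (hd b) v) => hb.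
    by rewrite (negbTE (loopfree_double hb)) !simpb c'_tl.
  by case: ifP => _; rewrite !simpb ?(rep_tl rX).
- rewrite /refl_E /refl_X; case: (eqVneq (hd b) v) => hb; first by rewrite !simpb.
  case: eqP => tb; rewrite !simpb ?(rep_hd rX) // -(tl_star b) p'_tl //.
  by rewrite hd_star.
- rewrite refl_FE; case: eqP => hb.
    by rewrite unitmx_dblock1 -unitmx_1Dmulmx_comm refl_unitP.
  case: eqP => tb; last by rewrite unitmx_ublock1 (rep_unit rX).
  by rewrite unitmx_ublock1 refl_unitP // hd_star.
- have [->|wv] := eqVneq w v; last first.
    rewrite refl_rel // (prod_double ord_enum) // 1?eq_sym // (rep_rel rX) scalerA.
    by rewrite reflect_qE /refl_E (negbTE wv) scale_block_mx !scaler0.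
  have cv := (loopfree_cart v).1 lfv.
  have gE b : hd b == v -> gfac sink_sign refl_X b
      = block_mx 1%:M 0 0 (1%:M + p' b *m c' b).
    by move=> hb; rewrite /gfac refl_FE /sink_sign hb.
  rewrite (eq_bigr _ gE).
  have -> : \big[mulmx/1%:M]_(b <- ord | hd b == v) block_mx 1%:M 0 0 (1%:M + p' b *m c' b)
     = block_mx 1%:M 0 0 (\big[mulmx/1%:M]_(b <- ord | hd b == v) (1%:M + p' b *m c' b))
     :> 'M_(N + r).
    elim: ord => [|b t IH]; first by rewrite !big_nil -scalar_mx_block.
    by rewrite !big_cons; case: ifP => // _; rewrite IH !simpb.
  rewrite prod' /refl_E eqxx !simpb reflect_qE cv scale_block_mx !scaler0.
  rewrite (_ : q v ^ (- 2) * q v = s) ?scalemx1 //.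
  by rewrite -{2}[q v]expr1z -expfzDr.
Qed.

Lemma rank_refl_E w : \rank (refl_E w) = if w == v then r else \rank (E w).
Proof.
by rewrite /refl_E; case: ifP => _; rewrite rank_diag_block_mx ?mxrank1 !mxrank0 ?addn0.
Qed.

Hypothesis rank_r : (r%:Z + (\rank (E v))%:Z = \sum_(b <- ord | hd b == v) (\rank (E (tl b)))%:Z)%R.

Lemma refl_dvec : dvec refl_E = reflection v (dvec E).
Proof.
apply/ffunP => w; have cv := (loopfree_cart v).1 lfv.
have [->|wv] := eqVneq w v; last first.
  by rewrite reflection_neq // !ffunE rank_refl_E (negbTE wv).
rewrite reflection_eq !ffunE rank_refl_E eqxx symf_coordr (bigD1 v) //= cv ffunE.
have := rank_r; rewrite (sum_double_cart ord_enum (fun u => (\rank (E u))%:Z)) //.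
have -> : \sum_(w | w != v) - cart v w * (\rank (E w))%:Z = - \sum_(w | w != v) dvec E w * cart w v.
  by rewrite -sumrN; apply: eq_bigr => u _; rewrite ffunE cartC; ring.
set S := \sum_(w | _) _; move: (\rank (E v)) => n rn. lia.
Qed.

Variable th : lattice Q.
Hypothesis stX : stable_rep th E X.

(* [W] is the new space at [v] of a subrepresentation of the reflected
   representation and [Uv] the space at [v] of a subrepresentation of the
   original one. *)
Hypothesis transfer : forall (U : vert Q -> 'M[K]_N) (W : 'M[K]_r),
  (forall w, (U w <= E w)%MS) ->
  (forall b, hd b = v -> (U (tl b) *m c' b <= W)%MS) ->
  (forall b, hd b = v -> (W *m p' b <= U (tl b))%MS) ->
  [/\ exists Uv : 'M[K]_N, [/\ (Uv <= E v)%MS,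
         forall b, hd b = v -> (U (tl b) *m X b <= Uv)%MS,
         forall b, hd b = v -> (Uv *m X (star b) <= U (tl b))%MS &
         (th v * (\sum_(b <- ord | hd b == v) (\rank (U (tl b)))%:Z - (\rank W)%:Z)
            <= th v * (\rank Uv)%:Z)%R],
      (forall b, hd b = v -> U (tl b) = 0) -> W != 0 -> (0 < th v)%R
    & (forall b, hd b = v -> (E (tl b) <= U (tl b))%MS) -> (\rank W < r)%N -> (th v < 0)%R].

(** A subrepresentation [U'] is compared with the subrepresentation [V] that agrees with it away
    from [v] and has [Uv] at [v]; the rank inequality of [transfer] compares their theta-values. If
    [V] is zero or everything, stability of the original says nothing about it, and the last two
    clauses of [transfer] take over. *)
Lemma refl_stable : dvec refl_E != 0 -> stable_rep (reflect_th v th) refl_E refl_X.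
Proof.
move=> d0; have [dE tE st] := stX; split=> //; first by rewrite refl_dvec dotp_reflect.
move=> U' [U'E U'X] [w0 nz] [w1 pr].
have [Rv U'v] : exists Rv, U' v = row_mx 0 Rv.
  exists (rsubmx (U' v)); have := U'E v; rewrite /refl_E eqxx => /submxP[Z ->].
  by rewrite -[Z]hsubmxK mul_row_block !simpb row_mxKr.
have [L U'w] : exists L, forall w, w != v -> U' w = row_mx (L w) 0.
  exists (fun w => lsubmx (U' w)) => w wv; have := U'E w; rewrite /refl_E (negbTE wv) => /submxP[Z ->].
  by rewrite -[Z]hsubmxK mul_row_block !simpb row_mxKl.
pose U w : 'M[K]_N := <<L w>>%MS; pose W : 'M[K]_r := <<Rv>>%MS.
have rowl m1 m2 (A : 'M[K]_(m1, N)) (B : 'M[K]_(m2, N)) :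
    (row_mx A (0 : 'M_(m1, r)) <= row_mx B (0 : 'M_(m2, r)))%MS = (A <= B)%MS.
  apply/idP/idP => /submxP[Z H]; apply/submxP; exists Z.
    by move: H; rewrite mul_mx_row mulmx0 => /eq_row_mx[].
  by rewrite H mul_mx_row mulmx0.
have rowr m1 m2 (A : 'M[K]_(m1, r)) (B : 'M[K]_(m2, r)) :
    (row_mx (0 : 'M_(m1, N)) A <= row_mx (0 : 'M_(m2, N)) B)%MS = (A <= B)%MS.
  apply/idP/idP => /submxP[Z H]; apply/submxP; exists Z.
    by move: H; rewrite mul_mx_row mulmx0 => /eq_row_mx[].
  by rewrite H mul_mx_row mulmx0.
have rkW : \rank (U' v) = \rank W.
  rewrite U'v genmxE; apply/eqP; rewrite eqn_leq.
  have -> : row_mx 0 Rv = Rv *m row_mx (0 : 'M_(r, N)) 1%:M.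
    by rewrite mul_mx_row mulmx0 mulmx1.
  rewrite mxrankM_maxl /=.
  rewrite -{1}[Rv](_ : Rv *m row_mx (0 : 'M_(r, N)) 1%:M *m col_mx 0 1%:M = _).
    exact: mxrankM_maxl.
  by rewrite -mulmxA mul_row_col mulmx0 mulmx1 add0r mulmx1.
have rkU w : w != v -> \rank (U' w) = \rank (U w).
  move=> wv; rewrite U'w // genmxE; apply/eqP; rewrite eqn_leq.
  have -> : row_mx (L w) 0 = L w *m row_mx 1%:M (0 : 'M_(N, r)).
    by rewrite mul_mx_row mulmx0 mulmx1.
  rewrite mxrankM_maxl /=.
  rewrite -{1}[L w](_ : L w *m row_mx 1%:M (0 : 'M_(N, r)) *m col_mx 1%:M 0 = _).
    exact: mxrankM_maxl.
  by rewrite -mulmxA mul_row_col mulmx0 mulmx1 addr0 mulmx1.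
have UE w : w != v -> (U w <= E w)%MS.
  move=> wv; rewrite genmxE; have := U'E w; rewrite U'w // /refl_E (negbTE wv).
  rewrite -rowl => /submx_trans; apply.
  by rewrite /block_mx row_mx0 -addsmxE addsmx0 rowl.
pose U0 w := if w == v then 0 else U w.
have U0E w : (U0 w <= E w)%MS by rewrite /U0; case: eqVneq => [_|/UE//]; exact: sub0mx.
have U0t b : hd b = v -> U0 (tl b) = U (tl b).
  by move=> hb; rewrite /U0 (negbTE (loopfree_double hb)).
have Wc b : hd b = v -> (U0 (tl b) *m c' b <= W)%MS.
  move=> hb; have tv := loopfree_double hb; rewrite U0t // !genmxE.
  rewrite (eqmxMr _ (genmxE _)); have := U'X b; rewrite /refl_X hb eqxx.
  by rewrite (U'w (tl b)) // U'v mul_row_block !simpb rowr.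
have Wp b : hd b = v -> (W *m p' b <= U0 (tl b))%MS.
  move=> hb; have tv := loopfree_double hb; rewrite U0t // genmxE (eqmxMr _ (genmxE _)).
  have := U'X (star b); rewrite tl_star hd_star /refl_X hd_star tl_star hb eqxx starK (negbTE tv).
  by rewrite U'v (U'w (tl b)) // mul_row_block !simpb rowl.
have [[Uv [UvE UvX UvXs rkUv]] zeroW fullW] := transfer U0E Wc Wp.
pose V w := if w == v then Uv else U w.
have sV : subrep E X V.
  split=> [w|b]; first by rewrite /V; case: eqVneq => [->|/UE].
  rewrite /V; case: (eqVneq (hd b) v) => [hb|hb].
    by rewrite (negbTE (loopfree_double hb)) -U0t // UvX.
  case: (eqVneq (tl b) v) => [tb|tb].
    have := UvXs (star b); rewrite hd_star tl_star starK => /(_ tb).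
    by rewrite -[X in U0 X]/(hd b) /U0 (negbTE hb).
  rewrite (eqmxMr _ (genmxE _)) genmxE; have := U'X b; rewrite /refl_X (negbTE hb) (negbTE tb).
  by rewrite (U'w (tl b)) // (U'w (hd b)) // mul_row_block !simpb rowl.
have dotV : dotp th (dvec V) = th v * (\rank Uv)%:Z + \sum_(w | w != v) th w * (\rank (U w))%:Z.
  rewrite /dotp (bigD1 v) //= ffunE /V eqxx; congr (_ + _).
  by apply: eq_bigr => w wv; rewrite ffunE (negbTE wv).
have dotU : dotp (reflect_th v th) (dvec U') =
    th v * (\sum_(b <- ord | hd b == v) (\rank (U0 (tl b)))%:Z - (\rank W)%:Z)
      + \sum_(w | w != v) th w * (\rank (U w))%:Z.
  have cv := (loopfree_cart v).1 lfv.
  rewrite (sum_double_cart ord_enum (fun u => (\rank (U0 u))%:Z)) //.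
  rewrite /dotp (bigD1 v) //= reflect_thE ffunE rkW cv mulrBr mulr_sumr.
  rewrite [in RHS]addrAC -big_split /= [RHS]addrC; congr (_ + _); first by ring.
  apply: eq_bigr => w wv; rewrite reflect_thE ffunE rkU // /U0 (negbTE wv); ring.
have [Vz|/existsP[wz Vnz]] := boolP [forall w, V w == 0].
  have Uz w : w != v -> U w = 0.
    by move=> wv; move/forallP: Vz => /(_ w); rewrite /V (negbTE wv) => /eqP.
  have U0z w : U0 w = 0 by rewrite /U0; case: eqVneq => // /Uz.
  have W0 : W != 0.
    have w0v : w0 = v.
      apply/eqP; apply: contraNT nz => w0v; rewrite -mxrank_eq0 rkU // Uz //.
      by rewrite mxrank0.
    by rewrite -mxrank_eq0 -rkW mxrank_eq0 -w0v.
  have tv : 0 < th v by apply: zeroW.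
  rewrite dotU big1 => [|b _]; last by rewrite U0z mxrank0.
  rewrite sub0r big1 => [|w wv]; last by rewrite Uz // mxrank0 mulr0.
  rewrite addr0 mulrN oppr_lt0 mulr_gt0 // ltz_nat lt0n mxrank_eq0 //.
have [Vf|/existsP[wf Vnf]] := boolP [forall w, (E w <= V w)%MS]; last first.
  apply: le_lt_trans (st V sV _ _).
  - by rewrite dotU dotV lerD2r.
  - by exists wz.
  - by exists wf.
have Uf w : w != v -> (U w :=: E w)%MS.
  move=> wv; apply/eqmxP; rewrite UE //=.
  by move/forallP: Vf => /(_ w); rewrite /V (negbTE wv).
have rkWr : (\rank W < r)%N.
  have w1v : w1 = v.
    apply/eqP; apply: contraNT pr => w1v; rewrite U'w // /refl_E (negbTE w1v).
    rewrite /block_mx row_mx0 -addsmxE addsmx0 rowl -(genmxE (L w1)) -/(U w1).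
    by rewrite Uf.
  rewrite ltn_neqAle rank_leq_col andbT; apply: contra pr => fW.
  rewrite w1v /refl_E eqxx U'v /block_mx row_mx0 -addsmxE adds0mx rowr.
  by move: fW; rewrite sub1mx /row_full /W genmxE.
have tv : th v < 0.
  by apply: fullW rkWr => b hb; rewrite U0t // Uf ?loopfree_double.
have sumE : \sum_(b <- ord | hd b == v) (\rank (U0 (tl b)))%:Z = r%:Z + (\rank (E v))%:Z.
  by rewrite rank_r; apply: eq_bigr => b /eqP hb; rewrite U0t // Uf ?loopfree_double.
have t0 := tE; rewrite /dotp (bigD1 v) //= ffunE in t0; rewrite dotU sumE.
have -> : \sum_(w | w != v) th w * (\rank (U w))%:Z = - (th v * (\rank (E v))%:Z).
  apply/eqP; rewrite -addr_eq0 addrC; apply/eqP; rewrite -[RHS]t0; congr (_ + _).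
  by apply: eq_bigr => w wv; rewrite ffunE Uf.
have -> : th v * (r%:Z + (\rank (E v))%:Z - (\rank W)%:Z) - th v * (\rank (E v))%:Z
    = th v * (r%:Z - (\rank W)%:Z) by ring.
by rewrite pmulr_llt0 // subr_gt0 ltz_nat.
Qed.

End Ambient.
End Reflect.

(** * Block matrices that collect all arrows into one vertex *)

Section BlockLemmas.
Variables (K : fieldType) (n N : nat).

Lemma submx_mxcolP m k (A : 'I_n -> 'M[K]_(N, k)) (W : 'M[K]_(m, k)) :
  (\mxcol_(i < n) A i <= W)%MS <-> forall i, (A i <= W)%MS.
Proof.
rewrite eqmx_col; split=> [/sumsmx_subP AW i|AW].
  by rewrite -(genmxE (A i)); exact: AW.
by apply/sumsmx_subP => i _; rewrite genmxE.
Qed.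

Lemma submx_mxdiagP m (U : 'I_n -> 'M[K]_N) (A : 'I_n -> 'M[K]_(m, N)) :
  (\mxrow_(i < n) A i <= \mxdiag_(i < n) U i)%MS <-> forall i, (A i <= U i)%MS.
Proof.
split=> [/submxP[Z]|AU].
  rewrite -[Z]submxrowK mul_mxrow_mxdiag => /eq_mxrowP AE i.
  by rewrite AE submxMl.
have /fin_all_exists[Z ZE] : forall i, exists Z, A i = Z *m U i.
  by move=> i; apply/submxP.
apply/submxP; exists (\mxrow_i Z i); rewrite mul_mxrow_mxdiag.
by apply/eq_mxrowP.
Qed.

Lemma mul_mxdiag (U V : 'I_n -> 'M[K]_N) :
  \mxdiag_(i < n) U i *m \mxdiag_(i < n) V i = \mxdiag_(i < n) (U i *m V i).
Proof.
rewrite {2 3}/mxdiag mul_mxdiag_mxblock; apply/eq_mxblockP => i j.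
by case: eqVneq => [->|_]; rewrite ?mulmx0 // !conform_mx_id.
Qed.

Lemma submxblockZ (a : K) (A : 'M[K]_(\sum_(i < n) N, \sum_(i < n) N)) i j :
  submxblock (a *: A) i j = a *: submxblock A i j.
Proof. by apply/matrixP => x y; rewrite !mxE. Qed.

End BlockLemmas.

Section BlockReflect.
Variables (K : fieldType) (Q : quiver).
Local Notation D := (double_quiver Q).
Local Notation tl b := (@atail D b : vert Q).
Local Notation hd b := (@ahead D b : vert Q).
Variable ord : seq (arr D).
Hypothesis ord_enum : perm_eq ord (enum (arr D)).
Variable v : vert Q.
Hypothesis lfv : loopfree v.
Variables (N : nat) (q : {ffun vert Q -> K}) (E : vert Q -> 'M[K]_N) (X : arr D -> 'M[K]_N).
Hypothesis rX : is_rep ord (sink_sign v) q E X.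

Definition heads := [seq b <- ord | hd b == v].
Local Notation n := (size heads).
Definition headn (i : 'I_n) : arr D := tnth (in_tuple heads) i.
Local Notation t i := (tl (headn i)).
Local Notation c i := (X (headn i)).
Local Notation p i := (X (star (headn i))).
Variable h : 'I_n -> 'M[K]_N.
Hypothesis hE : forall i, h i = p i + \sum_(l < n | (l < i)%N) h l *m (c l *m p i).

Lemma hd_headn i : hd (headn i) = v.
Proof.
have := mem_tnth i (in_tuple heads); rewrite -[tnth _ _]/(headn i) mem_filter.
by case/andP => /eqP.
Qed.

Lemma headn_inj : injective headn.
Proof. by apply/tuple_uniqP; rewrite filter_uniq // (ord_uniq ord_enum). Qed.

Lemma headnP b : hd b = v -> exists i, b = headn i.
Proof.
move=> hb; have : b \in in_tuple heads by rewrite mem_filter hb eqxx (mem_ord ord_enum).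
by case/tnthP => i ->; exists i.
Qed.

Lemma sum_heads (R : nmodType) (f : arr D -> R) :
  \sum_(b <- ord | hd b == v) f b = \sum_(i < n) f (headn i).
Proof. by rewrite -big_filter big_tnth. Qed.

Lemma prod_heads m (f : arr D -> 'M[K]_m) :
  \big[mulmx/1%:M]_(b <- ord | hd b == v) f b = \big[mulmx/1%:M]_(i < n) f (headn i).
Proof. by rewrite -big_filter big_tnth. Qed.

Lemma h_tl i : h i *m E (t i) = h i.
Proof.
have pE : p i *m E (t i) = p i by rewrite -hd_star (rep_hd rX).
rewrite hE mulmxDl pE; congr (_ + _); rewrite mulmx_suml; apply: eq_bigr => l _.
by rewrite -!mulmxA pE.
Qed.

Lemma h_v i : E v *m h i = h i.
Proof.
have [k] := ubnP (i : nat); elim: k i => // k IH i ik.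
rewrite hE mulmxDr -{1}(hd_headn i) -tl_star (rep_tl rX); congr (_ + _).
rewrite mulmx_sumr; apply: eq_bigr => l li; rewrite mulmxA IH //.
exact: leq_trans li _.
Qed.

(** Here the relation at [v] becomes linear: by [prod_expand] its product is 1 + sum h_i c_i, and it
    acts on the space at [v] as q_v. *)
Lemma sum_hc : \sum_i h i *m c i = (q v - 1) *: E v.
Proof.
have := rep_rel rX v; rewrite prod_heads.
have -> : \big[mulmx/1%:M]_(i < n) gfac (sink_sign v) X (headn i) =
    \big[mulmx/1%:M]_(i < n) (1%:M + p i *m c i).
  by apply: eq_bigr => i _; rewrite /gfac /sink_sign hd_headn eqxx.
rewrite (prod_expand hE) mulmxDr mulmx1 mulmx_sumr.
under eq_bigr => i _ do rewrite mulmxA h_v.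
by move/(canRL (addKr _)) => ->; rewrite scalerBl scale1r addrC.
Qed.

Definition colC : 'M[K]_(\sum_(i < n) N, N) := \mxcol_i c i.
Definition rowH : 'M[K]_(N, \sum_(i < n) N) := \mxrow_i h i.
Definition diagE : 'M[K]_(\sum_(i < n) N) := \mxdiag_i E (t i).

Lemma rowH_colC : rowH *m colC = (q v - 1) *: E v.
Proof. by rewrite mul_mxrow_mxcol sum_hc. Qed.

Lemma diagE_idem : diagE *m diagE = diagE.
Proof. by rewrite mul_mxdiag; apply: eq_mxdiag => i; rewrite (rep_idem rX). Qed.

Lemma diagE_colC : diagE *m colC = colC.
Proof. by rewrite mul_mxdiag_mxcol; apply: eq_mxcol => i; rewrite (rep_tl rX). Qed.

Lemma rowH_diagE : rowH *m diagE = rowH.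
Proof. by rewrite mul_mxrow_mxdiag; apply/eq_mxrowP => i; rewrite h_tl. Qed.

Lemma rowH_v : E v *m rowH = rowH.
Proof. by rewrite mul_mxrow; apply/eq_mxrowP => i; rewrite h_v. Qed.

Lemma colC_v : colC *m E v = colC.
Proof. by rewrite mxcol_mul; apply: eq_mxcol => i; rewrite -{1}(hd_headn i) (rep_hd rX). Qed.

Hypothesis qv0 : q v != 0.
Local Notation s := (q v)^-1.

(** Its image lies in the kernel of [colC], and on that kernel inside [diagE] it is the scalar
    [s - 1]. A factorisation [M *m L] through a space of the right dimension yields the reflected
    representation. *)
Definition newP := s *: (colC *m rowH) + (s - 1) *: diagE.

Variables (r : nat) (L : 'M[K]_(r, \sum_(i < n) N)) (M : 'M[K]_(\sum_(i < n) N, r)).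
Hypothesis ML : M *m L = newP.
Hypothesis LM : L *m M = (s - 1)%:M.
Hypothesis L_diag : L *m diagE = L.
Hypothesis diag_M : diagE *m M = M.
Hypothesis rank_r : (r + \rank (E v) = \rank diagE)%N.

Let c1 i := submxcol M i.
Let h1 i := submxrow L i.
(** The recurrence for [h] solved for [p], but with the old products [c l *m p i]. This is
    legitimate because they agree with the new ones for l < i, as [c1p1] shows. *)
Let p1 i := h1 i - \sum_(l < n | (l < i)%N) h1 l *m (c l *m p i).
Let cD b := \sum_(i | headn i == b) c1 i.
Let pD b := \sum_(i | headn i == b) p1 i.

Let cDE i : cD (headn i) = c1 i.
Proof.
rewrite /cD (bigD1 i) //= big1 ?addr0 // => l /andP[/eqP/headn_inj -> ].
by rewrite eqxx.
Qed.

Let pDE i : pD (headn i) = p1 i.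
Proof.
rewrite /pD (bigD1 i) //= big1 ?addr0 // => l /andP[/eqP/headn_inj -> ].
by rewrite eqxx.
Qed.

Let c1_tl i : E (t i) *m c1 i = c1 i.
Proof.
have := diag_M; rewrite -[M]submxcolK mul_mxdiag_mxcol => /eq_mxcolP/(_ i).
by rewrite -/(c1 i).
Qed.

Let h1_tl i : h1 i *m E (t i) = h1 i.
Proof.
have := L_diag; rewrite -[L]submxrowK mul_mxrow_mxdiag => /eq_mxrowP/(_ i).
by rewrite -/(h1 i).
Qed.

Let c1h1 j i : c1 j *m h1 i = s *: (c j *m h i) + (if j == i then (s - 1) *: E (t i) else 0).
Proof.
have := congr1 (fun A => submxblock A j i) ML; rewrite /newP submxblockD !submxblockZ.
rewrite -[M]submxcolK -[L]submxrowK !mul_mxcol_mxrow !mxblockK => ->.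
congr (_ + _); case: eqVneq => [->|ji].
  by rewrite conform_mx_id.
by rewrite scaler0.
Qed.

(** By [c1h1] the subtracted sum contains [s] times the tail of the recurrence for [c j *m h i],
    which leaves [s *: (c j *m p i)]. For j < i its term l = j subtracts in addition
    [(s - 1) *: (c j *m p i)], and the scalar drops to 1. *)
Let c1p1 (j i : 'I_n) : (j <= i)%N ->
  c1 j *m p1 i = if j == i then s *: (c j *m p i) + (s - 1) *: E (t i) else c j *m p i.
Proof.
move=> ji; rewrite /p1 mulmxBr mulmx_sumr c1h1.
have -> : c j *m h i = c j *m p i + \sum_(l < n | (l < i)%N) c j *m h l *m (c l *m p i).
  rewrite hE mulmxDr mulmx_sumr; congr (_ + _); apply: eq_bigr => l _.
  by rewrite mulmxA.
have -> : \sum_(l < n | (l < i)%N) c1 j *m (h1 l *m (c l *m p i)) =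
    s *: (\sum_(l < n | (l < i)%N) c j *m h l *m (c l *m p i))
    + if (j < i)%N then (s - 1) *: (c j *m p i) else 0.
  under eq_bigr => l _ do rewrite mulmxA c1h1 mulmxDl.
  rewrite big_split /=; congr (_ + _).
    by rewrite scaler_sumr; apply: eq_bigr => l _; rewrite -scalemxAl.
  case: ltnP => [lji|lij]; last first.
    apply: big1 => l li; case: eqVneq => [jl|]; last by rewrite mul0mx.
    by move: li; rewrite -jl ltnNge lij.
  rewrite (bigD1 j) //= eqxx big1 => [|l /andP[_ lj]]; last first.
    by rewrite eq_sym (negbTE lj) mul0mx.
  by rewrite addr0 -scalemxAl mulmxA (rep_tl rX).
case: eqVneq => [->|ne]; first by rewrite ltnn addr0 scalerDr addrAC addrK.
have -> : (j < i)%N by rewrite ltn_neqAle ne ji.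
rewrite addr0 scalerDr opprD addrA addrK.
by rewrite scalerBl scale1r opprB addrCA subrr addr0.
Qed.

Let h1E i : h1 i = p1 i + \sum_(l < n | (l < i)%N) h1 l *m (c1 l *m p1 i).
Proof.
rewrite /p1 -/(p1 i) -addrA -[LHS]addr0; congr (_ + _); apply/esym/eqP.
rewrite addrC subr_eq0; apply/eqP/eq_bigr => l li.
rewrite c1p1; last exact: ltnW.
by case: eqVneq li => [->|//]; rewrite ltnn.
Qed.

Let cD_tl b : hd b = v -> E (tl b) *m cD b = cD b.
Proof. by move/headnP => [i ->]; rewrite cDE c1_tl. Qed.

Let p1_tl i : p1 i *m E (t i) = p1 i.
Proof.
rewrite /p1 mulmxBl h1_tl mulmx_suml; congr (_ - _); apply: eq_bigr => l _.
by rewrite -!mulmxA -(hd_star (headn i)) (rep_hd rX).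
Qed.

Let pD_tl b : hd b = v -> pD b *m E (tl b) = pD b.
Proof. by move/headnP => [i ->]; rewrite pDE p1_tl. Qed.

Let cpD b : hd b = v -> cD b *m pD b = s *: (X b *m X (star b)) + (s - 1) *: E (tl b).
Proof. by move/headnP => [i ->]; rewrite cDE pDE c1p1 // eqxx. Qed.

Let prodD : \big[mulmx/1%:M]_(b <- ord | hd b == v) (1%:M + pD b *m cD b) = s%:M.
Proof.
rewrite prod_heads; under eq_bigr => i _ do rewrite cDE pDE.
rewrite (prod_expand h1E) -mul_mxrow_mxcol submxrowK submxcolK LM.
by rewrite -raddfD addrC subrK.
Qed.

Let rank_rD : (r%:Z + (\rank (E v))%:Z
  = \sum_(b <- ord | hd b == v) (\rank (E (tl b)))%:Z)%R.
Proof.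
rewrite -PoszD rank_r rank_mxdiag (sum_heads (fun b => (\rank (E (tl b)))%:Z)).
by rewrite (big_morph Posz PoszD (erefl _)).
Qed.

Variable th : lattice Q.
Hypothesis stX : stable_rep th E X.
Hypothesis q0 : forall w, q w != 0.

Hypothesis transfer : forall (U : 'I_n -> 'M[K]_N) (W : 'M[K]_r)
   (Ub := \mxdiag_(i < n) U i : 'M[K]_(\sum_(i < n) N)),
  (Ub <= diagE)%MS -> Ub *m diagE = Ub -> (Ub *m M <= W)%MS -> (W *m L <= Ub)%MS ->
  [/\ exists Uv : 'M[K]_N, [/\ (Uv <= E v)%MS, (Ub *m colC <= Uv)%MS, (Uv *m rowH <= Ub)%MS
        & (th v * ((\rank Ub)%:Z - (\rank W)%:Z) <= th v * (\rank Uv)%:Z)%R],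
      Ub = 0 -> W != 0 -> (0 < th v)%R
    & (diagE <= Ub)%MS -> (\rank W < r)%N -> (th v < 0)%R].

(** For the new families the expanded product at [v] is 1 + L M, that is, (q_v)^-1. Invariance of
    subspaces under the single maps [p] and under the blocks of [h] is exchanged through the
    recurrence, in both the old and the new representation. *)
Lemma block_has_stable :
  has_stable ord (reflect_q v q) (reflect_th v th) (reflection v (dvec E)).
Proof.
apply/(has_stable_sign _ _ _ _ (sink_sign_antisym lfv)).
exists _, (refl_E v E r), (refl_X v X cD pD); split.
- exact: (refl_is_rep ord_enum lfv qv0 rX cD_tl pD_tl cpD prodD).
- apply: (refl_stable ord_enum lfv qv0 rank_rD stX) => //; last first.
    have [d0 _ _] := stX; rewrite (refl_dvec ord_enum lfv qv0 rank_rD).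
    apply: contra d0 => /eqP/(congr1 (reflection v)).
    by rewrite reflectionK // reflection0 => ->.
  move=> U W UE Uc Wp.
  have Wh i : (W *m h1 i <= U (t i))%MS.
    have [k] := ubnP (i : nat); elim: k i => // k IH i ik.
    have Wpi : (W *m p1 i <= U (t i))%MS by rewrite -pDE Wp // hd_headn.
    rewrite h1E mulmxDr addmx_sub // mulmx_sumr; apply: summx_sub => l li.
    rewrite !mulmxA; apply: submx_trans (submxMr _ (submxMr _ (IH l _))) _.
      exact: leq_trans li _.
    by apply: submx_trans (submxMr _ _) Wpi; rewrite -cDE Uc // hd_headn.
  pose Ui i := U (t i); pose Ub : 'M[K]_(\sum_(i < n) N) := \mxdiag_i Ui i.
  have UEE w : U w *m E w = U w.
    by have /submxP[Z ->] := UE w; rewrite -mulmxA (rep_idem rX).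
  have Ub_diag : Ub *m diagE = Ub.
    by rewrite mul_mxdiag; apply: eq_mxdiag => i; rewrite UEE.
  have UbE : (Ub <= diagE)%MS by rewrite -Ub_diag submxMl.
  have UbM : (Ub *m M <= W)%MS.
    rewrite -[M]submxcolK mul_mxdiag_mxcol; apply/submx_mxcolP => i.
    by rewrite -/(c1 i) -cDE Uc // hd_headn.
  have WL : (W *m L <= Ub)%MS.
    rewrite -[L]submxrowK mul_mxrow; apply/submx_mxdiagP => i; exact: Wh.
  have rkUb : (\rank Ub)%:Z = \sum_(b <- ord | hd b == v) (\rank (U (tl b)))%:Z.
    rewrite rank_mxdiag (sum_heads (fun b => (\rank (U (tl b)))%:Z)).
    by rewrite (big_morph Posz PoszD (erefl _)).
  have [[Uv [UvE UbC UvH rk]] zW fW] := transfer UbE Ub_diag UbM WL.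
  split.
  - exists Uv; split=> // [b /headnP[i ->]|b /headnP[i ->]|].
    + move: UbC; rewrite mul_mxdiag_mxcol => /submx_mxcolP; exact.
    + have Uvh l : (Uv *m h l <= U (t l))%MS.
        by move: UvH; rewrite mul_mxrow => /submx_mxdiagP/(_ l).
      have -> : p i = h i - \sum_(l < n | (l < i)%N) h l *m (c l *m p i).
        by rewrite hE addrK.
      rewrite mulmxBr addmx_sub // eqmx_opp mulmx_sumr; apply: summx_sub => l li.
      have cl : c l *m p i = c1 l *m p1 i.
        rewrite c1p1; last exact: ltnW.
        by case: eqVneq li => [->|//]; rewrite ltnn.
      rewrite cl !mulmxA; apply: submx_trans (submxMr _ (submxMr _ (Uvh l))) _.
      have UcW : (U (t l) *m c1 l <= W)%MS by rewrite -cDE Uc // hd_headn.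
      by apply: submx_trans (submxMr _ UcW) _; rewrite -pDE Wp // hd_headn.
    + by rewrite -rkUb.
  - move=> U0; apply: zW; rewrite /Ub -[RHS]mxdiag0; apply: eq_mxdiag => i.
    by rewrite /Ui U0 // hd_headn.
  - move=> UF; apply: fW.
    have -> : diagE = \mxrow_i (submxrow diagE i) by rewrite submxrowK.
    apply/submx_mxdiagP => i; apply: submx_trans (UF _ (hd_headn i)).
    move: i; apply/submx_mxdiagP; rewrite submxrowK; exact: submx_refl.
by rewrite (refl_dvec ord_enum lfv qv0 rank_rD).
Qed.

End BlockReflect.

Section KerFactor.
Variable K : fieldType.

(** The rows of [P] lie in the kernel of [C] inside [Dm], so [P] factors through a basis [L] of that
    kernel; [L *m M] is then the action of [P] on it, which is a scalar. *)
Lemma ker_factor m N (Dm : 'M[K]_m) (C : 'M[K]_(m, N)) (P : 'M[K]_m) (k : K) :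
  Dm *m Dm = Dm -> P *m C = 0 -> Dm *m P = P -> P *m Dm = P ->
  (forall n (Y : 'M[K]_(n, m)), Y *m Dm = Y -> Y *m C = 0 -> Y *m P = k *: Y) ->
  exists r (L : 'M[K]_(r, m)) (M : 'M[K]_(m, r)),
    [/\ M *m L = P, L *m M = k%:M, L *m Dm = L, Dm *m M = M
      & row_free L /\ (L :=: Dm :&: kermx C)%MS].
Proof.
move=> DD PC DP PD Pk; pose L := row_base (Dm :&: kermx C)%MS.
have LE : (L :=: Dm :&: kermx C)%MS := eq_row_base _.
have LD : L *m Dm = L.
  have : (L <= Dm)%MS by rewrite LE capmxSl.
  by case/submxP => Z ->; rewrite -mulmxA DD.
have LC : L *m C = 0 by apply/sub_kermxP; rewrite LE capmxSr.
have PL : (P <= L)%MS by rewrite LE sub_capmx; apply/andP; split; [rewrite -PD submxMl|apply/sub_kermxP].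
have fL : row_free L := row_base_free _.
exists _, L, (P *m pinvmx L); split=> //; first exact: mulmxKpV.
- apply: (row_free_inj fL); rewrite -mulmxA mulmxKpV //.
  by rewrite (Pk _ L) // mul_scalar_mx.
- by rewrite mulmxA DP.
Qed.

End KerFactor.

(** * Admissible reflections of stable representations, by kernels and cokernels *)

Section ReflectionTheorem.
Variables (K : fieldType) (Q : quiver).
Local Notation D := (double_quiver Q).
Local Notation tl b := (@atail D b : vert Q).
Local Notation hd b := (@ahead D b : vert Q).
Variable ord : seq (arr D).
Hypothesis ord_enum : perm_eq ord (enum (arr D)).
Variable v : vert Q.
Hypothesis lfv : loopfree v.
Variables (q : {ffun vert Q -> K}) (th : lattice Q).
Hypothesis q0 : forall w, q w != 0.

Section Vertex.
Variables (N : nat) (E : vert Q -> 'M[K]_N) (X : arr D -> 'M[K]_N).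
Hypothesis rX : is_rep ord (sink_sign v) q E X.
Hypothesis stX : stable_rep th E X.
Local Notation n := (size (heads ord v)).
Local Notation headn := (@headn _ ord v).
Variable h : 'I_n -> 'M[K]_N.
Hypothesis hE : forall i, h i = X (star (headn i))
  + \sum_(l < n | (l < i)%N) h l *m (X (headn l) *m X (star (headn i))).
Local Notation C := (colC ord v X : 'M[K]_(\sum_(i < n) N, N)).
Local Notation H := (rowH h).
Local Notation Dg := (diagE ord v E : 'M[K]_(\sum_(i < n) N)).

Lemma dvec_line : (forall w, w != v -> E w = 0) -> dvec E = coord_vec v *~ (\rank (E v))%:Z.
Proof.
move=> Ew; apply/ffunP => w; rewrite ffunMzE !ffunE.
have [->|wv] := eqVneq w v; first by rewrite -mulrzr intz mul1r.
by rewrite Ew // mxrank0 mul0rz.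
Qed.

Lemma colC_subrep : subrep E X (fun w => if w == v then <<C>>%MS else E w).
Proof.
split=> [w|b].
  case: eqP => // ->; rewrite genmxE -(colC_v rX) submxMl.
  by [].
case: (eqVneq (hd b) v) => hb.
  rewrite (negbTE (loopfree_double lfv hb)) genmxE (rep_tl rX).
  have [i ->] := headnP ord_enum hb; exact: (proj1 (submx_mxcolP (fun i : 'I_n => X (headn i)) C) (submx_refl C) i).
by rewrite -(rep_hd rX b) mulmxA submxMl.
Qed.

Lemma kerH_subrep : subrep E X (fun w => if w == v then (E v :&: kermx H)%MS else 0).
Proof.
split=> [w|b]; first by case: eqP => [->|_]; [exact: capmxSl|exact: sub0mx].
case: (eqVneq (hd b) v) => hb; first by rewrite (negbTE (loopfree_double lfv hb)) mul0mx sub0mx.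
case: eqP => tb; last by rewrite mul0mx sub0mx.
have hs : hd (star b) = v by rewrite hd_star.
have [i bi] := headnP ord_enum hs.
set Y := (E v :&: kermx H)%MS; have YH : Y *m H = 0 by apply/sub_kermxP; exact: capmxSr.
have Yh l : Y *m h l = 0.
  have := YH; rewrite -[0](submxrowK (0 : 'M_(N, \sum_(i < n) N))) mul_mxrow => /eq_mxrowP/(_ l) ->.
  by rewrite submxrow0.
suff -> : Y *m X b = 0 by exact: sub0mx.
have -> : X b = h i - \sum_(l < n | (l < i)%N) h l *m (X (headn l) *m X (star (headn i))).
  by rewrite hE addrK -bi starK.
rewrite mulmxBr Yh mulmx_sumr big1 ?subrr // => l _.
by rewrite (mulmxA Y) Yh mul0mx.
Qed.

Lemma dotp_line_eq0 : (forall w, w != v -> E w = 0) -> th v != 0 -> False.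
Proof.
move=> Ew tv; have [d0 t0 _] := stX; have dE := dvec_line Ew.
case/negP: d0; rewrite dE; have := t0; rewrite dE dotpMz dotp_coord => /eqP.
by rewrite mulf_eq0 (negbTE tv) /= => /eqP ->; rewrite mulr0z.
Qed.

(** The subrepresentation [colC_subrep] has theta-value [th v * (\rank C - \rank (E v))], which is
    nonnegative for [th v <= 0]. Stability allows this only if it is everything or if the other
    spaces vanish. *)
Lemma colC_full : th v <= 0 -> (E v <= C)%MS \/ (forall w, w != v -> E w = 0).
Proof.
move=> tv; have [EC|nEC] := boolP (E v <= C)%MS; first by left.
right=> w wv; apply/eqP/negPn/negP => Ew.
have [d0 t0 st] := stX.
have := st _ colC_subrep (ex_intro _ w _) (ex_intro _ v _).
rewrite (negbTE wv) eqxx genmxE => /(_ Ew nEC).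
have := t0; rewrite /dotp (bigD1 v) //= ffunE => t0'.
rewrite (bigD1 v) //= ffunE eqxx genmxE.
have -> : \sum_(i | i != v) th i * dvec (fun w => if w == v then <<C>>%MS else E w) i
   = \sum_(i | i != v) th i * dvec E i.
  by apply: eq_bigr => i iv; rewrite !ffunE (negbTE iv).
set S := \sum_(i | _) _ in t0' *; move=> Slt.
have rk : (\rank C <= \rank (E v))%N by rewrite -(colC_v rX) mxrankM_maxr.
have : th v * ((\rank C)%:Z - (\rank (E v))%:Z) < 0.
  by rewrite mulrBr subr_lt0 -(ltrD2r S) t0'.
have rk0 : (\rank C)%:Z - (\rank (E v))%:Z <= 0 by rewrite subr_le0 lez_nat.
by rewrite ltNge mulr_le0.
Qed.

(** Dually, the kernel of [H] is a subrepresentation supported at [v], and its theta-value is [th v]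
    times its dimension. *)
Lemma rowH_free : 0 <= th v -> (\rank H = \rank (E v))%N \/ (forall w, w != v -> E w = 0).
Proof.
move=> tv; have := mxrank_mul_ker (E v) H; rewrite (rowH_v rX hE).
have [->|nz] := eqVneq (E v :&: kermx H)%MS 0; first by rewrite mxrank0 addn0; left.
move=> _; right=> w wv; apply/eqP/negPn/negP => Ew.
have [d0 t0 st] := stX.
have := st _ kerH_subrep (ex_intro _ v _) (ex_intro _ w _).
rewrite (negbTE wv) eqxx submx0 => /(_ nz Ew).
rewrite /dotp (bigD1 v) //= ffunE eqxx [X in _ + X]big1 => [|i iv]; last first.
  by rewrite ffunE (negbTE iv) mxrank0 mulr0.
by rewrite addr0 ltNge mulr_ge0.
Qed.

Local Notation s := (q v)^-1.
Let P := newP q E X h.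

Let DP : Dg *m P = P.
Proof.
by rewrite /P /newP mulmxDr -!scalemxAr mulmxA (diagE_colC rX) (diagE_idem rX).
Qed.

Let PD : P *m Dg = P.
Proof.
by rewrite /P /newP mulmxDl -!scalemxAl -mulmxA (rowH_diagE rX hE) (diagE_idem rX).
Qed.

Lemma PC0 : P *m C = 0.
Proof.
rewrite /P /newP mulmxDl -!scalemxAl -mulmxA (rowH_colC rX hE) (diagE_colC rX).
rewrite -scalemxAr (colC_v rX) scalerA -scalerDl (_ : _ + _ = 0) ?scale0r //.
by rewrite mulrBr mulVf ?q0 // mulr1 addrC subrKA subrr.
Qed.

(** As [C] is onto, its kernel has the dimension that the reflection predicts. In a
    subrepresentation, the new space [W] embeds into the kernel of [C] on [Ub]. For q_v different
    from 1 the dimensions agree, since [P] is a nonzero scalar on the kernel; for [th v < 0] the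
    inequality already has the right sign. *)
Lemma ker_reflect : (E v <= C)%MS -> q v != 1 \/ th v < 0 ->
  has_stable ord (reflect_q v q) (reflect_th v th) (reflection v (dvec E)).
Proof.
move=> EC qt.
have [] := @ker_factor _ _ _ Dg C P (s - 1) (diagE_idem rX) PC0 DP PD.
  by move=> k Y YD YC; rewrite /P /newP mulmxDr -!scalemxAr mulmxA YC mul0mx scaler0 add0r YD.
move=> r [L [M [ML LM LD DM [fL LE]]]].
have CE : (C :=: E v)%MS by apply/eqmxP; rewrite EC andbT -(colC_v rX) submxMl.
have rk : (r + \rank (E v) = \rank Dg)%N.
  have := mxrank_mul_ker Dg C; rewrite (diagE_colC rX) CE -LE addnC => <-.
  by move: fL; rewrite /row_free => /eqP ->.
have s1 : q v != 1 -> s - 1 != 0.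
  by move=> q1; rewrite subr_eq0 invr_eq1.
apply: (block_has_stable ord_enum lfv rX hE (q0 v) ML LM LD DM rk stX).
move=> U W Ub UbE UbD UbM WL.
have LC : L *m C = 0 by apply/sub_kermxP; rewrite LE capmxSr.
have WLk : (W *m L <= Ub :&: kermx C)%MS.
  by rewrite sub_capmx WL; apply/sub_kermxP; rewrite -mulmxA LC mulmx0.
have rkWL : \rank (W *m L) = \rank W by rewrite mxrankMfree.
have rkU := mxrank_mul_ker Ub C.
split.
- exists <<Ub *m C>>%MS; split; rewrite ?genmxE //.
  + by rewrite -(colC_v rX) mulmxA submxMl.
  + rewrite (eqmxMr _ (genmxE _)) -mulmxA.
    have -> : C *m H = q v *: (P - (s - 1) *: Dg).
      by rewrite /P /newP addrK scalerA mulfV ?q0 // scale1r.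
    rewrite -scalemxAr scalemx_sub // mulmxBr addmx_sub //.
      by rewrite -ML mulmxA; apply: submx_trans WL; exact: submxMr.
    by rewrite eqmx_opp -scalemxAr scalemx_sub // UbD.
  + case: qt => [q1|tv].
      have kW : (Ub :&: kermx C <= W *m L)%MS.
        set Y := (Ub :&: kermx C)%MS.
        have YC : Y *m C = 0 by apply/sub_kermxP; exact: capmxSr.
        have YD : Y *m Dg = Y.
          have /submxP[Z ->] : (Y <= Ub)%MS by exact: capmxSl.
          by rewrite -mulmxA UbD.
        have YP : Y *m P = (s - 1) *: Y.
          by rewrite /P /newP mulmxDr -!scalemxAr mulmxA YC mul0mx scaler0 add0r YD.
        have -> : Y = (s - 1)^-1 *: (Y *m P) by rewrite YP scalerA mulVf ?s1 // scale1r.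
        apply: scalemx_sub; rewrite -ML mulmxA; apply: submxMr.
        by apply: submx_trans UbM; apply: submxMr; exact: capmxSl.
      have e : \rank (Ub :&: kermx C)%MS = \rank W.
        by rewrite -rkWL; apply/eqP; rewrite eqn_leq (mxrankS kW) (mxrankS WLk).
      by rewrite -rkU e (_ : _ - _ = (\rank (Ub *m C))%:Z) //; lia.
    have := mxrankS WLk; rewrite rkWL => le.
    by apply: ler_wnM2l; [exact: ltW|lia].
- move=> U0; have : W *m L = 0 by apply/eqP; rewrite -submx0 -U0.
  by move/(congr1 mxrank); rewrite rkWL mxrank0 => /eqP; rewrite mxrank_eq0 => ->.
- move=> DU ltr; case: qt => [q1|//].
  have MW : (M <= W)%MS.
    rewrite -DM; apply: submx_trans UbM; exact: submxMr.
  have : (1%:M <= W)%MS.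
    have -> : 1%:M = (s - 1)^-1 *: (L *m M) by rewrite LM scale_scalar_mx mulVf ?s1.
    by apply: scalemx_sub; apply: submx_trans MW; exact: submxMl.
  by move/mxrankS; rewrite mxrank1 leqNgt ltr.
Qed.

(** The dual construction, by [ker_factor] for transposed matrices: the new space is the cokernel of
    [H], and a subrepresentation gets back at [v] the preimage of [Ub] under [H]. *)
Lemma coker_reflect : \rank H = \rank (E v) -> q v = 1 -> 0 < th v ->
  has_stable ord (reflect_q v q) (reflect_th v th) (reflection v (dvec E)).
Proof.
move=> rkH q1 tv.
have PE : P = C *m H by rewrite /P /newP q1 invr1 scale1r subrr scale0r addr0.
have HC : H *m C = 0 by rewrite (rowH_colC rX hE) q1 subrr scale0r.
have HD : H *m Dg = H := rowH_diagE rX hE.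
have [] := @ker_factor _ _ _ Dg^T H^T P^T 0.
- by rewrite -trmx_mul (diagE_idem rX).
- by rewrite -trmx_mul PE mulmxA HC mul0mx trmx0.
- by rewrite -trmx_mul PD.
- by rewrite -trmx_mul DP.
- by move=> k Y _ YH; rewrite PE trmx_mul mulmxA YH mul0mx scale0r.
move=> r [L0 [M0 [ML0 LM0 LD0 DM0 [fL0 LE0]]]].
pose L := M0^T; pose M := L0^T.
have ML : M *m L = P by rewrite -trmx_mul ML0 trmxK.
have LM : L *m M = (s - 1)%:M by rewrite -trmx_mul LM0 q1 invr1 subrr tr_scalar_mx.
have LD : L *m Dg = L by apply: trmx_inj; rewrite trmx_mul trmxK DM0.
have DM : Dg *m M = M by apply: trmx_inj; rewrite trmx_mul trmxK LD0.
have rkM : \rank M = r by rewrite mxrank_tr; exact/eqP.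
have rk : (r + \rank (E v) = \rank Dg)%N.
  have := mxrank_mul_ker Dg^T H^T; rewrite -trmx_mul HD !mxrank_tr rkH -LE0 addnC => <-.
  by move: fL0; rewrite /row_free => /eqP ->.
have HM : H *m M = 0.
  apply: trmx_inj; rewrite trmx_mul trmxK trmx0; apply/sub_kermxP.
  by rewrite LE0 capmxSr.
have kH : (Dg :&: kermx M <= H)%MS.
  have HK : (H <= Dg :&: kermx M)%MS.
    by rewrite sub_capmx -{1}HD submxMl; apply/sub_kermxP.
  rewrite -(geq_leqif (mxrank_leqif_sup HK)) rkH.
  by have := mxrank_mul_ker Dg M; rewrite DM rkM -rk => /addnI ->.
apply: (block_has_stable ord_enum lfv rX hE (q0 v) ML LM LD DM rk stX).
move=> U W Ub UbE UbD UbM WL; split=> //; last first.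
  move=> DU; have MW : (M <= W)%MS.
    by rewrite -DM; apply: submx_trans UbM; exact: submxMr.
  by have := mxrankS MW; rewrite rkM leqNgt => /negbTE ->.
exists (E v :&: kermx (H *m cokermx Ub))%MS; split.
- exact: capmxSl.
- rewrite sub_capmx -{1}(colC_v rX) mulmxA submxMl /=; apply/sub_kermxP.
  rewrite mulmxA -(mulmxA Ub) -PE -ML; apply/eqP; rewrite -submxE mulmxA.
  apply: submx_trans WL; exact: submxMr.
- by rewrite submxE -mulmxA; apply/eqP/sub_kermxP; exact: capmxSr.
- apply: ler_wpM2l; first exact: ltW.
  have := mxrank_mul_ker Ub M; have := mxrankS UbM.
  suff : (\rank (Ub :&: kermx M) <= \rank (E v :&: kermx (H *m cokermx Ub)))%N by lia.
  set Y := (Ub :&: kermx M)%MS; have YH : (Y <= H)%MS.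
    by apply: submx_trans kH; rewrite capmxS.
  have /submxP[Z YE] := YH; rewrite YE -(rowH_v rX hE) mulmxA.
  apply: leq_trans (mxrankM_maxl _ _) _; apply: mxrankS.
  rewrite sub_capmx submxMl; apply/sub_kermxP.
  rewrite mulmxA -(mulmxA Z) !(rowH_v rX hE) -YE.
  by apply/eqP; rewrite -submxE; exact: capmxSl.
Qed.

Lemma vertex_reflect : q v != 1 \/ th v != 0 ->
  has_stable ord (reflect_q v q) (reflect_th v th) (reflection v (dvec E)).
Proof.
have [q1|q1 _] := eqVneq (q v) 1; last first.
  apply: ker_reflect; last by left.
  have -> : E v = (q v - 1)^-1 *: (H *m C).
    by rewrite (rowH_colC rX hE) scalerA mulVf ?scale1r // subr_eq0.
  by apply: scalemx_sub; exact: submxMl.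
case=> // tv; have [tneg|tpos] := ltP (th v) 0.
  case: (colC_full (ltW tneg)) => [EC|Ew]; last by case: (dotp_line_eq0 Ew tv).
  by apply: ker_reflect => //; right.
have t0 : 0 < th v by rewrite lt_def tv.
case: (rowH_free tpos) => [rk|Ew]; last by case: (dotp_line_eq0 Ew tv).
exact: coker_reflect.
Qed.

(** For theta_v = 0 both [colC_full] and [rowH_free] apply, and [H *m C] vanishes because q_v = 1.
    So twice the dimension at [v] is at most that of the sum over the incoming arrows, which is the
    inequality. If everything sits at [v], all maps vanish for lack of loops, any line is a
    subrepresentation, and the dimension must be 1. *)
Lemma vertex_not_admissible : q v = 1 -> th v = 0 ->
  symf (dvec E) (coord_vec v) <= 0 \/ dvec E = coord_vec v.
Proof.
move=> q1 t0.
have line : (forall w, w != v -> E w = 0) -> dvec E = coord_vec v.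
  move=> Ew; have [d0 _ st] := stX; have dE := dvec_line Ew.
  have X0 b : X b = 0.
    case: (eqVneq (tl b) v) => tb; last by rewrite -(rep_tl rX) Ew // mul0mx.
    rewrite -(rep_hd rX) Ew ?mulmx0 //.
    by apply/eqP => hb; have := loopfree_double lfv hb; rewrite tb eqxx.
  have r0 : (0 < \rank (E v))%N.
    rewrite lt0n; apply/eqP => r0; case/eqP: d0.
    by rewrite dE r0 mulr0z.
  have [i Ei] : exists i, row i (E v) != 0.
    apply/existsP; apply: contraTT r0; rewrite negb_exists => /forallP rE.
    rewrite lt0n mxrank_eq0 negbK; apply/eqP/row_matrixP => i.
    by rewrite row0; apply/eqP; have := rE i; rewrite negbK.
  pose U w : 'M[K]_N := if w == v then <<row i (E v)>>%MS else 0.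
  have sU : subrep E X U.
    split=> [w|b]; last by rewrite X0 mulmx0 sub0mx.
    by rewrite /U; case: eqP => [->|_]; rewrite ?genmxE ?row_sub ?sub0mx.
  have [EU|nEU] := boolP (E v <= U v)%MS.
    have := mxrankS EU; rewrite /U eqxx genmxE rank_rV Ei => rk.
    rewrite dE; have -> : (\rank (E v)) = 1%N by move: rk r0; lia.
    by rewrite mulr1z.
  have Uv0 : U v != 0.
    rewrite /U eqxx; apply: contra Ei => /eqP/(congr1 mxrank)/eqP.
    by rewrite genmxE mxrank0 mxrank_eq0.
  have := st U sU (ex_intro _ v Uv0) (ex_intro _ v nEU).
  rewrite /dotp big1 // => w _; rewrite ffunE /U; case: eqP => [->|_].
    by rewrite t0 mul0r.
  by rewrite mxrank0 mulr0.
have tle : th v <= 0 by rewrite t0.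
have tge : 0 <= th v by rewrite t0.
case: (colC_full tle) => [EC|/line]; last by right.
case: (rowH_free tge) => [rkH|/line]; last by right.
left; have HC : H *m C = 0 by rewrite (rowH_colC rX hE) q1 subrr scale0r.
have CE : (C :=: E v)%MS by apply/eqmxP; rewrite EC andbT -(colC_v rX) submxMl.
have := mxrank_mul_ker Dg C; rewrite (diagE_colC rX) CE => rD.
have HK : (H <= Dg :&: kermx C)%MS.
  by rewrite sub_capmx -{1}(rowH_diagE rX hE) submxMl; apply/sub_kermxP.
have := mxrankS HK; rewrite rkH => rH.
have sD : (\rank Dg)%:Z = \sum_(w | w != v) - cart v w * dvec E w.
  rewrite -(sum_double_cart ord_enum) // rank_mxdiag (sum_heads ord v (fun b => dvec E (tl b))).
  by rewrite (big_morph Posz PoszD (erefl _)); apply: eq_bigr => i _; rewrite ffunE.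
rewrite symf_coordr (bigD1 v) //= ((loopfree_cart v).1 lfv) ffunE.
have -> : \sum_(i | i != v) dvec E i * cart i v = - (\rank Dg)%:Z.
  by rewrite sD -sumrN; apply: eq_bigr => i _; rewrite cartC; ring.
move: rD rH; lia.
Qed.

End Vertex.

Variable a : lattice Q.
Hypothesis st : has_stable ord q th a.

Theorem has_stable_reflect : q v != 1 \/ th v != 0 ->
  has_stable ord (reflect_q v q) (reflect_th v th) (reflection v a).
Proof.
move: st => /(has_stable_sign _ _ _ _ (sink_sign_antisym lfv)) [N [E [X [rX sX <-]]]].
have [h hE] := prod_expand_ex
  (fun i : 'I_(size (heads ord v)) => X (star (headn i))) (fun i => X (headn i)).
exact: (vertex_reflect rX sX hE).
Qed.

Theorem has_stable_not_admissible : q v = 1 -> th v = 0 ->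
  symf a (coord_vec v) <= 0 \/ a = coord_vec v.
Proof.
move: st => /(has_stable_sign _ _ _ _ (sink_sign_antisym lfv)) [N [E [X [rX sX <-]]]].
have [h hE] := prod_expand_ex
  (fun i : 'I_(size (heads ord v)) => X (star (headn i))) (fun i => X (headn i)).
exact: (vertex_not_admissible rX sX hE).
Qed.

End ReflectionTheorem.

(** * Dimension vectors of stable representations *)

Section Idem.
Variable K : fieldType.

Lemma idem_split N (E : 'M[K]_N) : E *m E = E ->
  exists (L : 'M[K]_(N, \rank E)) (R : 'M[K]_(\rank E, N)), E = L *m R /\ R *m L = 1%:M.
Proof.
move=> EE; exists (col_base E), (row_base E); rewrite mulmx_base; split=> //.
have fR : row_free (row_base E) := row_base_free _.
have fC : row_full (col_base E) := col_base_full _.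
apply: (row_free_inj fR); apply: (row_full_inj fC).
by rewrite /= mul1mx -mulmxA !mulmx_base mulmxA mulmx_base EE.
Qed.

Lemma det_idem N (E : 'M[K]_N) (x : K) : E *m E = E ->
  \det (1%:M + (x - 1) *: E) = x ^+ \rank E.
Proof.
move=> EE; have [L [R [EL RL]]] := idem_split EE.
rewrite {1}EL scalemxAl det_1Dmulmx_comm -scalemxAr RL -{1}[1%:M]scale1r -scalerDl.
by rewrite addrC subrK scalemx1 det_scalar.
Qed.

End Idem.

Section RepFacts.
Variables (K : fieldType) (Q : quiver).
Local Notation D := (double_quiver Q).
Local Notation tl b := (@atail D b : vert Q).
Local Notation hd b := (@ahead D b : vert Q).
Variable ord : seq (arr D).
Hypothesis ord_enum : perm_eq ord (enum (arr D)).

Section Det.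
Variables (N : nat) (q : {ffun vert Q -> K}) (E : vert Q -> 'M[K]_N) (X : arr D -> 'M[K]_N).
Hypothesis rX : is_rep ord (@std_sign Q) q E X.
Local Notation G := (gfac (@std_sign Q) X).

(** The product of the factors at [v] is q_v on the image of [E v], and each factor fixes the
    complement given by [1 - E v]. *)
Lemma det_vertex v : q v ^+ \rank (E v) = \prod_(b <- ord | hd b == v) \det (G b).
Proof.
pose P := \big[mulmx/1%:M]_(b <- ord | hd b == v) G b.
have GE b : hd b = v -> (1%:M - E v) *m G b = 1%:M - E v.
  move=> hb; have FE : (1%:M - E v) *m (1%:M + X (star b) *m X b) = 1%:M - E v.
    rewrite mulmxDr mulmx1 mulmxA mulmxBl mul1mx -{2}hb -(tl_star b) (rep_tl rX).
    by rewrite subrr mul0mx addr0.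
  rewrite /gfac; case: (std_sign b) => //.
  by rewrite -{1}FE mulmxK // (rep_unit rX).
have PE : (1%:M - E v) *m P = 1%:M - E v.
  rewrite /P; apply: (big_ind (fun A => (1%:M - E v) *m A = 1%:M - E v)).
  - by rewrite mulmx1.
  - by move=> A B HA HB; rewrite mulmxA HA HB.
  - by move=> b /eqP; exact: GE.
have -> : \prod_(b <- ord | hd b == v) \det (G b) = \det P.
  by rewrite (big_morph determinant (@det_mulmx K N) (det1 _ _)).
have -> : P = 1%:M + (q v - 1) *: E v.
  rewrite -[P]mul1mx -[1%:M in LHS](subrK (E v)) mulmxDl PE (rep_rel rX).
  by rewrite scalerBl scale1r addrAC -addrA.
by rewrite det_idem // (rep_idem rX).
Qed.

Lemma det_star b : \det (G b) * \det (G (star b)) = 1.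
Proof.
have u b' : \det (1%:M + X (star b') *m X b') != 0.
  by have := rep_unit rX b'; rewrite unitmxE unitfE.
rewrite /gfac std_sign_antisym starK; case: (std_sign b) => /=.
  by rewrite det_inv det_1Dmulmx_comm mulfV //; have := u (star b); rewrite starK.
by rewrite det_inv det_1Dmulmx_comm mulVf //; have := u (star b); rewrite starK.
Qed.

(** Arrows with both ends in [J] cancel against their opposites by [det_star]. For the set of all
    vertices no arrow is left, which gives q^alpha = 1. *)
Lemma det_set (J : {set vert Q}) :
  \prod_(v in J) q v ^+ \rank (E v)
    = \prod_(b <- ord | (hd b \in J) && (tl b \notin J)) \det (G b).
Proof.
transitivity (\prod_(b <- ord | hd b \in J) \det (G b)).
  under eq_bigr => v _ do rewrite det_vertex.
  rewrite (exchange_big_dep (fun b => hd b \in J)) /=; last by move=> v b vJ /eqP ->.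
  apply: eq_bigr => b bJ; rewrite (bigD1 (hd b)) ?bJ ?eqxx //= big1 ?mulr1 //.
  by move=> v /andP[/andP[_ /eqP ->]]; rewrite eqxx.
rewrite (bigID (fun b => tl b \in J)) /= -[RHS]mul1r; congr (_ * _).
rewrite (perm_big _ ord_enum) /= big_enum_cond /= big_mkcond.
rewrite (big_sumType _ _ (fun b : arr Q + arr Q => if (hd b \in J) && (tl b \in J) then \det (G b) else 1)) /=.
rewrite -big_split big1 // => x _ /=; rewrite andbC; case: ifP => // _; last by rewrite mulr1.
exact: (det_star (inl x)).
Qed.

End Det.

Section Stable.
Variables (N : nat) (q : {ffun vert Q -> K}) (E : vert Q -> 'M[K]_N) (X : arr D -> 'M[K]_N).
Hypothesis rX : is_rep ord (@std_sign Q) q E X.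
Variable th : lattice Q.
Hypothesis stX : stable_rep th E X.

Lemma qpow_dvec : qpow q (dvec E) = 1.
Proof.
have := det_set rX setT; rewrite [RHS]big_pred0 => [|b]; last by rewrite !inE.
by move=> <-; rewrite big_mkcond; apply: eq_bigr => v _; rewrite inE ffunE.
Qed.

Lemma stable_closed (S : {set vert Q}) x y :
  (forall b, tl b \in S -> hd b \notin S -> X b = 0) ->
  x \in S -> E x != 0 -> y \notin S -> E y != 0 ->
  \sum_(w in S) th w * dvec E w < 0.
Proof.
move=> SX xS Ex yS Ey; have [_ _ st] := stX.
pose U w := if w \in S then E w else 0.
have sU : subrep E X U.
  split=> [w|b]; first by rewrite /U; case: ifP; rewrite ?sub0mx.
  rewrite /U; case: ifP => tS; last by rewrite mul0mx sub0mx.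
  rewrite (rep_tl rX); case: ifP => hS; last by rewrite SX ?hS ?sub0mx.
  by rewrite -(rep_hd rX) submxMl.
have Ux : U x != 0 by rewrite /U xS.
have Uy : ~~ (E y <= U y)%MS by rewrite /U (negbTE yS) submx0.
have := st U sU (ex_intro _ x Ux) (ex_intro _ y Uy).
rewrite /dotp [X in _ -> X < 0]big_mkcond; congr (_ < 0).
apply: eq_bigr => w _; rewrite !ffunE /U; case: ifP => // _.
by rewrite mxrank0 mulr0.
Qed.

(** Otherwise a component and its complement would both span subrepresentations of negative
    theta-value, while the total value is 0. *)
Lemma stable_connected : connected_in (supp (dvec E)).
Proof.
move=> x y xs ys; set e := (fun v' w' => _); apply/idPn => nxy.
have E0 w : (w \in supp (dvec E)) = (E w != 0).
  by rewrite inE ffunE eqz_nat mxrank_eq0.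
have esym : symmetric e.
  by move=> v w; rewrite /e andbCA andbA [adjacent v w]adjacentC -andbA andbCA.
pose S := [set w | connect e x w].
have Ssupp w : w \in S -> E w != 0.
  rewrite inE => /connectP[p pth ->] {w}; rewrite -E0.
  elim: p x xs pth {nxy S} => //= z p IH x xs /andP[/and3P[_ zs _] pth].
  exact: IH zs pth.
have adj b : adjacent (tl b) (hd b).
  by apply/existsP; case: b => z; exists z; rewrite !eqxx ?orbT.
have xS : x \in S by rewrite inE connect0.
have yS : y \notin S by rewrite inE.
have Ex : E x != 0 by rewrite -E0.
have Ey : E y != 0 by rewrite -E0.
have cl b : tl b \in S -> hd b \notin S -> X b = 0.
  move=> tS hS; apply/eqP/negPn/negP => Xb.
  have Eh : E (hd b) != 0.
    by apply: contra Xb => /eqP Eh; rewrite -(rep_hd rX) Eh mulmx0.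
  case/negP: hS; rewrite inE; apply: connect_trans (_ : connect e x (tl b)) (connect1 _).
    by rewrite inE in tS.
  by rewrite /e !E0 (Ssupp _ tS) Eh adj.
have clC b : tl b \in ~: S -> hd b \notin ~: S -> X b = 0.
  rewrite !inE negbK => tS hS; apply/eqP/negPn/negP => Xb.
  have Et : E (tl b) != 0.
    by apply: contra Xb => /eqP Et; rewrite -(rep_tl rX) Et mul0mx.
  have Eh : E (hd b) != 0 by apply: Ssupp; rewrite inE.
  case/negP: tS; apply: connect_trans hS (connect1 _).
  by rewrite esym /e !E0 Et Eh; exact: adj.
have yS' : y \in ~: S by rewrite inE.
have xS' : x \notin ~: S by rewrite inE negbK.
have := stable_closed cl xS Ex yS Ey; have := stable_closed clC yS' Ey xS' Ex.
have [_ t0 _] := stX; have := t0; rewrite /dotp (bigID (mem S)) /=.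
have -> : \sum_(i in ~: S) th i * dvec E i = \sum_(i | i \notin S) th i * dvec E i.
  by apply: eq_bigl => i; rewrite inE.
set A := \sum_(i in S) _; set B := \sum_(i | _) _ => AB A0 B0.
by have := ltrD A0 B0; rewrite addrC AB ltxx.
Qed.

Lemma stable_Nqt : Nqt q th (dvec E).
Proof.
by have [_ t0 _] := stX; split=> [v||] //; [rewrite ffunE|exact: qpow_dvec].
Qed.

End Stable.

(** Between lines [A] and [B] are scalars a and b, and the determinant is 1 + ab. *)
Lemma line_maps N (Ej Ek A B : 'M[K]_N) : Ej *m Ej = Ej -> Ek *m Ek = Ek ->
  \rank Ej = 1 -> \rank Ek = 1 -> Ej *m A *m Ek = A -> Ek *m B *m Ej = B ->
  \det (1%:M + A *m B) = 1 -> A = 0 \/ B = 0.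
Proof.
move=> jj kk rj rk AE BE.
have [Lj [Rj [Ej_E RLj]]] := idem_split jj; have [Lk [Rk [Ek_E RLk]]] := idem_split kk.
move: Lj Rj Ej_E RLj Lk Rk Ek_E RLk; rewrite rj rk => Lj Rj EjE RLj Lk Rk EkE RLk.
have [a Aa] : exists a, A = Lj *m a *m Rk.
  by exists (Rj *m A *m Lk); rewrite -{1}AE EjE EkE !mulmxA.
have [b Bb] : exists b, B = Lk *m b *m Rj.
  by exists (Rk *m B *m Lj); rewrite -{1}BE EjE EkE !mulmxA.
have -> : A *m B = (Lj *m (a *m b)) *m Rj.
  by rewrite {1}Aa {1}Bb !mulmxA -(mulmxA (Lj *m a) Rk) RLk mulmx1.
rewrite det_1Dmulmx_comm mulmxA RLj mul1mx => d1.
have : a 0 0 * b 0 0 = 0.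
  move: d1; rewrite det_mx11 !mxE big_ord_recl big_ord0 addr0 eqxx => /eqP.
  by rewrite -subr_eq0 addrAC subrr add0r => /eqP.
move=> /eqP; rewrite mulf_eq0 => /orP[] /eqP z.
  by left; rewrite Aa [a]mx11_scalar z raddf0 mulmx0 mul0mx.
by right; rewrite Bb [b]mx11_scalar z raddf0 mulmx0 mul0mx.
Qed.

Variables (q : {ffun vert Q -> K}) (th a : lattice Q).
Hypothesis st : has_stable ord q th a.

Lemma has_stable_connected : connected_in (supp a).
Proof. by have [N [E [X [rX sX <-]]]] := st; exact: (stable_connected rX sX). Qed.

Lemma has_stable_Nqt : Nqt q th a.
Proof. by have [N [E [X [rX sX <-]]]] := st; exact: (stable_Nqt rX sX). Qed.

Lemma has_stable_neq0 : a != 0.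
Proof. by have [N [E [X [rX [] // d0 _ _ <-]]]] := st. Qed.

(** The determinants over [J] leave only the arrow that joins [J] to [L], with determinant q^(a|J) =
    1. It connects two lines, so it or its opposite acts as 0. Then [J] or its complement spans a
    subrepresentation of theta-value 0, against stability. *)
Lemma has_stable_no_b1 : ~ has_b1 q th a.
Proof.
move=> [J [L [j [k [[sJL dJL [b0 [tb0 hb0 jJ kL uniq]] ak] aj rJ]]]]].
have [N [E [X [rX sX dE]]]] := st.
have aE w : a w = (\rank (E w))%:Z by rewrite -dE ffunE.
have E0 w : w \notin J -> w \notin L -> E w = 0.
  move=> wJ wL; apply/eqP; rewrite -mxrank_eq0 -eqz_nat -aE.
  have : w \notin supp a by rewrite sJL inE negb_or wJ.
  by rewrite inE negbK.
have kJ : k \notin J by apply/negP => kJ; move/pred0P: dJL => /(_ k) /=; rewrite kJ kL.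
have ex0 w : extend0 (restrict J a) w = if w \in J then a w else 0.
  by rewrite ffunE; case: insubP => [u wJ <-|/negbTE -> //]; rewrite ffunE (valP u).
have [_ [_ qJ tJ]] := rJ.
have out b : hd b \in J -> tl b \notin J -> b = star b0 \/ X b = 0.
  move=> hJ tJ'; have [tL|tL] := boolP (tl b \in L).
    left; rewrite -(uniq (star b)) ?starK //.
      by rewrite -[atail _]/(tl (star b)) tl_star.
    by rewrite -[ahead _]/(hd (star b)) hd_star.
  by right; rewrite -(rep_tl rX) E0 // mul0mx.
have out' b : tl b \in J -> hd b \notin J -> b = b0 \/ X b = 0.
  move=> tJ' hJ; have [hL|hL] := boolP (hd b \in L); first by left; exact: uniq.
  by right; rewrite -(rep_hd rX) E0 // mulmx0.
have tb0' : tl b0 = j := tb0; have hb0' : hd b0 = k := hb0.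
have G0 : \det (gfac (@std_sign Q) X (star b0)) = 1.
  have := det_set rX J; rewrite [RHS]big_mkcond (bigD1_seq (star b0)) ?(mem_ord ord_enum) ?(ord_uniq ord_enum) // hd_star tl_star tb0' hb0' jJ kJ.
  rewrite /= [X in _ = _ * X -> _]big1 => [|b bb].
    rewrite mulr1 => <-; rewrite -[RHS]qJ /qpow [RHS](bigID (mem J)) /=.
    rewrite [X in _ = _ * X]big1 => [|w wJ]; last by rewrite ex0 (negbTE wJ).
    by rewrite mulr1; apply: eq_bigr => w wJ; rewrite ex0 wJ aE.
  case: ifP => // /andP[hJ tJ']; case: (out b hJ tJ') => [bE|Xb].
    by rewrite bE eqxx in bb.
  by rewrite /gfac Xb mulmx0 addr0 invmx1 if_same det1.
have F0 : \det (1%:M + X b0 *m X (star b0)) = 1.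
  move: G0; rewrite /gfac starK; case: ifP => // _; rewrite det_inv => /eqP.
  by rewrite invr_eq1 => /eqP.
have rj : \rank (E j) = 1 by apply/eqP; rewrite -eqz_nat -aE aj.
have rk : \rank (E k) = 1 by apply/eqP; rewrite -eqz_nat -aE ak.
have Ej : E j != 0 by rewrite -mxrank_eq0 rj.
have Ek : E k != 0 by rewrite -mxrank_eq0 rk.
have A1 : E j *m X b0 *m E k = X b0 by rewrite -tb0' -hb0' (rep_tl rX) (rep_hd rX).
have A2 : E k *m X (star b0) *m E j = X (star b0).
  by rewrite -tb0' -hb0' -(tl_star b0) (rep_tl rX) -(hd_star b0) (rep_hd rX).
have sJ0 : \sum_(w in J) th w * dvec E w = 0.
  rewrite -[RHS]tJ /dotp [RHS](bigID (mem J)) /= [X in _ = _ + X]big1 => [|w wJ].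
    by rewrite addr0; apply: eq_bigr => w wJ; rewrite ex0 wJ dE.
  by rewrite ex0 (negbTE wJ) mulr0.
case: (line_maps (rep_idem rX j) (rep_idem rX k) rj rk A1 A2 F0) => X0.
  suff : \sum_(w in J) th w * dvec E w < 0 by rewrite sJ0 ltxx.
  apply: (stable_closed rX sX _ jJ Ej kJ Ek) => b tJ' hJ.
  by case: (out' b tJ' hJ) => [->|].
suff : \sum_(w in ~: J) th w * dvec E w < 0.
  have [_ t0 _] := sX; have := t0; rewrite /dotp (bigID (mem J)) /= sJ0 add0r => t1.
  by rewrite (eq_bigl (fun w => w \notin J)) ?t1 ?ltxx // => w; rewrite inE.
have kJ' : k \in ~: J by rewrite inE.
have jJ' : j \notin ~: J by rewrite inE negbK.
apply: (stable_closed rX sX _ kJ' Ek jJ' Ej) => b; rewrite !inE negbK => tJ' hJ.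
by case: (out b hJ tJ') => [->|].
Qed.

End RepFacts.

(** With theta = 0 stability means simplicity. These one-dimensional modules are where the generic
    representations of [real_root_sign] start. *)
Lemma has_stable_coord (K : fieldType) (Q : quiver) ord (q : {ffun vert Q -> K}) v :
  loopfree v -> q v = 1 -> has_stable ord q 0 (coord_vec v).
Proof.
move=> lv q1; exists 1%N, (fun w => (v == w)%:R%:M), (fun=> 0).
have dE : dvec (fun w => (v == w)%:R%:M : 'M[K]_1) = coord_vec v.
  apply/ffunP => w; rewrite coordE ffunE; case: eqP => _; last by rewrite raddf0 mxrank0.
  by rewrite mxrank1.
split=> //; first split=> [w|b|b|b|w].
- by rewrite -scalar_mxM -natrM mulnb andbb.
- by rewrite mulmx0.
- by rewrite mul0mx.
- by rewrite mulmx0 addr0 unitmx1.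
- rewrite big1 => [|b _]; last by rewrite /gfac mulmx0 addr0 invmx1 if_same.
  rewrite mulmx1; case: eqP => [<-|_]; first by rewrite q1 scale1r.
  by rewrite raddf0 scaler0.
- split; first by rewrite dE coord_neq0.
  by rewrite /dotp big1 // => w _; rewrite ffunE mul0r.
  move=> U [UE _] [x Ux] [y Uy].
  have xv : x = v.
    apply/eqP; apply: contraNT Ux => xv; have := UE x.
    by rewrite eq_sym (negbTE xv) raddf0 submx0.
  have yv : y = v.
    apply/eqP; apply: contraNT Uy => yv.
    by rewrite eq_sym (negbTE yv) raddf0 sub0mx.
  case/negP: Uy; rewrite yv eqxx sub1mx /row_full; rewrite xv in Ux.
  by have := rank_leq_row (U v); rewrite leq_eqVlt ltnS leqn0 mxrank_eq0 (negbTE Ux) orbF.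
Qed.

(** * Representations from modules *)

Import VectorInternalTheory.
Local Open Scope ring_scope.

Section LfunMatrix.
Variable K : fieldType.
Implicit Types aT rT vT : vectType K.

Lemma v2r_lfun aT rT (f : 'Hom(aT, rT)) u : v2r (f u) = v2r u *m f2mx f.
Proof. by rewrite unlock /= r2vK. Qed.

Lemma f2mxP aT rT (f : 'Hom(aT, rT)) A : (forall u, v2r (f u) = v2r u *m A) -> f2mx f = A.
Proof.
move=> fA; apply/row_matrixP => i; rewrite !rowE -[delta_mx 0 i]r2vK -v2r_lfun.
exact: fA.
Qed.

Lemma f2mx_comp aT vT rT (f : 'Hom(vT, rT)) (g : 'Hom(aT, vT)) :
  f2mx (f \o g)%VF = f2mx g *m f2mx f.
Proof. by apply: f2mxP => u; rewrite lfunE /= !v2r_lfun mulmxA. Qed.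

Lemma f2mxD aT rT (f g : 'Hom(aT, rT)) : f2mx (f + g) = f2mx f + f2mx g.
Proof. by apply: f2mxP => u; rewrite lfunE /= linearD /= !v2r_lfun mulmxDr. Qed.

Lemma f2mxZ aT rT k (f : 'Hom(aT, rT)) : f2mx (k *: f) = k *: f2mx f.
Proof. by apply: f2mxP => u; rewrite lfunE /= linearZ /= !v2r_lfun -scalemxAr. Qed.

Lemma f2mx_id vT : f2mx (\1%VF : 'End(vT)) = 1%:M.
Proof. by apply: f2mxP => u; rewrite lfunE /= mulmx1. Qed.

Lemma dim_lfun_img aT rT (f : 'Hom(aT, rT)) m (A : 'M_(m, dim aT)) :
  \dim (f @: mx2vs A) = \rank (A *m f2mx f).
Proof. by rewrite unlock /dimv mx2vsK (eqmxMr _ (mx2vsK A)). Qed.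

Lemma lfun_img_sub aT (f : 'End(aT)) m (A : 'M_(m, dim aT)) :
  (f @: mx2vs A <= mx2vs A)%VS = (A *m f2mx f <= A)%MS.
Proof. by rewrite unlock /subsetv !mx2vsK (eqmxMr _ (mx2vsK A)). Qed.

End LfunMatrix.

Section Extract.
Variables (K : fieldType) (Q : quiver).
Local Notation D := (double_quiver Q).
Local Notation tl b := (@atail D b : vert Q).
Local Notation hd b := (@ahead D b : vert Q).
Variables (ord : seq (arr D)) (q : {ffun vert Q -> K}) (M : mpa_mod ord q).
Local Notation n := (dim M).
Local Notation rels := (mpa_rel ord q).
Local Notation tm := (aterm K (mpa_gen Q)).

Definition actmx (x : mpa ord q) : 'M[K]_n := f2mx (mod_act M x).

(** Operators become matrices acting on row vectors, which reverses products; the relation will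
    therefore be read along [rev ord]. *)
Fixpoint tmx (t : tm) : 'M[K]_n :=
  match t with
  | TScal k => k%:M
  | TGen g => actmx (gen rels g)
  | TAdd s t => tmx s + tmx t
  | TMul s t => tmx t *m tmx s
  end.

Lemma act1 : mod_act M 1 = \1%VF. Proof. by case: M. Qed.
Lemma actM x y : mod_act M (x * y) = (mod_act M x \o mod_act M y)%VF.
Proof. by case: M. Qed.

Lemma tmxE t : actmx (cls rels t) = tmx t.
Proof.
elim: t => [k|g|s IHs t IHt|s IHs t IHt] //=.
- have -> : cls rels (TScal k) = k *: (1 : mpa ord q).
    rewrite -[RHS]/(pscale k (cls rels (TScal 1))) cls_scale; apply: cls_eq.
    by rewrite -{1}[k]mulr1; exact: cong_scalM.
  by rewrite /actmx linearZ /= f2mxZ act1 f2mx_id scalemx1.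
- rewrite -cls_add -[padd _ _]/((cls rels s : mpa ord q) + cls rels t).
  by rewrite /actmx linearD /= f2mxD; congr (_ + _).
- rewrite -cls_mul -[pmul _ _]/((cls rels s : mpa ord q) * cls rels t).
  by rewrite /actmx actM f2mx_comp; congr (_ *m _).
Qed.

Lemma tmx_rel s t : rels s t -> tmx s = tmx t.
Proof. by move=> st; rewrite -!tmxE (cls_eq (cong_rel st)). Qed.

Definition actE v := actmx (mpa_triv ord q v).
Definition actX b := actmx (gen rels (Arr b)).

Lemma actE_idem v : actE v *m actE v = actE v.
Proof. exact: (tmx_rel (rel_idem ord q v)). Qed.

Lemma actE_orth v w : v != w -> actE v *m actE w = 0.
Proof.
move=> vw; have := tmx_rel (rel_orth ord q (v := w) (w := v) _); rewrite eq_sym => /(_ vw) /=.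
by rewrite -[0%:M]scalemx1 scale0r.
Qed.

Lemma tmx_tsum s : tmx (tsum s) = \sum_(t <- s) tmx t.
Proof. by elim: s => [|t s IH]; rewrite ?big_nil ?big_cons /= ?raddf0 ?IH. Qed.

Lemma actE_sum : \sum_v actE v = 1%:M.
Proof.
have /= <- := tmx_rel (Defs.rel_unit ord q).
by rewrite tmx_tsum big_map big_enum.
Qed.

Lemma actX_hd b : actX b *m actE (hd b) = actX b.
Proof. exact: (tmx_rel (rel_head ord q b)). Qed.

Lemma actX_tl b : actE (tl b) *m actX b = actX b.
Proof. exact: (tmx_rel (rel_tail ord q b)). Qed.

Lemma act_loc b : actmx (gen rels (Loc b)) = invmx (1%:M + actX (star b) *m actX b)
  /\ 1%:M + actX (star b) *m actX b \in unitmx.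
Proof.
by have /= /invmxP[-> u] := tmx_rel (rel_locl ord q b).
Qed.

Lemma act_factor b : tmx (factor_t K b) = gfac (@std_sign Q) actX b.
Proof.
case: b => x //; rewrite /gfac /=; exact: (act_loc (inr x)).1.
Qed.

Lemma tmx_tprod (l : seq (arr D)) : tmx (tprod [seq factor_t K b | b <- l])
  = \big[mulmx/1%:M]_(b <- rev l) gfac (@std_sign Q) actX b.
Proof.
elim: l => [|b l IH] /=; first by rewrite big_nil.
by rewrite rev_cons -cats1 big_cat big_seq1 IH act_factor.
Qed.

Lemma act_prod : \big[mulmx/1%:M]_(b <- rev ord) gfac (@std_sign Q) actX b
  = \sum_v q v *: actE v.
Proof.
rewrite -tmx_tprod (tmx_rel (rel_mult ord q)) tmx_tsum big_map big_enum /=.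
by apply: eq_bigr => v _; rewrite mul_mx_scalar.
Qed.

(** The algebra has one relation, a product over all arrows, while [is_rep] asks for one product per
    vertex. Multiplied by [actE v], the factors of arrows with another head disappear, and the
    others commute with [actE v]. *)
Lemma act_is_rep : is_rep (rev ord) (@std_sign Q) q actE actX.
Proof.
split=> [v|b|b|b|v]; first exact: actE_idem.
- exact: actX_tl.
- exact: actX_hd.
- exact: (act_loc b).2.
have FE b : 1%:M + actX (star b) *m actX b \in unitmx := (act_loc b).2.
have Gne b : hd b != v -> actE v *m gfac (@std_sign Q) actX b = actE v.
  move=> hb; have E1 : actE v *m (1%:M + actX (star b) *m actX b) = actE v.
    rewrite mulmxDr mulmx1 mulmxA -(actX_tl (star b)) tl_star mulmxA actE_orth 1?eq_sym //.
    by rewrite !mul0mx addr0.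
  by rewrite /gfac; case: ifP => // _; rewrite -{1}E1 mulmxK.
have Geq b : hd b = v -> actE v *m gfac (@std_sign Q) actX b
    = gfac (@std_sign Q) actX b *m actE v.
  move=> hb; have E1 : actE v *m (1%:M + actX (star b) *m actX b)
      = (1%:M + actX (star b) *m actX b) *m actE v.
    have e1 : actE v *m actX (star b) = actX (star b) by rewrite -hb -(tl_star b) actX_tl.
    have e2 : actX b *m actE v = actX b by rewrite -hb actX_hd.
    by rewrite mulmxDl mulmxDr mulmx1 mul1mx mulmxA e1 -mulmxA e2.
  by rewrite /gfac; case: ifP => // _; exact: invmx_comm.
have filt (l : seq (arr D)) :
    actE v *m \big[mulmx/1%:M]_(b <- l | hd b == v) gfac (@std_sign Q) actX b
    = actE v *m \big[mulmx/1%:M]_(b <- l) gfac (@std_sign Q) actX b.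
  elim: l => [|b l IH]; first by rewrite !big_nil.
  rewrite !big_cons; case: (eqVneq (hd b) v) => hb; last by rewrite IH mulmxA Gne.
  by rewrite !mulmxA Geq // -!mulmxA IH.
rewrite filt act_prod mulmx_sumr (bigD1 v) //= -scalemxAr actE_idem big1 ?addr0 // => w wv.
by rewrite -scalemxAr actE_orth ?scaler0 // eq_sym.
Qed.

Lemma dim_vec_act m (A : 'M_(m, n)) v : dim_vec (mx2vs A) v = (\rank (A *m actE v))%:Z.
Proof. by rewrite ffunE dim_lfun_img. Qed.

Lemma dim_vec_full : dim_vec (M := M) fullv = dvec actE.
Proof. by apply/ffunP => v; rewrite dim_vec_act ffunE mul1mx. Qed.

Section Sub.
Variable U : vert Q -> 'M[K]_n.
Hypothesis sU : subrep actE actX U.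
Let A : 'M[K]_n := (\sum_v U v)%MS.

Let UE v : U v *m actE v = U v.
Proof. by have [UE _] := sU; have /submxP[Z ->] := UE v; rewrite -mulmxA actE_idem. Qed.

Let UEne v w : v != w -> U v *m actE w = 0.
Proof. by move=> vw; rewrite -(UE v) -mulmxA actE_orth // mulmx0. Qed.

Let AE v : (A *m actE v :=: U v)%MS.
Proof.
apply/eqmxP/andP; split.
  rewrite /A sumsmxMr; apply/sumsmx_subP => w _.
  by case: (eqVneq w v) => [->|/UEne ->]; rewrite ?UE ?sub0mx.
rewrite -{1}(UE v); apply: submxMr; exact: (sumsmx_sup v).
Qed.

Let AX b : (A *m actX b <= A)%MS.
Proof.
rewrite {1}/A sumsmxMr; apply/sumsmx_subP => w _; case: (eqVneq w (tl b)) => [->|/UEne Uw].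
  apply: submx_trans (sU.2 b) _; exact: (sumsmx_sup (hd b)).
by rewrite -actX_tl mulmxA Uw mul0mx sub0mx.
Qed.

(** Induction on a term representing the algebra element; the formal inverses are covered by
    [submx_invmx], so invariance under the arrows is enough. *)
Lemma sub_submodule : submodule (M := M) (mx2vs A).
Proof.
move=> x; have [t ->] := cls_surj x; rewrite lfun_img_sub -[f2mx _]/(actmx _) tmxE.
elim: t => [k|[v|b|b]|s IHs t IHt|s IHs t IHt] /=.
- by rewrite mul_mx_scalar scalemx_sub.
- by rewrite (AE v); exact: (sumsmx_sup v).
- exact: AX.
- have [-> u] := act_loc b; apply: submx_invmx => //.
  rewrite mulmxDr mulmx1 addmx_sub // mulmxA.
  exact: submx_trans (submxMr _ (AX _)) (AX _).
- by rewrite mulmxDr addmx_sub.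
- by rewrite mulmxA; apply: submx_trans (submxMr _ IHt) IHs.
Qed.

Lemma dim_vec_sub : dim_vec (M := M) (mx2vs A) = dvec U.
Proof. by apply/ffunP => v; rewrite dim_vec_act ffunE (AE v). Qed.

Lemma sub_neq0 v : U v != 0 -> mx2vs A != 0%VS.
Proof.
move=> Uv; apply: contra Uv => /eqP A0; have := dim_vec_sub; rewrite A0 => /ffunP/(_ v).
rewrite !ffunE limg0 => /eqP; rewrite eqz_nat dimv0 eq_sym mxrank_eq0 //.
Qed.

Lemma sub_neqf v : ~~ (actE v <= U v)%MS -> mx2vs A != fullv.
Proof.
apply: contra => /eqP Af; rewrite -(AE v) -{1}[actE v]mul1mx; apply: submxMr.
have : (fullv <= mx2vs A)%VS by rewrite Af.
by rewrite /subsetv !mx2vsK.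
Qed.

End Sub.

Lemma act_stable th : theta_stable M th -> stable_rep th actE actX.
Proof.
move=> [f0 t0 st]; split.
- rewrite -dim_vec_full; apply: contra f0 => /eqP d0.
  have E0 v : actE v = 0.
    have := congr1 (fun f : lattice Q => f v) d0; rewrite dim_vec_full !ffunE => /eqP.
    by rewrite eqz_nat mxrank_eq0 => /eqP.
  have I0 : 1%:M = 0 :> 'M[K]_n by rewrite -actE_sum big1.
  rewrite -dimv_eq0 dimvf; move/(congr1 mxrank): I0; rewrite mxrank1 mxrank0 => ->.
  by [].
- by rewrite -dim_vec_full.
- move=> U sU [v Uv] [w Uw]; rewrite -(dim_vec_sub sU).
  apply: st; [exact: sub_submodule|exact: (sub_neq0 sU Uv)|exact: (sub_neqf sU Uw)].
Qed.

Theorem theta_stable_has_stable th : theta_stable M th ->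
  has_stable (rev ord) q th (dim_vec (M := M) fullv).
Proof.
move=> st; exists n, actE, actX; split; [exact: act_is_rep|exact: act_stable|].
by rewrite dim_vec_full.
Qed.

End Extract.

(** * Signs of roots and transport along reflections *)

Section Primes.

Lemma logn_prod (I : Type) (r : seq I) (P : pred I) (F : I -> nat) p :
  (forall i, (0 < F i)%N) ->
  logn p (\prod_(i <- r | P i) F i)%N = (\sum_(i <- r | P i) logn p (F i))%N.
Proof.
move=> F0; elim: r => [|i r IH]; first by rewrite !big_nil logn1.
rewrite !big_cons; case: ifP => // _; rewrite lognM ?IH //.
by apply: prodn_cond_gt0 => j _; exact: F0.
Qed.

Lemma prime_family (T : finType) : exists p : T -> nat, injective p /\ forall x, prime (p x).
Proof.
have next m : exists p, prime p /\ (m < p)%N by have [p mp pp] := prime_above m; exists p.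
have [nx nxP] := choice next.
pose f k := iter k nx (nx 0).
have pf k : prime (f k) by case: k => [|k]; exact: (nxP _).1.
have finc : {homo f : i j / (i < j)%N}.
  by apply: homo_ltn => [? ? ?|k]; [exact: ltn_trans|exact: (nxP _).2].
have finj : injective f.
  move=> i j fij; case: (ltngtP i j) => // /finc; by rewrite fij ltnn.
exists (fun x => f (enum_rank x)); split=> // x y /finj/val_inj; exact: enum_rank_inj.
Qed.

(** Moving the negative exponents to the other side gives an equality of natural numbers, and the
    p-adic valuations compare the exponents. *)
Lemma prime_relation (T : finType) (p : T -> nat) (S : pred T) (z : T -> int) :
  injective p -> (forall x, prime (p x)) ->
  \prod_(x | S x) (p x)%:R ^ z x = 1 :> rat -> forall x, S x -> z x = 0.
Proof.
move=> pinj pp zp x Sx.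
have p0 y : (0 < p y)%N by exact: prime_gt0.
pose A := (\prod_(y | S y) p y ^ (if (0 <= z y)%R then `|z y| else 0))%N.
pose B := (\prod_(y | S y) p y ^ (if (0 <= z y)%R then 0 else `|z y|))%N.
have AB : A = B.
  have B0 : B%:R != 0 :> rat.
    by rewrite pnatr_eq0 -lt0n; apply: prodn_cond_gt0 => y _; rewrite expn_gt0 p0.
  apply/eqP; rewrite -(eqr_nat rat); apply/eqP/(divIf B0); rewrite divff // -[RHS]zp.
  rewrite /A /B !natr_prod -prodf_div; apply: eq_bigr => y _; rewrite !natrX.
  case: (z y) => k /=; first by rewrite expr0 divr1.
  by rewrite expr0 mul1r NegzE -exprnN.
have lg (e : T -> nat) : logn (p x) (\prod_(y | S y) p y ^ e y)%N = e x.
  rewrite logn_prod => [|y]; last by rewrite expn_gt0 p0.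
  rewrite (bigD1 x) //= big1 => [|y /andP[_ yx]].
    by rewrite addn0 lognX logn_prime // eqxx muln1.
  rewrite lognX logn_prime //; case: eqP => [/pinj xy|_]; last by rewrite muln0.
  by rewrite xy eqxx in yx.
have := congr1 (logn (p x)) AB; rewrite /A /B !lg.
by case: (z x) => k //= ->.
Qed.

End Primes.

(** * Words in the reflections and the signs of roots *)

Section Words.
Variable Q : quiver.
Implicit Types (a b x y : lattice Q) (v w c : vert Q) (s : seq (vert Q)).

Lemma reflectionMz v a (n : int) : reflection v (a *~ n) = reflection v a *~ n.
Proof.
case: n => n; first exact: reflectionMn.
by rewrite NegzE !mulrNz reflectionN -!pmulrn reflectionMn.
Qed.

Definition act s a := foldr (@reflection Q) a s.

Lemma actB s a b : act s (a - b) = act s a - act s b.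
Proof. by elim: s => //= v s ->; rewrite reflectionD reflectionN. Qed.

Lemma actN s a : act s (- a) = - act s a.
Proof. by elim: s => //= v s ->; rewrite reflectionN. Qed.

Lemma actMz s a (n : int) : act s (a *~ n) = act s a *~ n.
Proof. by elim: s => //= v s ->; rewrite reflectionMz. Qed.

Definition lfseq s := forall v, v \in s -> loopfree v.

Lemma lfseq_cons v s : lfseq (v :: s) -> loopfree v /\ lfseq s.
Proof. by move=> l; split=> [|w ws]; apply: l; rewrite inE ?eqxx ?ws ?orbT. Qed.

Lemma lfseq_cat s t : lfseq (s ++ t) <-> lfseq s /\ lfseq t.
Proof.
split=> [l|[ls lt] v]; last by rewrite mem_cat => /orP[/ls|/lt].
by split=> v vs; apply: l; rewrite mem_cat vs ?orbT.
Qed.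

Lemma act_symf s a b : lfseq s -> symf (act s a) (act s b) = symf a b.
Proof.
by elim: s => //= v s IH /lfseq_cons[lv ls]; rewrite reflection_symf // IH.
Qed.

Lemma act_cat s t a : act (s ++ t) a = act s (act t a).
Proof. exact: foldr_cat. Qed.

Lemma act_revK s a : lfseq s -> act s (act (rev s) a) = a.
Proof.
elim: s a => //= v s IH a /lfseq_cons[lv ls].
by rewrite rev_cons -cats1 act_cat /= IH // reflectionK.
Qed.

Lemma act_eq0 s a : lfseq s -> act s a = 0 -> a = 0.
Proof.
elim: s => //= v s IH /lfseq_cons[lv ls] /(congr1 (reflection v)).
by rewrite reflectionK // reflection0; exact: IH.
Qed.

Lemma reflected_fromP a b : reflected_from a b <-> exists2 s, lfseq s & b = act s a.
Proof.
split=> [|[s ls ->]].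
  elim=> [|{}b v _ [s ls ->] lv]; first by exists [::].
  exists (v :: s) => // w; rewrite inE => /orP[/eqP->//|]; exact: ls.
elim: s ls => [|v s IH] /=; first by constructor.
by move=> /lfseq_cons[lv ls]; apply: reflected_step => //; exact: IH.
Qed.

Lemma real_root_reflect v a : loopfree v -> real_root a -> real_root (reflection v a).
Proof. by move=> lv [w [lw ra]]; exists w; split=> //; exact: reflected_step. Qed.

Lemma imaginary_root_reflect v a : loopfree v -> imaginary_root a ->
  imaginary_root (reflection v a).
Proof.
by move=> lv [b [fb []]] rb; exists b; split=> //; [left|right]; exact: reflected_step.
Qed.

Lemma real_root_symf a : real_root a -> symf a a = 2.
Proof.
move=> [v [lv /reflected_fromP[s ls ->]]]; rewrite act_symf // symf_coord.
exact/loopfree_cart.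
Qed.

Lemma fundamental_symf_le0 a x : fundamental a -> nonneg x -> symf a x <= 0.
Proof.
move=> [_ _ _ fa] x0; rewrite symf_sumr; apply: sumr_le0 => v _.
exact: mulr_ge0_le0.
Qed.

Lemma imaginary_root_symf a : imaginary_root a -> symf a a <= 0.
Proof.
move=> [b [fb]]; have b0 : nonneg b by case: fb.
have := fundamental_symf_le0 fb b0 => bb.
by case=> /reflected_fromP[s ls ->]; rewrite act_symf // ?symfNl ?symfNr ?opprK.
Qed.

Lemma imaginary_root_neq0 a : imaginary_root a -> a != 0.
Proof.
move=> [b [[b0 _ _ _] rb]]; apply: contra b0 => /eqP a0.
case: rb => /reflected_fromP[s ls]; rewrite a0 => /esym/(act_eq0 ls) /eqP //.
by rewrite oppr_eq0.
Qed.

Lemma real_root_neq0 a : real_root a -> a != 0.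
Proof. by move/real_root_symf => a2; apply/eqP => a0; move: a2; rewrite a0 symf0l. Qed.

Lemma torsion_free a (n : int) : n != 0 -> a *~ n = 0 -> a = 0.
Proof.
move=> n0 /ffunP an; apply/ffunP => v; have := an v.
rewrite ffunMzE !ffunE -mulrzr intz => /eqP; rewrite mulf_eq0 (negbTE n0) orbF.
by move/eqP.
Qed.

(* A real root is, up to sign, the dimension vector of a simple module over a
   multiplicative preprojective algebra whose parameter kills only the
   multiples of that root. *)
Lemma real_root_sign a : real_root a -> nonneg a \/ nonneg (- a).
Proof.
move=> [v [lv ra]]; pose ord := enum (arr (double_quiver Q)).
have po : perm_eq ord (enum (arr (double_quiver Q))) := perm_refl _.
suff [q [_ _ [st|st]]] : exists q : {ffun vert Q -> rat},
    [/\ forall w, q w != 0,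
        forall z : lattice Q, qpow q z = 1 -> exists n : int, z = a *~ n
      & has_stable ord q 0 a \/ has_stable ord q 0 (- a)].
  by left; case: (has_stable_Nqt po st).
  by right; case: (has_stable_Nqt po st).
elim: ra => [|b u _ [q [q0 qz qst]] lu].
  (* The parameter is 1 at [v] and takes distinct prime values elsewhere, so by unique factorisation
     q^z = 1 only for multiples of e_v. *)
  have [p [pinj pp]] := prime_family (vert Q).
  exists [ffun w => if w == v then 1 else (p w)%:R]; split=> [w|z|].
  - by rewrite ffunE; case: ifP => // _; rewrite pnatr_eq0 -lt0n prime_gt0.
  - rewrite /qpow (bigD1 v) //= ffunE eqxx exp1rz mul1r => zp; exists (z v).
    have z0 w : w != v -> z w = 0.
      apply: (prime_relation (S := fun w => w != v) pinj pp).
      by rewrite -[RHS]zp; apply: eq_bigr => x xv; rewrite ffunE (negbTE xv).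
    apply/ffunP => w; rewrite ffunMzE coordE; have [<-|wv] := eqVneq v w.
      by rewrite -mulrzr intz mul1r.
    by rewrite z0 1?eq_sym // mul0rz.
  - by left; apply: has_stable_coord => //; rewrite ffunE eqxx.
have [q1|q1] := eqVneq (q u) 1; last first.
  have th0 : reflect_th u (0 : lattice Q) = 0.
    by apply/ffunP => w; rewrite reflect_thE !ffunE mulr0 subr0.
  exists (reflect_q u q); split; first exact: reflect_q_neq0.
  - move=> z; rewrite -{1}(reflectionK lu z) qpow_reflect // => /qz[n zE].
    by exists n; rewrite -(reflectionK lu z) zE reflectionMz.
  - rewrite -reflectionN -th0; case: qst => st; [left|right];
      by apply: (has_stable_reflect po lu q0 st); left.
(* If q_u = 1, the choice of [q] makes e_u a multiple of [b], and the reflection only changes the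
   sign of [b]. This is why the induction carries both signs. *)
have [n eE] : exists n : int, coord_vec u = b *~ n by apply: qz; rewrite qpow_coord.
have n0 : n != 0.
  by apply/eqP => n0; have := coord_neq0 u; rewrite eE n0 mulr0z eqxx.
have rb : reflection u b = - b.
  apply/eqP; rewrite -addr_eq0; apply/eqP; apply: (torsion_free n0).
  by rewrite mulrzDl -reflectionMz -eE reflection_coord // addNr.
exists q; rewrite rb opprK; split=> [//|z /qz[m ->]|]; last by case: qst; [right|left].
by exists (- m); rewrite mulNrz mulrNz opprK.
Qed.

Lemma single_support v a : (forall w, w != v -> a w = 0) -> a = coord_vec v *~ a v.
Proof.
move=> av; apply/ffunP => w; rewrite ffunMzE coordE; have [<-|wv] := eqVneq v w.
  by rewrite -mulrzr intz mul1r.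
by rewrite av 1?eq_sym // mul0rz.
Qed.

(** Here (a, a) = 2 a_v^2, which is 2 for a real root and would be at most 0 for an imaginary
    one. *)
Lemma single_support_root v a : loopfree v -> nonneg a -> (forall w, w != v -> a w = 0) ->
  real_root a \/ imaginary_root a -> a = coord_vec v.
Proof.
move=> lv a0 /single_support aE.
have aa : symf a a = a v * a v * 2.
  have -> : symf a a = symf (coord_vec v *~ a v) (coord_vec v *~ a v) by rewrite -aE.
  by rewrite symfZl symfC symfZl symf_coord ((loopfree_cart v).1 lv) mulrA.
have av : 0 <= a v := a0 v.
case=> [/real_root_symf|ia]; first by rewrite aa => av1; rewrite aE (_ : a v = 1) ?mulr1z //; nia.
have := imaginary_root_symf ia; have := imaginary_root_neq0 ia.
rewrite aa => a0' le0; have av0 : a v = 0 by nia.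
by case/eqP: a0'; rewrite aE av0 mulr0z.
Qed.

(** At the first letter where the sign changes, the reflection alters one coordinate only, so the
    root just before it is supported at that letter and is its coordinate vector. *)
Lemma word_first_negative s a : lfseq s -> real_root a -> nonneg a ->
  nonneg (- act (rev s) a) ->
  exists s1 c s2, s = s1 ++ c :: s2 /\ act (rev s1) a = coord_vec c.
Proof.
elim: s a => [|c s IH] a ls ra a0.
  move=> na; case/eqP: (real_root_neq0 ra); apply/ffunP => v; rewrite ffunE.
  by have := na v; have := a0 v; rewrite ffunE /=; lia.
have [lc ls'] := lfseq_cons ls.
rewrite rev_cons -cats1 act_cat /= => na.
case: (real_root_sign (real_root_reflect lc ra)) => [ra0|nra].
  have [s1 [d [s2 [-> e]]]] := IH _ ls' (real_root_reflect lc ra) ra0 na.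
  by exists (c :: s1), d, s2; rewrite rev_cons -cats1 act_cat /= e.
exists [::], c, s; split=> //=; apply: single_support_root => //; last by left.
move=> w wc; have := nra w; have := a0 w; rewrite ffunE reflection_neq //; lia.
Qed.

(* The exchange condition: a letter that would decrease an element of the
   orbit of [g] cancels against an earlier letter of the word. *)
Lemma act_fundamental_nonneg g s : fundamental g -> lfseq s -> nonneg (act s g).
Proof.
move=> fg; have [n] := ubnP (size s); elim: n s => // n IH [|i s] /=.
  by case: fg => _ g0 _ _ _ _.
rewrite ltnS => sn ls; have [li ls'] := lfseq_cons ls.
have lrs : lfseq (rev s) by move=> v; rewrite mem_rev => /ls'.
have re : real_root (act (rev s) (coord_vec i)).
  by exists i; split=> //; apply/reflected_fromP; exists (rev s).
have re0 : real_root (coord_vec i) by exists i; split=> //; constructor.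
case: (real_root_sign re) => [e0|ne].
  have := IH s sn ls' => a0 v; have [->|vi] := eqVneq v i; last by rewrite reflection_neq.
  rewrite reflection_eq -(act_revK (coord_vec i) ls') act_symf //.
  by have := fundamental_symf_le0 fg e0; have := a0 i; lia.
have [s1 [c [s2 [sE e]]]] := word_first_negative ls' re0 (@coord_nonneg Q i) ne.
have [l1 l2] : lfseq s1 /\ lfseq (c :: s2) by apply/lfseq_cat; rewrite -sE.
have [lc l2'] := lfseq_cons l2.
have ei : act s1 (coord_vec c) = coord_vec i by rewrite -e act_revK.
have -> : reflection i (act s g) = act (s1 ++ s2) g.
  rewrite sE !act_cat -[act (c :: s2) g]/(reflection c (act s2 g)).
  set y := act s2 g; rewrite [LHS]reflectionE -{2}ei act_symf // -ei -actMz -actB -reflectionE.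
  by rewrite reflectionK.
apply: IH; last exact/lfseq_cat.
by apply: leq_trans sn; rewrite sE !size_cat /= addnS ltnS.
Qed.

Lemma root_sign a : real_root a \/ imaginary_root a -> nonneg a \/ nonneg (- a).
Proof.
case=> [/real_root_sign //|[g [fg []]] /reflected_fromP[s ls ->]].
  by left; exact: act_fundamental_nonneg.
by right; rewrite actN opprK; exact: act_fundamental_nonneg.
Qed.

Section Transport.
Variable K : fieldType.
Implicit Types (q : {ffun vert Q -> K}) (th : lattice Q).

(** By [root_sign] the reflected root could fail to be positive only if [b] were e_v, because one
    coordinate changes; but admissibility says that e_v is not in N_{q,theta}. *)
Lemma Rqt_reflect q th v b : (forall w, q w != 0) -> loopfree v ->
  q v != 1 \/ th v != 0 -> Rqt q th b ->
  Rqt (reflect_q v q) (reflect_th v th) (reflection v b).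
Proof.
move=> q0 lv adm [[rb b0] nb].
have rr : real_root (reflection v b) \/ imaginary_root (reflection v b).
  by case: rb => [/(real_root_reflect lv)|/(imaginary_root_reflect lv)]; [left|right].
suff r0 : nonneg (reflection v b) by split=> //; exact: Nqt_reflect.
case: (root_sign rr) => // nr.
have bE : b = coord_vec v.
  apply: single_support_root => // w wv; have := nr w; have := b0 w.
  by rewrite ffunE reflection_neq //; lia.
have [_ qb tb] := nb; move: qb tb; rewrite bE qpow_coord dotp_coord => q1 t1.
by case: adm; rewrite ?q1 ?t1 eqxx.
Qed.

Lemma admissible_reflect q th v : loopfree v -> (forall w, q w != 0) ->
  q v != 1 \/ th v != 0 -> reflect_q v q v != 1 \/ reflect_th v th v != 0.
Proof.
move=> /loopfree_cart cv q0; rewrite reflect_qE reflect_thE cv.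
have -> : q v ^ (- 2) * q v = (q v)^-1 by rewrite -{2}[q v]expr1z -expfzDr.
case=> [qv|tv]; [left|right]; first by rewrite invr_eq1.
by move: tv; apply: contra => /eqP ?; apply/eqP; lia.
Qed.

Lemma Sigma_reflect q th v a : (forall w, q w != 0) -> loopfree v ->
  q v != 1 \/ th v != 0 -> Sigma q th a ->
  Sigma (reflect_q v q) (reflect_th v th) (reflection v a).
Proof.
move=> q0 lv adm [ra sa]; split; first exact: Rqt_reflect.
move=> s s2 sR aE; rewrite reflection_pfun //.
have pE : \sum_(b <- s) pfun b = \sum_(b <- map (@reflection Q v) s) pfun b.
  by rewrite big_map; apply: eq_bigr => b _; rewrite reflection_pfun.
rewrite pE; apply: sa; first by rewrite size_map.
  move=> _ /mapP[b /sR rb ->].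
  have := Rqt_reflect (reflect_q_neq0 v q0) lv (admissible_reflect lv q0 adm) rb.
  by rewrite reflect_qK // reflect_thK.
by rewrite -reflection_sum -aE reflectionK.
Qed.

Lemma Sigma_iso_reflect q th v a : (forall w, q w != 0) -> loopfree v ->
  q v != 1 \/ th v != 0 -> Sigma_iso q th a ->
  Sigma_iso (reflect_q v q) (reflect_th v th) (reflection v a).
Proof.
move=> q0 lv adm [sa ia pa]; split; first exact: Sigma_reflect.
  exact: imaginary_root_reflect.
by rewrite reflection_pfun.
Qed.

Lemma Sigma_transport q th a q' th' a' : (forall w, q w != 0) ->
  admissibly_reflected_from q th a q' th' a' ->
  Sigma q th a \/ proper_multiples (Sigma_iso q th) a ->
  (forall w, q' w != 0) /\
  (Sigma q' th' a' \/ proper_multiples (Sigma_iso q' th') a').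
Proof.
move=> q0 adm start; elim: adm => [//|q1 th1 a1 v _ [q10 IH] lv ad].
split; first exact: reflect_q_neq0.
case: IH => [sa|[m [b [m2 ib ->]]]]; first by left; exact: Sigma_reflect.
by right; exists m, (reflection v b); split=> //; [exact: Sigma_iso_reflect|rewrite reflectionMn].
Qed.

Lemma admissibly_reflected_trans q th a q1 th1 a1 q2 th2 a2 :
  admissibly_reflected_from q th a q1 th1 a1 ->
  admissibly_reflected_from q1 th1 a1 q2 th2 a2 ->
  admissibly_reflected_from q th a q2 th2 a2.
Proof. by move=> A1; elim=> // q' th' a' v _ IH lv ad; exact: admissible_step. Qed.

Lemma admissibly_reflected_back q th a v : (forall w, q w != 0) -> loopfree v ->
  q v != 1 \/ th v != 0 ->
  admissibly_reflected_from (reflect_q v q) (reflect_th v th) (reflection v a) q th a.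
Proof.
move=> q0 lv adm; rewrite -{2}(reflect_qK lv q0) -{2}(reflect_thK th lv) -{2}(reflectionK lv a).
by apply: admissible_step => //; [exact: admissible_nil|exact: admissible_reflect].
Qed.

End Transport.
End Words.

(** * Decompositions of fundamental vectors *)

Section Pairs.
Variable Q : quiver.
Implicit Types (a b x y : lattice Q) (v w i l : vert Q).
Local Notation "n %:R'" := (n%:~R : rat) (at level 2, format "n %:R'").

(* Kac's identity for the form on a decomposition of [x + y]; at vertices where
   [x + y] vanishes both sides vanish, as division by zero gives zero. *)
Lemma pairing_identity x y (a := x + y) : nonneg x -> nonneg y ->
  (symf x y)%:R' *+ 2 =
  (\sum_i (symf a (coord_vec i))%:R' * (x i)%:R' * (y i)%:R' / (a i)%:R') *+ 2
  + \sum_i \sum_l (cart i l)%:R' * ((x i * y l - x l * y i)%:R') ^+ 2 / ((a i)%:R' * (a l)%:R').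
Proof.
move=> x0 y0.
have E1 : (symf x y)%:R' *+ 2 =
    \sum_i \sum_l (cart i l)%:R' * ((x i)%:R' * (y l)%:R' + (x l)%:R' * (y i)%:R').
  rewrite mulr2n {2}symfC !symfE !rmorph_sum -big_split; apply: eq_bigr => i _ /=.
  rewrite !rmorph_sum -big_split; apply: eq_bigr => l _ /=.
  by rewrite !rmorphM /=; ring.
have E2 : (\sum_i (symf a (coord_vec i))%:R' * (x i)%:R' * (y i)%:R' / (a i)%:R') *+ 2 =
    \sum_i \sum_l (cart i l)%:R' * ((a l)%:R' * (x i)%:R' * (y i)%:R' / (a i)%:R'
       + (a i)%:R' * (x l)%:R' * (y l)%:R' / (a l)%:R').
  have E3 : \sum_i (symf a (coord_vec i))%:R' * (x i)%:R' * (y i)%:R' / (a i)%:R' =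
      \sum_i \sum_l (cart i l)%:R' * ((a l)%:R' * (x i)%:R' * (y i)%:R' / (a i)%:R').
    apply: eq_bigr => i _; rewrite symf_coordr rmorph_sum /= !mulr_suml.
    by apply: eq_bigr => l _; rewrite rmorphM /= cartC; ring.
  rewrite mulr2n {2}E3 exchange_big E3 -big_split; apply: eq_bigr => i _ /=.
  by rewrite -big_split; apply: eq_bigr => l _ /=; rewrite [cart l i]cartC mulrDr.
rewrite E1 E2 -big_split; apply: eq_bigr => i _; rewrite -big_split; apply: eq_bigr => l _ /=.
rewrite -[X in _ = _ + X]mulrA -mulrDr; congr (_ * _).
have aE w : a w = x w + y w by rewrite ffunE.
have a0 w : a w = 0 -> x w = 0 /\ y w = 0.
  by rewrite aE; have := x0 w; have := y0 w; lia.
rewrite rmorphB !rmorphM /=.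
have [ai|ai] := eqVneq (a i) 0; first by have [-> ->] := a0 _ ai; rewrite ai !(mul0r, mulr0, addr0, subr0, invr0, expr0n).
have [al|al] := eqVneq (a l) 0; first by have [-> ->] := a0 _ al; rewrite al !(mul0r, mulr0, addr0, subr0, invr0, expr0n).
rewrite !aE !rmorphD /=.
have hi : (x i)%:R' + (y i)%:R' != 0 by rewrite -rmorphD /= -aE intr_eq0.
have hl : (x l)%:R' + (y l)%:R' != 0 by rewrite -rmorphD /= -aE intr_eq0.
by field; rewrite hi hl.
Qed.

Lemma square_term_le0 x y i l : nonneg x -> nonneg y ->
  (cart i l)%:R' * ((x i * y l - x l * y i)%:R') ^+ 2 / (((x + y) i)%:R' * ((x + y) l)%:R') <= 0.
Proof.
move=> x0 y0; have [->|il] := eqVneq i l; first by rewrite subrr expr0n /= mulr0 mul0r.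
have a0 w : 0 <= (x + y) w by rewrite ffunE addr_ge0.
rewrite mulr_le0_ge0 ?invr_ge0 ?mulr_ge0 ?ler0z //.
by rewrite mulr_le0_ge0 ?sqr_ge0 // lerz0 cart_le0.
Qed.

Lemma linear_term_le0 x y i : fundamental (x + y) -> nonneg x -> nonneg y ->
  (symf (x + y) (coord_vec i))%:R' * (x i)%:R' * (y i)%:R' / ((x + y) i)%:R' <= 0.
Proof.
move=> [_ a0 _ fa] x0 y0; rewrite mulr_le0_ge0 ?invr_ge0 ?ler0z //.
by rewrite mulr_le0_ge0 ?ler0z // mulr_le0_ge0 ?ler0z // lerz0.
Qed.

Lemma pairing_le0 x y : fundamental (x + y) -> nonneg x -> nonneg y -> symf x y <= 0.
Proof.
move=> fa x0 y0; have := pairing_identity x0 y0.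
have S1 : \sum_i (symf (x + y) (coord_vec i))%:R' * (x i)%:R' * (y i)%:R' / ((x + y) i)%:R' <= 0.
  by apply: sumr_le0 => i _; exact: linear_term_le0.
have S2 : \sum_i \sum_l (cart i l)%:R' * ((x i * y l - x l * y i)%:R') ^+ 2
    / (((x + y) i)%:R' * ((x + y) l)%:R') <= 0.
  by apply: sumr_le0 => i _; apply: sumr_le0 => l _; exact: square_term_le0.
by rewrite -(lerz0 rat) => ?; move: S1 S2; lra.
Qed.

Lemma sum_le0_eq0 (T : finType) (F : T -> rat) :
  (forall t, F t <= 0) -> \sum_t F t = 0 -> forall t, F t = 0.
Proof.
move=> F0 S0 t; apply/eqP; rewrite eq_le F0 /=.
have := S0; rewrite (bigD1 t) //= => E.
have := sumr_le0 (index_enum T) (fun s (_ : s != t) => F0 s); move: E; lra.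
Qed.

Definition proportional x y := forall i l, x i * y l = x l * y i.

(** All terms of Kac's identity are nonpositive, so each of them vanishes. The quadratic ones make x
    / (x + y) constant along edges, hence on the connected support; then [x] and [y] are positive on
    all of it, and the linear terms give the orthogonality. *)
Lemma pairing_eq0 x y : fundamental (x + y) -> nonneg x -> nonneg y ->
  x != 0 -> y != 0 -> symf x y = 0 ->
  proportional x (x + y) /\ forall i, i \in supp (x + y) -> symf (x + y) (coord_vec i) = 0.
Proof.
move=> fa x0 y0 xn yn sxy; have := pairing_identity x0 y0; rewrite sxy mul0rn.
have T1 i := linear_term_le0 i fa x0 y0; have T2 i l := square_term_le0 i l x0 y0.
set S2 := \sum_i \sum_l _; set S1 := \sum_i _ => /esym SE.
have S10 : S1 <= 0 by apply: sumr_le0 => i _; exact: T1.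
have T2s i : \sum_l (cart i l)%:R' * ((x i * y l - x l * y i)%:R') ^+ 2
    / (((x + y) i)%:R' * ((x + y) l)%:R') <= 0.
  by apply: sumr_le0 => l _; exact: T2.
have S20 : S2 <= 0 by apply: sumr_le0 => i _; exact: T2s.
have E1 : S1 = 0 by move: S10 S20 SE; rewrite mulr2n; lra.
have E2 : S2 = 0 by move: E1 SE => ->; rewrite mul0rn add0r.
have L1 := sum_le0_eq0 T1 E1.
have L2 i := sum_le0_eq0 (T2 i) (sum_le0_eq0 T2s E2 i).
have [_ a0 ca _] := fa.
have aE w : (x + y) w = x w + y w by rewrite ffunE.
have adj i l : i \in supp (x + y) -> l \in supp (x + y) -> adjacent i l ->
    x i * (x + y) l = x l * (x + y) i.
  rewrite !inE => ai al il; have [->//|ne] := eqVneq i l.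
  have := L2 i l; move/eqP; rewrite adjacent_cart // in il.
  rewrite mulf_eq0 invr_eq0 !mulf_eq0 !intr_eq0 (negbTE ai) (negbTE al) !orbF.
  by rewrite (lt_eqF il) /= orbb !aE => /eqP; lia.
have prop i l : i \in supp (x + y) -> l \in supp (x + y) -> x i * (x + y) l = x l * (x + y) i.
  move=> ai al; apply: (connected_in_ind (P := fun l => x i * (x + y) l = x l * (x + y) i) ca ai al) => //.
  move=> u w au aw uw xu; have := adj u w au aw uw.
  have : (x + y) u != 0 by rewrite inE in au.
  move=> un uwE; apply/eqP; rewrite -subr_eq0.
  suff : (x i * (x + y) w - x w * (x + y) i) * (x + y) u == 0 by rewrite mulf_eq0 (negbTE un) orbF.
  by rewrite mulrBl subr_eq0; apply/eqP; rewrite mulrAC xu mulrAC uwE mulrAC.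
have out w : w \notin supp (x + y) -> x w = 0 /\ (x + y) w = 0.
  by rewrite inE negbK aE => /eqP; have := x0 w; have := y0 w; lia.
have pr : proportional x (x + y).
  move=> i l; have [ai|ai] := boolP (i \in supp (x + y)); last first.
    by have [-> ->] := out _ ai; rewrite mul0r mulr0.
  have [al|al] := boolP (l \in supp (x + y)); last first.
    by have [-> ->] := out _ al; rewrite mul0r mulr0.
  exact: prop.
split=> // i ai.
have [v xv] := neq0_supp xn; have [w yw] := neq0_supp yn.
have ai' : (x + y) i != 0 by rewrite inE in ai.
have xi : x i != 0.
  have := pr v i; apply: contra_eq_neq => xi0; rewrite xi0 mul0r mulf_neq0 //.
have yi : y i != 0.
  have := pr w i; rewrite !aE => E.
  have yE : y w * x i = x w * y i by lia.
  move: yE; apply: contra_eq_neq => ->; rewrite mulr0 mulf_neq0 //.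
have := L1 i; move/eqP; rewrite !mulf_eq0 invr_eq0 !intr_eq0 (negbTE xi) (negbTE yi) (negbTE ai').
by rewrite !orbF => /eqP.
Qed.

Section Params.
Variable K : fieldType.
Variables (q : {ffun vert Q -> K}) (th : lattice Q).

Lemma root_neq0 a : real_root a \/ imaginary_root a -> a != 0.
Proof. by case=> [/real_root_neq0|/imaginary_root_neq0]. Qed.

Lemma sum_seq_ge0 (s : seq (lattice Q)) : (forall b, b \in s -> nonneg b) ->
  nonneg (\sum_(b <- s) b).
Proof.
move=> s0 v; rewrite sum_ffunE big_seq; apply: sumr_ge0 => b /s0; exact.
Qed.

Lemma nonnegD_eq0 x y : nonneg x -> nonneg y -> x + y = 0 -> x = 0.
Proof.
move=> x0 y0 /ffunP xy; apply/ffunP => v; have := xy v; rewrite !ffunE.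
by move/eqP; rewrite paddr_eq0 ?x0 ?y0 // => /andP[/eqP].
Qed.

(** Pairs suffice for decompositions of any length: 2 sum p(b) = sum ((b, a - b) + 2) - (a, a),
    where each summand on the right is at most 0, and -(a, a) = 2 p(a) - 2. *)
Lemma Sigma_of_pairs a : Rqt q th a ->
  (forall b, Nqt q th b -> b != 0 -> nonneg (a - b) -> a - b != 0 -> symf b (a - b) < -1) ->
  Sigma q th a.
Proof.
move=> ra H; split=> // s s2 sR aE.
have sn b : b \in s -> nonneg b by move=> /sR[[]].
have sz b : b \in s -> b != 0 by move=> /sR[[/root_neq0]].
have pair b : b \in s -> symf b (a - b) <= -2.
  move=> bs; have abE : a - b = \sum_(c <- rem b s) c.
    by rewrite aE (big_rem b) //= addrC addKr || rewrite aE (big_rem b) //= addrAC subrr add0r.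
  have rn c : c \in rem b s -> nonneg c by move=> /mem_rem/sn.
  have ab0 : nonneg (a - b) by rewrite abE; exact: sum_seq_ge0.
  suff abn : a - b != 0.
    have [_ nb] := sR b bs; have := H b nb (sz b bs) ab0 abn; lia.
  rewrite abE; have : (0 < size (rem b s))%N by rewrite size_rem // -subn1 subn_gt0.
  have : {subset rem b s <= s} by move=> c; exact: mem_rem.
  move: rn; case: (rem b s) => // c t rn sub _; rewrite big_cons.
  apply: contra (sz c (sub c (mem_head c t))) => /eqP/nonnegD_eq0 -> //; first by apply: rn; exact: mem_head.
  by apply: sum_seq_ge0 => u ut; apply: rn; rewrite inE ut orbT.
have S1 : \sum_(b <- s) symf b (a - b) = symf a a - \sum_(b <- s) symf b b.
  rewrite {2}aE symf_suml -sumrB; apply: eq_bigr => b _; exact: symfBr.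
have S2 : \sum_(b <- s) (symf b (a - b) + 2) <= 0.
  by rewrite big_seq; apply: sumr_le0 => b /pair; lia.
have S3 : (\sum_(b <- s) pfun b) *+ 2 = \sum_(b <- s) (symf b (a - b) + 2) - symf a a.
  transitivity (\sum_(b <- s) (2 - symf b b)).
    by rewrite -sumrMnl; apply: eq_bigr => b _; exact: pfun_symf.
  by rewrite sumrB [X in _ = X - _]big_split /= S1; ring.
have := pfun_symf a; move: S2 S3.
set E := \sum_(b <- s) pfun b; set A := \sum_(b <- s) _.
by move: E A (symf a a) (pfun a) => E A B C; lia.
Qed.

Lemma min_height (P : lattice Q -> Prop) : (forall b, P b -> nonneg b) -> (exists b, P b) ->
  exists b, P b /\ forall c, P c -> height b <= height c.
Proof.
move=> P0 [b]; have [n] := ubnP `|height b|%N; elim: n b => // n IH b bn Pb.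
have [[c [Pc cb]]|no] := pselect (exists c, P c /\ height c < height b).
  apply: (IH c) => //; have := height_ge0 (P0 c Pc); have := height_ge0 (P0 b Pb).
  by move: (height b) (height c) bn cb; lia.
exists b; split=> // c Pc; rewrite leNgt; apply/negP => cb; apply: no; by exists c.
Qed.

Hypothesis q0 : forall v, q v != 0.

Lemma fundamental_Rqt a : fundamental a -> Nqt q th a -> Rqt q th a.
Proof.
move=> fa na; split=> //; split; last by case: fa.
by right; exists a; split=> //; left; constructor.
Qed.

(** Let [b] be the lowest nonzero element of N_{q,theta} proportional to [a]; division with
    remainder at one coordinate makes [a] a multiple of it. Everything below [b] is orthogonal to
    [b], so (c, b - c) = -(c, c) is even. If it exceeded -2 it would be 0, and [c] would be a lower
    element proportional to [a]. *)
Lemma radical_case a : fundamental a -> Nqt q th a ->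
  (forall i, i \in supp a -> symf a (coord_vec i) = 0) ->
  Sigma q th a \/ proper_multiples (Sigma_iso q th) a.
Proof.
move=> fa na rad; have [an a0 ca ale] := fa.
pose P b := [/\ nonneg b, b != 0, Nqt q th b & proportional b a].
have [b [[b0 bn nb pb] bmin]] : exists b, P b /\ forall c, P c -> height b <= height c.
  apply: min_height; first by move=> c [].
  by exists a; split=> // i l; rewrite mulrC.
have [i ai] := neq0_supp an.
have bi : b i != 0.
  have [l bl] := neq0_supp bn; have := pb i l; apply: contra_eq_neq => ->.
  by rewrite mul0r eq_sym mulf_neq0.
have bi0 : 0 < b i by rewrite lt_def bi b0.
have ai0 : 0 < a i by rewrite lt_def ai a0.
pose m := (a i %/ b i)%Z; pose g := a - b *~ m.
have gE l : g l = a l - b l * m by rewrite !ffunE ffunMzE -mulrzr intz.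
have gi : g i = (a i %% b i)%Z by rewrite gE /modz mulrC.
have gi0 : 0 <= g i by rewrite gi modz_ge0.
have gib : g i < b i by rewrite gi ltz_pmod.
have prop l : g l * b i = b l * g i by rewrite !gE; have := pb i l; lia.
have g0 : nonneg g.
  move=> l; have : 0 <= g l * b i by rewrite prop mulr_ge0.
  by rewrite pmulr_lge0.
have bz c (z : int) : Nqt q th c -> qpow q (c *~ z) = 1 /\ dotp th (c *~ z) = 0.
  by move=> [_ qc tc]; rewrite qpowMz dotpMz qc tc exp1rz mul0r.
have gz : g = 0.
  apply/eqP/negPn/negP => gn.
  have : P g.
    split=> //.
      have [_ qa ta] := na; have [qb tb] := bz b m nb.
      by split=> //; rewrite /g ?qpowD // ?qpowN ?qa ?qb ?divr1 // dotpDr dotpNr ta tb subr0.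
    by move=> u w; rewrite !gE !mulrBl [a u * _]mulrC; congr (_ - _); rewrite mulrAC pb mulrAC.
  move/bmin => hbg.
  have : height g * b i = height b * g i.
    by rewrite /height !mulr_suml; apply: eq_bigr => l _; exact: prop.
  have hb : 0 < height b.
    by rewrite lt_def height_ge0 // andbT; apply: contra bn => /eqP/(height_eq0 b0) ->.
  move=> E; have : height b * g i < height g * b i.
    by apply: (@lt_le_trans _ _ (height b * b i)); rewrite ?ltr_pM2l // ler_pM2r.
  by rewrite E ltxx.
have aE : a = b *~ m by apply/eqP; rewrite -subr_eq0 -/g gz.
have m0 : 0 < m.
  have : 0 < b i * m by have := gE i; rewrite gz ffunE; lia.
  by rewrite pmulr_rgt0.
have bs : supp b = supp a.
  apply/setP => l; rewrite !inE aE ffunMzE -mulrzr intz mulf_eq0.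
  by rewrite (gt_eqF m0) orbF.
have be l : symf a (coord_vec l) = m * symf b (coord_vec l) by rewrite aE symfZl.
have fb : fundamental b.
  split=> //; first by rewrite bs.
  by move=> l; have := ale l; rewrite be pmulr_rle0.
have radb l : l \in supp a -> symf b (coord_vec l) = 0.
  by move=> /rad; rewrite be => /eqP; rewrite mulf_eq0 (gt_eqF m0) /= => /eqP.
have orth c : nonneg c -> nonneg (b - c) -> symf c b = 0.
  move=> c0 bc; rewrite symfC symf_sumr big1 // => l _.
  have [la|la] := boolP (l \in supp a); first by rewrite radb // mulr0.
  have := bc l; have := c0 l; rewrite !ffunE; move: la; rewrite -bs inE negbK => /eqP ->.
  rewrite sub0r oppr_ge0 => c1 c2; rewrite (_ : c l = 0) ?mul0r //.
  by apply/eqP; rewrite eq_le c1 c2.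
have bb : symf b b = 0.
  by apply: orth => // l; rewrite !ffunE subrr.
have pb1 : pfun b = 1 by have := pfun_symf b; rewrite bb; lia.
have sb : Sigma q th b.
  apply: Sigma_of_pairs; first exact: fundamental_Rqt.
  move=> c nc cn bc0 bcn; rewrite ltNge; apply/negP => ge1.
  have c0 : nonneg c by case: nc.
  have cbE : symf c (b - c) = - symf c c by rewrite symfBr orth // sub0r.
  have fcb : fundamental (c + (b - c)) by rewrite addrC subrK.
  have le0 := pairing_le0 fcb c0 bc0.
  have [k kE] := symf_even c.
  have cc : symf c (b - c) = 0 by move: ge1 le0; rewrite cbE kE; lia.
  have [pc _] := pairing_eq0 fcb c0 bc0 cn bcn cc.
  rewrite addrC subrK in pc.
  have : P c.
    by split=> // u w; rewrite aE !ffunMzE -[b w *~ m]mulrzr -[b u *~ m]mulrzr !intz !mulrA pc.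
  move/bmin; have := heightD c (b - c); rewrite addrC subrK => ->.
  rewrite gerDl => hle; case/eqP: bcn; apply: height_eq0 => //.
  by apply/eqP; rewrite eq_le hle height_ge0.
case: m m0 aE {g gE gi gi0 gib prop g0 gz be} => // n n0 aE.
have [n1|n1] := eqVneq n 1%N; first by left; rewrite aE n1 mulr1z.
right; exists n, b; split; [lia| |by rewrite aE -pmulrn].
by split=> //; exists b; split=> //; left; constructor.
Qed.

End Params.
End Pairs.

(** * Unit currents *)

Lemma mulz_nneg_eq1 (m n : int) : 0 <= m -> m * n = 1 -> m = 1 /\ n = 1.
Proof.
move=> m0 mn; have n0 : 0 < n by rewrite ltNge; apply/negP => n0; have := mulr_ge0_le0 m0 n0; rewrite mn.
have m1 : 0 < m by rewrite lt_def m0 andbT; apply/eqP => m00; move: mn; rewrite m00 mul0r.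
have mle : m <= m * n by apply: ler_peMr => //; lia.
have nle : n <= m * n by apply: ler_peMl; [exact: ltW|lia].
by rewrite mn in mle nle; lia.
Qed.

Section Flow.
Variables (Q : quiver) (B : {set vert Q}) (b x : lattice Q).
Implicit Types (v w i l o : vert Q) (A : {set vert Q}).
Hypothesis b_gt0 : forall i, i \in B -> 0 < b i.
Hypothesis b_out : forall i, i \notin B -> b i = 0.
Hypothesis x0 : nonneg x.
Hypothesis x_out : forall i, i \notin B -> x i = 0.

(* The current along the edges from [i] to [l] for the potential [x / b]. *)
Definition flow i l : int := - cart i l * (x i * b l - x l * b i).

Lemma flowC i l : flow i l = - flow l i.
Proof. by rewrite /flow cartC; ring. Qed.

Lemma flow_eq1_cart i l : flow i l = 1 -> cart i l = -1.
Proof.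
have [->|il] := eqVneq i l; first by rewrite /flow subrr mulr0.
move=> fe; have [|cE _] := @mulz_nneg_eq1 (- cart i l) (x i * b l - x l * b i) _ fe.
  by rewrite oppr_ge0 cart_le0.
by rewrite -[cart i l]opprK cE.
Qed.

Lemma flow_out i l : l \notin B -> flow i l = 0.
Proof. by move=> lB; rewrite /flow (b_out lB) (x_out lB) mulr0 mul0r subrr mulr0. Qed.

Lemma flow_div i : \sum_l flow i l =
  b i * symf x (coord_vec i) - x i * symf b (coord_vec i).
Proof.
rewrite !symf_coordr !mulr_sumr -sumrB; apply: eq_bigr => l _.
by rewrite /flow cartC; ring.
Qed.

Definition pot i : rat := (x i)%:~R / (b i)%:~R.

Lemma pot_le i l : i \in B -> l \in B -> (pot l <= pot i) = (x l * b i <= x i * b l).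
Proof.
move=> /b_gt0 bi /b_gt0 bl.
rewrite /pot ler_pdivrMr ?ltr0z // mulrAC ler_pdivlMr ?ltr0z //.
by rewrite -!rmorphM ler_int.
Qed.

Lemma pot_lt i l : i \in B -> l \in B -> (pot l < pot i) = (x l * b i < x i * b l).
Proof. by move=> iB lB; rewrite !ltNge pot_le. Qed.

Lemma flow_ge0 i l : i \in B -> l \in B -> pot l <= pot i -> 0 <= flow i l.
Proof.
move=> iB lB; rewrite pot_le // => h; rewrite /flow.
have [->|il] := eqVneq i l; first by rewrite subrr mulr0.
by rewrite mulr_ge0 ?subr_ge0 // oppr_ge0 cart_le0.
Qed.

Lemma flow_gt0_pot i l : i \in B -> l \in B -> 0 < flow i l -> pot l < pot i.
Proof. by move=> iB lB f0; rewrite ltNge; apply/negP => /(flow_ge0 lB iB); rewrite flowC; lia. Qed.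

Lemma flow_eq0_cart i l : i \in B -> l \in B -> pot l != pot i -> flow i l = 0 -> cart i l = 0.
Proof.
move=> iB lB ne /eqP; rewrite mulf_eq0 oppr_eq0 => /orP[/eqP //|e].
case/negP: ne; rewrite eq_le !pot_le //; move: e; rewrite subr_eq0 => /eqP ->.
by rewrite lexx.
Qed.

(** The hypothesis says that away from [k] the outgoing currents have sum at most 0. Where the
    potential is maximal they are all nonnegative, hence 0, and the neighbours share the maximum; so
    it spreads along [B] until it reaches [k]. *)
Lemma max_principle k : connected_in B -> k \in B ->
  (forall i, i \in B -> i != k -> 0 <= b i * symf x (coord_vec i) * -1 + x i * symf b (coord_vec i)) ->
  forall l, l \in B -> x l * b k <= x k * b l.
Proof.
move=> cB kB H l lB; pose mx i := [forall w in B, pot w <= pot i].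
suff : mx k by move/forall_inP/(_ l lB); rewrite pot_le.
have [i0 i0B m0] : exists2 i, i \in B & mx i.
  case: (arg_maxP pot kB) => i iB im; exists i => //.
  by apply/forall_inP => w; exact: im.
suff [//|//] : mx k \/ mx k.
apply: (connected_in_ind (P := fun i => mx i \/ mx k) cB i0B kB (or_introl m0)).
move=> i w iB wB iw [mi|]; last by right.
have [<-|ik] := eqVneq i k; first by right.
left; have [<- //|ne] := eqVneq i w.
have f0 u : 0 <= flow i u.
  have [uB|uB] := boolP (u \in B); last by rewrite flow_out.
  by apply: flow_ge0 => //; move/forall_inP: mi; exact.
have s0 : \sum_u flow i u == 0.
  rewrite eq_le sumr_ge0 // andbT flow_div; have := H i iB ik; lia.
move: s0; rewrite psumr_eq0 // => /allP/(_ w); rewrite mem_index_enum => /(_ isT) /eqP fw.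
have pw : pot w == pot i.
  apply: contraT => nep; rewrite adjacent_cart // in iw.
  by rewrite (flow_eq0_cart iB wB nep fw) ltxx in iw.
by apply/forall_inP => u uB; rewrite (eqP pw); move/forall_inP: mi; exact.
Qed.

Section Cut.
Variables (A : {set vert Q}) (D : vert Q -> int).
Hypothesis AB : A \subset B.
Hypothesis flowD : forall i, i \in B -> \sum_l flow i l = D i.
Hypothesis A_ge0 : forall i l, i \in A -> l \notin A -> 0 <= flow i l.

Lemma cut_sum : \sum_(i in A) \sum_(l | l \notin A) flow i l = \sum_(i in A) D i.
Proof.
have -> : \sum_(i in A) D i = \sum_(i in A) \sum_l flow i l.
  by apply: eq_bigr => i iA; rewrite flowD // (subsetP AB).
under [RHS]eq_bigr => i _ do rewrite (bigID (mem A)) /=.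
rewrite big_split /=.
suff -> : \sum_(i in A) \sum_(l in A) flow i l = 0 by rewrite add0r.
set S := \sum_(i in A) _; have : S = - S.
  rewrite {1}/S exchange_big -sumrN; apply: eq_bigr => i _.
  by rewrite -sumrN; apply: eq_bigr => l _; exact: flowC.
lia.
Qed.

(** Currents are integers: a total of at most 1 across the cut leaves room for one positive term. *)
Lemma cut_single o w : o \in A -> w \notin A -> 0 < flow o w -> \sum_(i in A) D i <= 1 ->
  flow o w = 1 /\ forall i l, i \in A -> l \notin A -> (i, l) != (o, w) -> flow i l = 0.
Proof.
move=> oA wA f0; rewrite -cut_sum (bigD1 o) //= (bigD1 w) //=.
set S1 := \sum_(l | _) _; set S2 := \sum_(i | _) _ => le1.
have S1p : 0 <= S1 by apply: sumr_ge0 => l /andP[lA _]; exact: A_ge0.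
have S2p : 0 <= S2.
  by apply: sumr_ge0 => i /andP[iA _]; apply: sumr_ge0 => l lA; exact: A_ge0.
have [fo S10 S20] : [/\ flow o w = 1, S1 == 0 & S2 == 0].
  by move: S1 S2 S1p S2p le1 f0 => s1 s2 *; split; try (apply/eqP); lia.
split=> // i l iA lA ne; have [io|io] := eqVneq i o.
  have lw : l != w by apply: contra ne => /eqP ->; rewrite io.
  move: S10; rewrite psumr_eq0 => [/allP/(_ l)|l' /andP[lA' _]]; last exact: A_ge0.
  by rewrite mem_index_enum lA lw io => /(_ isT)/eqP.
move: S20; rewrite psumr_eq0 => [/allP/(_ i)|i' /andP[iA' _]]; last first.
  by apply: sumr_ge0 => l' lA'; exact: A_ge0.
rewrite mem_index_enum iA io => /(_ isT).
rewrite psumr_eq0 => [/allP/(_ l)|l' lA']; last exact: A_ge0.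
by rewrite mem_index_enum lA => /(_ isT)/eqP.
Qed.

Lemma cut_none : \sum_(i in A) D i <= 0 ->
  forall i l, i \in A -> l \notin A -> flow i l = 0.
Proof.
move=> le0 i l iA lA; apply/eqP; rewrite eq_le A_ge0 // andbT leNgt; apply/negP => f0.
have := cut_sum; rewrite (bigD1 i) //= (bigD1 l) //=.
set S1 := \sum_(l' | _) _; set S2 := \sum_(i' | _) _ => e.
have S1p : 0 <= S1 by apply: sumr_ge0 => l' /andP[lA' _]; exact: A_ge0.
have S2p : 0 <= S2.
  by apply: sumr_ge0 => i' /andP[iA' _]; apply: sumr_ge0 => l' lA'; exact: A_ge0.
by move: le0; rewrite -e; move: S1 S2 S1p S2p f0 {e} => s1 s2; lia.
Qed.

End Cut.

Hypothesis b_harm : forall i, i \in B -> 0 < x i -> symf b (coord_vec i) = 0.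

(* Along a unit current the values of [b] and [x] at [c] are coprime, so [b / b c]
   is integral on the level set of [c]; its square length is even, positive and
   at most [cart c c]. *)
Lemma level_set c p (u : int) : c \in B -> p \in B -> flow c p = 1 -> 0 <= u ->
  (forall i l, i \in B -> pot i = pot c -> l \in B -> pot l != pot c -> i != c -> cart i l = 0) ->
  \sum_(l | (l \in B) && (pot l != pot c)) - cart c l * b l = u + b p ->
  u + b p = b c * 2.
Proof.
move=> cB pB f1 u0 H1 H2.
have ltp : pot p < pot c by apply: flow_gt0_pot => //; rewrite f1.
have bc := b_gt0 cB; have bp := b_gt0 pB.
have one : x c * b p - x p * b c = 1.
  have cp : c != p by apply/eqP => cp; rewrite cp ltxx in ltp.
  by have [] := mulz_nneg_eq1 _ f1; rewrite ?oppr_ge0 ?cart_le0.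
have xc0 : 0 < x c.
  by have := x0 c; have := x0 p; move: ltp; rewrite pot_lt //; nia.
pose R := [set i in B | pot i == pot c].
have cR : c \in R by rewrite inE cB eqxx.
have RB i : i \in R -> i \in B by rewrite inE => /andP[].
have RE i : i \in R -> x i * b c = x c * b i.
  rewrite inE => /andP[iB /eqP pi]; apply/eqP.
  by rewrite eq_le -!pot_le // pi lexx.
have Rx i : i \in R -> 0 < x i.
  move=> iR; have := RE i iR; have := b_gt0 (RB _ iR); have := x0 i => ? ? ?.
  have : 0 < x i * b c by rewrite RE // mulr_gt0.
  by rewrite pmulr_lgt0.
pose nu : lattice Q := [ffun i => if i \in R then b p * x i - x p * b i else 0].
have nuE i : i \in R -> b c * nu i = b i.
  move=> iR; rewrite ffunE iR; have := RE i iR.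
  have -> : b c * (b p * x i - x p * b i) = b p * (x i * b c) - x p * b c * b i by ring.
  move=> ->; rewrite -[RHS]mul1r -one; ring.
have nu_out i : i \notin R -> nu i = 0 by rewrite ffunE => /negbTE ->.
have nuc : nu c = 1 by rewrite ffunE cR mulrC one.
have sn i : i \in R -> b c * symf nu (coord_vec i) =
    \sum_(l | (l \in B) && (pot l != pot c)) - cart i l * b l.
  move=> iR; have E := b_harm (RB _ iR) (Rx _ iR).
  rewrite symf_coordr (bigID (mem R)) /= in E.
  rewrite symf_coordr mulr_sumr (bigID (mem R)) /=.
  have -> : \sum_(l in R) b c * (nu l * cart l i) = \sum_(l in R) b l * cart l i.
    by apply: eq_bigr => l lR; rewrite mulrA nuE.
  rewrite [X in _ + X = _]big1 ?addr0; last by move=> l lR; rewrite nu_out // mul0r mulr0.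
  have -> : \sum_(l in R) b l * cart l i = - \sum_(l | l \notin R) b l * cart l i.
    by apply/eqP; rewrite -addr_eq0; apply/eqP.
  rewrite -sumrN [LHS](bigID (mem B)) /= [X in _ + X]big1 ?addr0; last first.
    by move=> l /andP[_ lB]; rewrite b_out // mul0r oppr0.
  apply: eq_big => l; last by rewrite cartC => _; ring.
  by rewrite inE; case: (l \in B); rewrite ?andbF ?andbT.
have snc : b c * symf nu (coord_vec c) = u + b p by rewrite sn.
have sni i : i \in R -> i != c -> symf nu (coord_vec i) = 0.
  move=> iR ic; have : b c * symf nu (coord_vec i) = 0.
    rewrite sn // big1 // => l /andP[lB pl].
    by move: iR; rewrite inE => /andP[iB /eqP pi]; rewrite H1 // oppr0 mul0r.
  by move/eqP; rewrite mulf_eq0 (gt_eqF bc) => /eqP.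
have snn : symf nu nu = symf nu (coord_vec c).
  rewrite symf_sumr (bigD1 c) //= nuc mul1r big1 ?addr0 // => i ic.
  by have [iR|iR] := boolP (i \in R); [rewrite sni // mulr0|rewrite nu_out // mul0r].
have nu0 : nonneg nu.
  move=> i; have [iR|iR] := boolP (i \in R); last by rewrite nu_out.
  have : 0 <= b c * nu i by rewrite nuE // ltW // b_gt0 // RB.
  by rewrite pmulr_rge0.
have le2 : symf nu (coord_vec c) <= 2.
  apply: le_trans (nonneg_symf_coord_le c nu0) _; rewrite nuc mul1r.
  exact: cart_diag_le2.
have gt0 : 0 < symf nu (coord_vec c).
  have : 0 < b c * symf nu (coord_vec c) by rewrite snc; lia.
  by rewrite pmulr_rgt0.
have [k kE] := symf_even nu.
rewrite -snc; congr (_ * _); move: le2 gt0 kE; rewrite snn.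
by move: (symf nu _) => s; lia.
Qed.

Variables j i0 : vert Q.
Hypothesis jB : j \in B.
Hypothesis i0B : i0 \in B.
Hypothesis j_i0 : j != i0.
Hypothesis bj : b j = 1.
Hypothesis bi0 : b i0 = 1.
Hypothesis flowD : forall i, i \in B -> \sum_l flow i l = (i == j)%:Z - (i == i0)%:Z.

Let sumD_le1 A : \sum_(i in A) ((i == j)%:Z - (i == i0)%:Z) <= (j \in A)%:Z.
Proof.
rewrite sumrB.
have S v : \sum_(i in A) (i == v)%:Z = (v \in A)%:Z.
  have [vA|vA] := boolP (v \in A).
    by rewrite (bigD1 v) //= eqxx big1 ?addr0 // => i /andP[_ /negbTE ->].
  rewrite big1 // => i iA; case: eqP => // iv; by rewrite -iv iA in vA.
by rewrite !S; case: (j \in A); case: (i0 \in A).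
Qed.

Let cutset_ge0 (P : pred rat) : {homo P : s t / s <= t >-> s ==> t} ->
  forall i l, i \in [set i in B | P (pot i)] -> l \notin [set i in B | P (pot i)] -> 0 <= flow i l.
Proof.
move=> mono i l; rewrite !inE => /andP[iB Pi]; rewrite negb_and => /orP[lB|Pl].
  by rewrite flow_out.
have [lB|lB] := boolP (l \in B); last by rewrite flow_out.
apply: flow_ge0 => //; rewrite leNgt; apply/negP => /ltW/mono; rewrite Pi /=.
by rewrite (negbTE Pl).
Qed.

Let sub_cut (P : pred rat) : [set i in B | P (pot i)] \subset B.
Proof. by apply/subsetP => i; rewrite inE => /andP[]. Qed.

Let ge_mono (s : rat) : {homo (fun t => s <= t) : s t / s <= t >-> s ==> t}.
Proof. by move=> u t ut; apply/implyP => su; exact: le_trans su ut. Qed.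
Let gt_mono (s : rat) : {homo (fun t => s < t) : s t / s <= t >-> s ==> t}.
Proof. by move=> u t ut; apply/implyP => su; exact: lt_le_trans su ut. Qed.

(** As b_c is at least 2, [c] is neither source nor sink, so the current leaves it towards some [p].
    The cuts just above and just below the level of [c] carry one unit each, so o - c and c - p are
    the only links of that level to the rest of [B]. Now [level_set] gives b_o + b_p = 2 b_c, hence
    b_p = b_c + 1. The number of vertices at or below the level of [c] has to decrease forever. *)
Let flow_step n o c : #|[set i in B | pot i <= pot c]| = n -> o \in B -> c \in B ->
  0 < flow o c -> b c = b o + 1 -> False.
Proof.
elim/ltn_ind: n o c => n IH o c cn oB cB foc bco.
have bo := b_gt0 oB.
have ci0 : c != i0 by apply/eqP => ci0; move: bco; rewrite ci0 bi0; lia.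
have cj : c != j by apply/eqP => cj; move: bco; rewrite cj bj; lia.
have Dc : \sum_l flow c l = 0 by rewrite flowD // (negbTE ci0) (negbTE cj).
have [p fcp] : exists p, 0 < flow c p.
  apply/existsP; apply: contraT => /existsPn np.
  have : \sum_l flow c l < 0.
    rewrite (bigD1 o) //= -[ltRHS](addr0 0); apply: ltr_leD; first by rewrite flowC; lia.
    by apply: sumr_le0 => l _; rewrite leNgt np.
  by rewrite Dc ltxx.
have pB : p \in B.
  by apply: contraT => pB; move: fcp; rewrite flow_out ?ltxx.
have poc := flow_gt0_pot oB cB foc; have pcp := flow_gt0_pot cB pB fcp.
pose A1 := [set i in B | pot c < pot i]; pose A2 := [set i in B | pot c <= pot i].
have oA1 : o \in A1 by rewrite inE oB.
have cA1 : c \notin A1 by rewrite inE cB ltxx.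
have cA2 : c \in A2 by rewrite inE cB lexx.
have pA2 : p \notin A2 by rewrite inE pB -ltNge.
have le1 A : \sum_(i in A) ((i == j)%:Z - (i == i0)%:Z) <= 1.
  by apply: le_trans (sumD_le1 A) _; case: (j \in A).
have [fo1 u1] := cut_single (sub_cut _) flowD (cutset_ge0 (@gt_mono (pot c))) oA1 cA1 foc (le1 _).
have [fp1 u2] := cut_single (sub_cut _) flowD (cutset_ge0 (@ge_mono (pot c))) cA2 pA2 fcp (le1 _).
have out i l : i \in B -> pot i = pot c -> l \in B -> pot l != pot c ->
    ~~ ((i == c) && ((l == o) || (l == p))) -> cart i l = 0.
  move=> iB pi lB pl ne; have [lt|] := ltP (pot l) (pot c).
    apply: (flow_eq0_cart iB lB); first by rewrite pi.
    apply: u2; rewrite ?inE ?iB ?lB ?pi ?lexx -?ltNge //.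
    by apply: contra ne => /eqP[-> ->]; rewrite !eqxx orbT.
  rewrite le_eqVlt eq_sym (negbTE pl) /= => gt; rewrite cartC.
  apply: (flow_eq0_cart lB iB); first by rewrite pi eq_sym.
  apply: u1; rewrite ?inE ?iB ?lB ?pi ?ltxx //.
  by apply: contra ne => /eqP[-> ->]; rewrite !eqxx.
have op : o != p by apply: contraTneq poc => ->; rewrite -leNgt ltW.
have sumE : \sum_(l | (l \in B) && (pot l != pot c)) - cart c l * b l = b o + b p.
  rewrite (bigD1 o) /=; last by rewrite oB (gt_eqF poc).
  rewrite (bigD1 p) /=; last by rewrite pB (lt_eqF pcp) eq_sym op.
  rewrite big1 ?addr0 => [|l /andP[/andP[/andP[lB pl] lo] lp]].
    by rewrite [cart c o]cartC !flow_eq1_cart // !opprK !mul1r.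
  by rewrite out ?oppr0 ?mul0r // (negbTE lo) (negbTE lp) andbF.
have := level_set cB pB fp1 (ltW bo) _ sumE => lev.
have bp : b p = b c + 1.
  have : b o + b p = b c * 2.
    by apply: lev => i l iB pi lB pl ic; apply: out; rewrite // (negbTE ic).
  by move=> e; apply: (@addrI _ (b o)); rewrite e bco; ring.
apply: (IH _ _ c p erefl cB pB fcp bp); rewrite -cn; apply: proper_card.
apply/properP; split; first by apply/subsetP => i; rewrite !inE => /andP[-> /le_trans]; apply; exact: ltW.
by exists c; rewrite inE cB ?lexx // -ltNge.
Qed.

(* [b] grows by 1 at each step of the current away from [j], so that the current
   cannot reach [i0], where [b] equals 1. *)
Lemma no_unit_flow : False.
Proof.
have Dj : \sum_l flow j l = 1 by rewrite flowD // eqxx (negbTE j_i0) subr0.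
have [p fjp] : exists p, 0 < flow j p.
  apply/existsP; apply: contraT => /existsPn np.
  have : \sum_l flow j l <= 0 by apply: sumr_le0 => l _; rewrite leNgt np.
  by rewrite Dj.
have pB : p \in B by apply: contraT => pB; move: fjp; rewrite flow_out ?ltxx.
have pjp := flow_gt0_pot jB pB fjp.
pose A1 := [set i in B | pot j < pot i]; pose A2 := [set i in B | pot j <= pot i].
have jA1 : j \notin A1 by rewrite inE jB ltxx.
have jA2 : j \in A2 by rewrite inE jB lexx.
have pA2 : p \notin A2 by rewrite inE pB -ltNge.
have le1 A : \sum_(i in A) ((i == j)%:Z - (i == i0)%:Z) <= 1.
  by apply: le_trans (sumD_le1 A) _; case: (j \in A).
have le0 : \sum_(i in A1) ((i == j)%:Z - (i == i0)%:Z) <= 0.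
  by apply: le_trans (sumD_le1 A1) _; rewrite (negbTE jA1).
have u1 := cut_none (sub_cut _) flowD (cutset_ge0 (@gt_mono (pot j))) le0.
have [fp1 u2] := cut_single (sub_cut _) flowD (cutset_ge0 (@ge_mono (pot j))) jA2 pA2 fjp (le1 _).
have out i l : i \in B -> pot i = pot j -> l \in B -> pot l != pot j ->
    ~~ ((i == j) && (l == p)) -> cart i l = 0.
  move=> iB pi lB pl ne; have [lt|] := ltP (pot l) (pot j).
    apply: (flow_eq0_cart iB lB); first by rewrite pi.
    by apply: u2; rewrite ?inE ?iB ?lB ?pi ?lexx -?ltNge.
  rewrite le_eqVlt eq_sym (negbTE pl) /= => gt; rewrite cartC.
  apply: (flow_eq0_cart lB iB); first by rewrite pi eq_sym.
  by apply: u1; rewrite ?inE ?iB ?lB ?pi ?ltxx.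
have sumE : \sum_(l | (l \in B) && (pot l != pot j)) - cart j l * b l = 0 + b p.
  rewrite (bigD1 p) /=; last by rewrite pB (lt_eqF pjp).
  rewrite big1 ?addr0 => [|l /andP[/andP[lB pl] lp]]; first by rewrite flow_eq1_cart // opprK mul1r add0r.
  by rewrite out ?oppr0 ?mul0r // (negbTE lp) andbF.
have bp : b p = b j + 1.
  have : 0 + b p = b j * 2.
    apply: (level_set jB pB fp1 (lexx 0) _ sumE) => i l iB pi lB pl ij.
    by apply: out; rewrite // (negbTE ij).
  by rewrite bj add0r => ->.
exact: (flow_step (erefl _) jB pB fjp bp).
Qed.

End Flow.

(** * Decompositions with pairing -1 *)

Section Arrow.
Variable Q : quiver.
Local Notation D := (double_quiver Q).
Implicit Types (v w : vert Q).

Lemma sum_eqN1 (T : finType) (F : T -> int) : (forall t, F t <= 0) -> \sum_t F t = -1 ->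
  exists t, F t = -1 /\ forall s, s != t -> F s = 0.
Proof.
move=> F0 S1; have [t Ft] : exists t, F t < 0.
  apply/existsP; apply: contraT => /existsPn np.
  have : 0 <= \sum_t F t by apply: sumr_ge0 => t _; rewrite leNgt np.
  by rewrite S1.
have R0 : \sum_(s | s != t) F s <= 0 by apply: sumr_le0.
have [e1 e2] : F t = -1 /\ \sum_(s | s != t) - F s == 0.
  have := S1; rewrite (bigD1 t) //= sumrN oppr_eq0.
  by move: (\sum_(s | _) _) R0 => r R0 e; split; [|apply/eqP]; lia.
exists t; split=> // s st; move: e2; rewrite psumr_eq0 => [/allP/(_ s)|s' _]; last by rewrite oppr_ge0.
by rewrite mem_index_enum st => /(_ isT); rewrite oppr_eq0 => /eqP.
Qed.

Lemma arrow_of_cart v w : v != w -> cart v w = -1 ->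
  exists b : arr D, [/\ atail b = v, ahead b = w &
    forall b' : arr D, atail b' = v -> ahead b' = w -> b' = b].
Proof.
move=> vw; rewrite /cart (negbTE vw) mul0rn sub0r => /oppr_inj e1.
have n1 := narr_ge0 v w; have n2 := narr_ge0 w v.
have one u u' (x y : arr Q) : narr u u' <= 1 -> atail x = u -> ahead x = u' ->
    atail y = u -> ahead y = u' -> x = y.
  move=> le1 tx hx ty hy; apply/eqP; apply: contraLR le1 => xy; rewrite -ltNge.
  rewrite /narr (bigD1 x) //= (bigD1 y) 1?eq_sym //= tx hx ty hy !eqxx /=.
  by rewrite ltrDl; apply: ltr_pwDl => //; exact: sumr_ge0.
have [/narr_gt0[x [tx hx]]|n] := boolP (0 < narr v w).
  have pvw : 0 < narr v w by apply/narr_gt0; exists x.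
  have nwv : narr w v = 0 by move: n1 n2 e1 pvw; lia.
  have nvw : narr v w <= 1 by lia.
  exists (inl x); split=> // -[y ty hy|y /= hy ty]; first by congr inl; exact: one nvw _ _ _ _.
  have yp : 0 < narr w v by apply/narr_gt0; exists y.
  by rewrite nwv in yp.
have /narr_gt0[x [tx hx]] : 0 < narr w v by lia.
have pwv : 0 < narr w v by apply/narr_gt0; exists x.
have nvw : narr v w = 0 by lia.
have nwv : narr w v <= 1 by lia.
exists (inr x); split=> // -[y /= ty hy|y /= hy ty]; last by congr inr; exact: one nwv _ _ _ _.
have yp : 0 < narr v w by apply/narr_gt0; exists y.
by rewrite nvw in yp.
Qed.

End Arrow.

(** * The shape of a lowest summand with pairing -1 *)

Section Analysis.
Variable Q : quiver.
Implicit Types (v w i l : vert Q).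
Variables a b : lattice Q.
Hypothesis fa : fundamental a.
Hypothesis nrad : exists2 i, i \in supp a & symf a (coord_vec i) != 0.
Hypothesis b0 : nonneg b.
Hypothesis c0 : nonneg (a - b).
Local Notation c := (a - b).

Lemma pairing_lt0 (x : lattice Q) : nonneg x -> nonneg (a - x) -> x != 0 -> a - x != 0 ->
  symf x (a - x) <= -1.
Proof.
move=> x0 y0 xn yn; have fx : fundamental (x + (a - x)) by rewrite addrC subrK.
have le0 := pairing_le0 fx x0 y0.
suff : symf x (a - x) != 0 by move: le0; rewrite le_eqVlt => /orP[->//|]; lia.
apply/eqP => e; have [_] := pairing_eq0 fx x0 y0 xn yn e; rewrite addrC subrK => r.
by have [i ia /eqP] := nrad; apply; exact: r.
Qed.

Hypothesis bc : symf b c = -1.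
Hypothesis b_le0 : forall i, symf b (coord_vec i) <= 0.
Hypothesis hbc : height b <= height c.

Let aE i : a i = b i + c i. Proof. by rewrite !ffunE addrC subrK. Qed.
Let a0 : nonneg a. Proof. by case: fa. Qed.
Let a_le0 i : symf a (coord_vec i) <= 0. Proof. by case: fa. Qed.
Let aS i : symf a (coord_vec i) = symf b (coord_vec i) + symf c (coord_vec i).
Proof. by rewrite -symfDl addrC subrK. Qed.
Let suppb i : (i \in supp b) = (0 < b i). Proof. exact: supp_gt0. Qed.
Let suppa i : (i \in supp a) = (0 < a i). Proof. exact: supp_gt0. Qed.
Let supp_ba i : i \in supp b -> i \in supp a.
Proof. by rewrite suppb suppa aE => bi; rewrite ltr_wpDr. Qed.

(** The pairing is the sum of the terms c_i (b, e_i), nonpositive integers with total -1. *)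
Lemma minimal_exit : exists k, [/\ c k = 1, symf b (coord_vec k) = -1
  & forall i, i != k -> 0 < c i -> symf b (coord_vec i) = 0].
Proof.
have [||k [ck H]] := @sum_eqN1 _ (fun i => c i * symf b (coord_vec i)).
- by move=> i; rewrite mulr_ge0_le0.
- by rewrite -symf_sumr.
exists k; have [|c1 s1] := @mulz_nneg_eq1 (c k) (- symf b (coord_vec k)) (c0 k).
  by rewrite mulrN ck opprK.
split=> // [|i ik ci]; first by rewrite -[symf _ _]opprK s1.
by have /eqP := H i ik; rewrite mulf_eq0 (gt_eqF ci) /= => /eqP.
Qed.

(** If b_k > 0, the vanishing of (b, e_i) at the other vertices where [c] is positive spreads the
    support of [b] over that of [a]. The maximum principle for c / b then gives c <= b, so c = b by
    comparison of heights, and (b, b) = -1 would be odd. *)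
Lemma exit_out k : c k = 1 -> symf b (coord_vec k) = -1 ->
  (forall i, i != k -> 0 < c i -> symf b (coord_vec i) = 0) -> b k = 0.
Proof.
move=> ck sk H; apply/eqP; rewrite eq_le b0 andbT leNgt; apply/negP => bk.
have ca : connected_in (supp a) by case: fa.
have ka : k \in supp a by apply: supp_ba; rewrite suppb.
have full i : i \in supp a -> 0 < b i.
  move=> ia; apply: (connected_in_ind (P := fun i => 0 < b i) ca ka ia bk) => u w ua wa uw bu.
  rewrite lt_def b0 andbT; apply/eqP => bw.
  have uw' : u != w by apply: contraTneq bu => ->; rewrite bw ltxx.
  have cw : 0 < c w by move: wa; rewrite suppa aE bw add0r.
  have wk : w != k by apply: contraTneq bk => <-; rewrite bw ltxx.
  have := H w wk cw; apply/eqP; rewrite lt_eqF // symf_coordr (bigD1 u) //=.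
  rewrite -[ltRHS](addr0 0); apply: ltr_leD.
    by rewrite pmulr_rlt0 // -adjacent_cart.
  apply: sumr_le0 => v _; have [->|vw] := eqVneq v w; first by rewrite bw mul0r.
  by rewrite mulr_ge0_le0 // cart_le0.
have suppE i : i \notin supp a -> b i = 0 /\ c i = 0.
  rewrite inE negbK aE => /eqP; have := b0 i; have := c0 i; move: (b i) (c i) => s t; lia.
have Hk i : i \in supp a -> i != k ->
    0 <= b i * symf c (coord_vec i) * -1 + c i * symf b (coord_vec i).
  move=> ia ik; rewrite mulrN1; have := c0 i; rewrite le_eqVlt => /orP[/eqP ci|ci].
    rewrite -ci mul0r addr0 oppr_ge0 mulr_ge0_le0 //.
    by apply: nonneg_symf_coord_out.
  rewrite (H i ik ci) mulr0 addr0 oppr_ge0 mulr_ge0_le0 //.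
  by have := a_le0 i; rewrite aS (H i ik ci) add0r.
have mp := max_principle full (fun i ia => (suppE i ia).1) (fun i ia => (suppE i ia).2) ca ka Hk.
have cb i : c i <= b i.
  have [ia|/suppE[-> ->] //] := boolP (i \in supp a).
  have := mp i ia; rewrite ck mul1r; apply: le_trans; apply: ler_peMr => //.
have bcE : b = c.
  apply/ffunP => i; apply/eqP; rewrite -subr_eq0.
  have hh : height b - height c == 0.
    rewrite eq_le subr_le0 hbc subr_ge0 /=; apply: ler_sum => w _; exact: cb.
  move: hh; rewrite -sumrB psumr_eq0 => [/allP/(_ i)|w _]; last by rewrite subr_ge0.
  by rewrite mem_index_enum => /(_ isT).
have [u uE] := symf_even b; move: bc; rewrite -bcE uE; lia.
Qed.

Lemma minimal_shape : exists L j k, [/\ one_arrow_split a (supp b) L j k, b j = 1,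
  connected_in (supp b) &
  (forall i, i \in supp b -> a i = b i) \/
  exists2 m : nat, (2 <= m)%N & forall i, i \in supp b ->
    a i = b i * m%:Z /\ symf b (coord_vec i) = 0].
Proof.
have [k [ck sk H]] := minimal_exit; have bk := exit_out ck sk H.
(* Since b_k = 0, also (b, e_k) = -1 is a sum of nonpositive integers; its only nonzero term gives
   [j], with b_j = 1 and a single edge to [k]. *)
have [||j [jk Hj]] := @sum_eqN1 _ (fun i => b i * cart i k).
- move=> i; have [->|ik] := eqVneq i k; first by rewrite bk mul0r.
  by rewrite mulr_ge0_le0 // cart_le0.
- by rewrite -symf_coordr.
have [|bj jk1] := @mulz_nneg_eq1 (b j) (- cart j k) (b0 j); first by rewrite mulrN jk opprK.
have {jk}jk : cart j k = -1 by rewrite -[cart j k]opprK jk1.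
have jB : j \in supp b by rewrite suppb bj.
have kB : k \notin supp b by rewrite inE bk eqxx.
pose L := supp a :\: supp b.
have Lb i : i \in L -> b i = 0 /\ 0 < c i.
  rewrite inE suppb -leNgt suppa aE => /andP[bi ci].
  have b00 : b i = 0 by apply/eqP; rewrite eq_le bi b0.
  by move: ci; rewrite b00 add0r.
have kL : k \in L by rewrite inE kB suppa aE bk ck.
have cross i l : i \in supp b -> l \in L -> cart i l != 0 -> i = j /\ l = k.
  move=> ib lL cil; have [bl cl] := Lb l lL.
  have lk : l = k.
    apply/eqP; apply: contraNT cil => lk; have s0 := H l lk cl.
    move: s0; rewrite symf_coordr => /eqP; rewrite -oppr_eq0 -sumrN psumr_eq0 => [/allP/(_ i)|w _].
      rewrite mem_index_enum => /(_ isT); rewrite oppr_eq0 mulf_eq0.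
      by rewrite suppb in ib; rewrite (gt_eqF ib).
    have [->|wl] := eqVneq w l; first by rewrite bl mul0r oppr0.
    by rewrite oppr_ge0 mulr_ge0_le0 // cart_le0.
  split=> //; apply/eqP; apply: contraNT cil => ij.
  have /eqP := Hj i ij; rewrite lk mulf_eq0; rewrite suppb in ib; by rewrite (gt_eqF ib).
have jk' : j != k by apply: contraTneq jB => ->.
have split : one_arrow_split a (supp b) L j k.
  split.
  - apply/setP => i; rewrite !inE; have [bi|] := boolP (b i != 0); last by [].
    by have := supp_ba (i := i); rewrite !inE bi => /(_ isT) ->.
  - by rewrite -setI_eq0; apply/eqP/setP => i; rewrite !inE; case: (b i == 0); rewrite ?andbF.
  - have [e [te he uniq]] := arrow_of_cart jk' jk; exists e; split=> // e' tb hL.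
    have te' : (atail e' : vert Q) != ahead e'.
      by apply: contraTneq tb => ->; move: hL; rewrite inE => /andP[].
    have : @cart Q (atail e') (ahead e') != 0.
      have : @adjacent Q (atail e') (ahead e').
        by apply/existsP; case: (e') => z; exists z; rewrite !eqxx ?orbT.
      rewrite adjacent_cart; last exact: te'.
      by move=> lt0; rewrite lt_eqF.
    by move/(cross _ _ tb hL) => [t h]; exact: uniq.
  - by rewrite aE bk ck.
have ca : connected_in (supp a) by case: fa.
have cb : connected_in (supp b).
  move=> u w ub wb; set e := (fun v' w' => _).
  suff : if w \in supp b then connect e u w else connect e u j by rewrite wb.
  have ua := supp_ba ub; have wa := supp_ba wb.
  apply: (connected_in_ind (P := fun w => if w \in supp b then connect e u w else connect e u j) ca ua wa).
    by rewrite ub connect0.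
  move=> i l ia la il; have inL z : z \in supp a -> z \notin supp b -> z \in L.
    by move=> za zb; rewrite inE zb.
  have nz : i != l -> cart i l != 0 by move=> ne; move: il; rewrite adjacent_cart // => /lt_eqF ->.
  case: (boolP (i \in supp b)) => ib; case: (boolP (l \in supp b)) => lb cn //.
  - by apply: connect_trans cn (connect1 _); rewrite /e ib lb.
  - have ne : i != l by apply: contraTneq ib => ->.
    by have [<- _] := cross _ _ ib (inL _ la lb) (nz ne).
  - have ne : i != l by apply: contraNneq ib => ->.
    by have [-> _] := cross _ _ lb (inL _ ia ib) (eq_ind _ (fun z => z != 0) (nz ne) _ (cartC i l)).
exists L, j, k; split=> //.
have [/existsP[s /andP[sb sc]]|S0] := boolP [exists i, (i \in supp b) && (0 < c i)]; last first.
  left=> i ib; move/existsPn: S0 => /(_ i); rewrite ib /= -leNgt => ci.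
  by rewrite aE; have := c0 i; move: (c i) ci => t t0 t1; lia.
right.
pose x : lattice Q := [ffun i => if i \in supp b then c i else 0].
have xE i : i \in supp b -> x i = c i by move=> ib; rewrite ffunE ib.
have x_out i : i \notin supp b -> x i = 0 by move=> ib; rewrite ffunE (negbTE ib).
have x0 : nonneg x by move=> i; rewrite ffunE; case: ifP.
have xc i : x i <= c i by rewrite ffunE; case: ifP.
have ax0 : nonneg (a - x).
  move=> i; rewrite [(a - x) i]ffunE [(- x) i]ffunE subr_ge0 aE.
  by apply: le_trans (xc i) _; rewrite lerDr.
have b_out i : i \notin supp b -> b i = 0 by rewrite inE negbK => /eqP.
have bx0 i : i \in supp b -> 0 < x i -> symf b (coord_vec i) = 0.
  by move=> ib; rewrite xE //; apply: H; apply: contraTneq ib => ->.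
have xb0 i : x i * symf b (coord_vec i) = 0.
  have [ib|ib] := boolP (i \in supp b); last by rewrite x_out ?mul0r.
  have := x0 i; rewrite le_eqVlt => /orP[/eqP <-|xi]; first by rewrite mul0r.
  by rewrite bx0 ?mulr0.
have xb : symf x b = 0.
  by rewrite symfC symf_sumr big1.
pose z : lattice Q := c - x.
have zE i : z i = if i \in supp b then 0 else c i.
  rewrite /z [(c - x) i]ffunE [(- x) i]ffunE.
  by case: ifP => ib; [rewrite xE // subrr|rewrite x_out ?ib // subr0].
have zj i : i \in supp b -> symf z (coord_vec i) = - (i == j)%:Z.
  move=> ib; rewrite symf_coordr (bigD1 k) //= zE (negbTE kB) ck mul1r big1 ?addr0 => [|w wk].
    have [->|ij] := eqVneq i j; first by rewrite cartC jk.
    rewrite oppr0; apply/eqP; rewrite cartC; apply: contraTT ij => /(cross _ _ ib kL)[-> _].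
    by rewrite eqxx.
  rewrite zE; case: ifP => wb; first by rewrite mul0r.
  have [wa|wa] := boolP (w \in supp a); last first.
    by move: wa; rewrite inE negbK aE b_out ?wb // add0r => /eqP ->; rewrite mul0r.
  have wL : w \in L by rewrite inE wb.
  have [->|nz] := eqVneq (cart w i) 0; first by rewrite mulr0.
  have [_ wk'] := cross _ _ ib wL (eq_ind _ (fun u => u != 0) nz _ (cartC w i)).
  by rewrite wk' eqxx in wk.
have bE : a - x = b + z by rewrite /z addrA [b + c]addrC subrK.
have xz : symf x z = - x j.
  rewrite symfC symf_sumr (bigD1 j) //= zj // eqxx big1 ?addr0 ?mulrN1 // => w wj.
  have [wb|wb] := boolP (w \in supp b); last by rewrite x_out ?mul0r.
  by rewrite zj // (negbTE wj) oppr0 mulr0.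
have xn : x != 0.
  by apply/eqP => x00; have := xE s sb; rewrite x00 ffunE => e; rewrite -e ltxx in sc.
have axn : a - x != 0.
  by apply/eqP => /ffunP/(_ j); rewrite bE [(b + z) j]ffunE zE jB bj ffunE.
(* The vector [x] is orthogonal to [b] and meets the outer part [z] only across the edge j - k, so
   (x, a - x) = -x_j, which must be at most -1. *)
have xj : 0 < x j.
  have := pairing_lt0 x0 ax0 xn axn; rewrite bE symfDr xb xz add0r; lia.
have cx i : symf c (coord_vec i) = symf x (coord_vec i) + symf z (coord_vec i).
  by rewrite -symfDl (_ : x + z = c) // /z addrC subrK.
have d_le i : i \in supp b -> symf x (coord_vec i) <= (i == j)%:Z.
  move=> ib; have := x0 i; rewrite le_eqVlt => /orP[/eqP xi|xi]; last first.
    by have := a_le0 i; rewrite aS bx0 // add0r cx zj //; case: (i == j); lia.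
  by apply: le_trans (nonneg_symf_coord_out x0 _) _.
have bx : \sum_(i in supp b) b i * symf x (coord_vec i) = 0.
  rewrite -[RHS]xb symf_sumr [RHS](bigID (mem (supp b))) /= [X in _ + X]big1 ?addr0 // => i ib.
  by rewrite b_out ?mul0r.
have bpos i : i \in supp b -> 0 < b i by rewrite suppb.
(* Without a source at [j], all (x, e_i) are nonpositive on the support of [b] and their sum
   weighted by [b] is 0, so they vanish; then x / b is constant and a = (x_j + 1) b there. *)
have [dj|dj] := leP (symf x (coord_vec j)) 0.
  have d0 i : i \in supp b -> symf x (coord_vec i) = 0.
    have le0 w : w \in supp b -> b w * symf x (coord_vec w) <= 0.
      move=> wb; rewrite pmulr_rle0 ?bpos //; have [->//|wj] := eqVneq w j.
      by have := d_le w wb; rewrite (negbTE wj).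
    move=> ib; have := bx; move/eqP; rewrite -oppr_eq0 -sumrN psumr_eq0 => [/allP/(_ i)|w wb].
      rewrite mem_index_enum ib => /(_ isT); rewrite oppr_eq0 mulf_eq0 (gt_eqF (bpos i ib)).
      by move/eqP.
    by rewrite oppr_ge0 le0.
  have prop u w : u \in supp b -> w \in supp b -> x w * b u <= x u * b w.
    move=> ub wb; apply: (max_principle bpos b_out x_out cb ub _ wb) => i ib _.
    by rewrite d0 // mulr0 mul0r add0r xb0.
  have xE' i : i \in supp b -> x i = b i * x j.
    move=> ib; apply/eqP; rewrite eq_le.
    have := prop i j ib jB; have := prop j i jB ib; rewrite bj !mulr1 mulrC.
    by move=> -> ; rewrite mulrC => ->.
  exists (`|x j|.+1)%N; first by have := xj; move: (x j) => t; lia.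
  move=> i ib; split; last by apply: bx0 => //; rewrite xE' // mulr_gt0 // bpos.
  rewrite aE -xE // xE' // -addn1 PoszD gez0_abs ?ltW //; ring.
(* Otherwise one unit of current starts at [j]. As the sum of b_i (x, e_i) is 0, it ends at a single
   vertex [i0], where [b] is 1 again: this is excluded by [no_unit_flow]. *)
exfalso.
have dj1 : symf x (coord_vec j) = 1.
  by have := d_le j jB; rewrite eqxx; move: dj; lia.
have [||i0 [bi0 Hi0]] := @sum_eqN1 _ (fun i =>
    if (i \in supp b) && (i != j) then b i * symf x (coord_vec i) else 0).
- move=> i; case: ifP => // /andP[ib ij]; rewrite pmulr_rle0 ?bpos //.
  by have := d_le i ib; rewrite (negbTE ij).
- have := bx; rewrite (bigD1 j) //= bj mul1r dj1 -big_mkcond /=.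
  by move: (\sum_(i | _) _) => t; lia.
move: bi0; case: ifP => // /andP[i0B i0j] bi0.
have [|b1 s1] := @mulz_nneg_eq1 (b i0) (- symf x (coord_vec i0)) (b0 i0).
  by rewrite mulrN bi0 opprK.
have ji0 : j != i0 by rewrite eq_sym.
apply: (no_unit_flow bpos b_out x0 x_out _ jB i0B ji0 bj b1) => // i ib.
rewrite flow_div xb0 subr0.
have [->|ij] := eqVneq i j; first by rewrite bj dj1 (negbTE ji0).
have [->|ii0] := eqVneq i i0; first by rewrite bi0.
by have := Hi0 i ii0; rewrite ib ij.
Qed.

End Analysis.

(** For the underlying graph weighted by [d] radicality is the harmonic condition, and [j] is the
    vertex of weight 1 that the classification needs. *)
Lemma affine_of_radical (P : quiver) (d : lattice P) j : (forall i, 0 < d i) ->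
  (forall i, symf d (coord_vec i) = 0) -> connected_in [set: vert P] -> d j = 1 ->
  affine_dynkin P.
Proof.
move=> d0 rad cP dj.
pose p (u v : vert P) (x : arr P) := ((atail x == u) && (ahead x == v))
  || ((atail x == v) && (ahead x == u)).
pose E u v := #|[set x : arr P | p u v x]|.
have ES u v : (E u v)%:Z = \sum_x (p u v x)%:Z.
  rewrite /E -sum1_card (big_morph Posz PoszD (erefl _)) big_mkcond /=.
  by apply: eq_bigr => x _; rewrite inE; case: (p u v x).
have EC u v : E u v = E v u by apply: eq_card => x; rewrite !inE /p orbC.
have Euu u : (E u u)%:Z = narr u u.
  by rewrite ES; apply: eq_bigr => x _; rewrite /p orbb.
have Euv u v : u != v -> (E u v)%:Z = - cart u v.
  move=> uv; rewrite /cart (negbTE uv) mul0rn sub0r opprK ES -big_split.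
  apply: eq_bigr => x _; rewrite /p /=.
  by case: (atail x =P u) => [->|_]; rewrite ?(negbTE uv) /= ?orbF ?addr0 ?add0r.
have [A [f [bf Ef]]] : exists A, realizes E A.
  apply: (@affine_classification _ E (fun v => `|d v|%N) EC _ _ _ j); last by rewrite dj.
  - by move=> u; rewrite absz_gt0 gt_eqF.
  - move=> u; apply/eqP; rewrite -eqz_nat PoszD !PoszM (big_morph Posz PoszD (erefl _)).
    have dE v : (`|d v|%N : int) = d v by rewrite gez0_abs // ltW.
    under eq_bigr => v _ do rewrite PoszM dE.
    rewrite (bigD1 u) //= Euu !dE; have := rad u; rewrite symf_coordr (bigD1 u) //= cart_diag.
    have -> : \sum_(i | i != u) (E u i)%:Z * d i = - \sum_(i | i != u) d i * cart i u.
      rewrite -sumrN; apply: eq_bigr => v vu; rewrite Euv 1?eq_sym // cartC; ring.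
    by move: (\sum_(i | _) _) (narr u u) (d u) => s n e h; apply/eqP; lia.
  - move=> u v; have := cP u v (in_setT _) (in_setT _); apply: connect_sub => {u v}u v.
    rewrite !in_setT /= => /existsP[x ux]; apply: connect1; rewrite /E card_gt0.
    by apply/set0Pn; exists x; rewrite inE.
by exists A, f; split=> // i l; rewrite -Ef.
Qed.

(** * Restriction of the form to a set of vertices *)

Section Restrict.
Variables (Q : quiver) (J : {set vert Q}).
Local Notation P := (subquiver J).

Lemma narr_sub (v w : vert P) : narr v w = narr (val v) (val w).
Proof.
pose A (x : arr Q) := (atail x \in J) && (ahead x \in J).
rewrite /narr [RHS](bigID A) /= [X in _ + X]big1 ?addr0 => [|x]; last first.
  rewrite /A negb_and; case: eqP => //= ->; case: eqP => //= ->.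
  by rewrite (valP v) (valP w).
rewrite (reindex_omap (val : arr P -> arr Q) insub) /= => [|x Ax]; last by rewrite insubT.
apply: eq_big => [x|x _]; first by rewrite valK eqxx andbT; symmetry; exact: (valP x).
by rewrite -!val_eqE.
Qed.

Lemma cart_sub (v w : vert P) : cart v w = cart (val v) (val w).
Proof. by rewrite /cart !narr_sub val_eqE. Qed.

Variable b : lattice Q.
Hypothesis b_out : forall v, v \notin J -> b v = 0.

Lemma extend0_restrict : extend0 (restrict J b) = b.
Proof.
apply/ffunP => v; rewrite ffunE; case: insubP => [w _ <-|/b_out ->//].
by rewrite ffunE.
Qed.

Lemma symf_restrict (v : vert P) :
  symf (restrict J b) (coord_vec v) = symf b (coord_vec (val v)).
Proof.
rewrite !symf_coordr [RHS](bigID (mem J)) /= [X in _ + X]big1 ?addr0 => [|w /b_out ->].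
  rewrite (reindex_omap (val : vert P -> vert Q) insub) /= => [|w wJ]; last by rewrite insubT.
  apply: eq_big => [w|w _]; first by rewrite valK eqxx andbT; symmetry; exact: (valP w).
  by rewrite ffunE cart_sub.
by rewrite mul0r.
Qed.

End Restrict.

Lemma connected_restrict (Q : quiver) (J : {set vert Q}) : connected_in J ->
  connected_in [set: vert (subquiver J)].
Proof.
move=> cJ u w _ _; set e := (fun v' w' => _).
pose G v := forall vJ : v \in J, connect e u (Sub v vJ).
suff /(_ (valP w)) : G (val w) by rewrite (_ : Sub _ _ = w) //; exact: val_inj.
apply: (connected_in_ind (P := G) cJ (valP u) (valP w)) => [vJ|i l iJ lJ il Gi vJ].
  by rewrite (_ : Sub _ _ = u) //; exact: val_inj.
apply: connect_trans (Gi iJ) (connect1 _); rewrite /e !in_setT /=.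
move: il => /existsP[x xil]; have xJ : (atail x \in J) && (ahead x \in J).
  by case/orP: xil => /andP[/eqP -> /eqP ->]; rewrite iJ lJ.
by apply/existsP; exists (Sub x xJ); rewrite -!val_eqE.
Qed.

(** * The trichotomy *)

Section Main.
Variables (K : fieldType) (Q : quiver).
Implicit Types (q : {ffun vert Q -> K}) (th a b c : lattice Q) (v w i : vert Q).
Variable ord : seq (arr (double_quiver Q)).
Hypothesis ord_enum : perm_eq ord (enum (arr (double_quiver Q))).

Lemma coord_height v : height (coord_vec v) = 1.
Proof. by rewrite /height -[RHS](sum_delta (fun=> 1) v); apply: eq_bigr => w _; rewrite coordE eq_sym mul1r. Qed.

Lemma height_gt0 a : nonneg a -> a != 0 -> 0 < height a.
Proof.
move=> a0 an; rewrite lt_def height_ge0 // andbT.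
by apply: contraNneq an => /(height_eq0 a0) ->.
Qed.

(** A vector of height 1 is not a sum of two nonzero nonnegative ones. *)
Lemma Sigma_coord q th v : loopfree v -> Nqt q th (coord_vec v) -> Sigma q th (coord_vec v).
Proof.
move=> lv Nv; split.
  split=> //; split; last exact: coord_nonneg.
  by left; exists v; split=> //; constructor.
move=> [|b [|c s]] // _ Rs e.
have root x : x \in [:: b, c & s] -> nonneg x /\ 0 < height x.
  move/Rs => [[rx x0] _]; split=> //; apply: height_gt0 => //; exact: root_neq0.
have [b0 bh] := root b (mem_head _ _).
have [c0 ch] : nonneg c /\ 0 < height c by apply: root; rewrite !inE eqxx orbT.
have s0 : nonneg (\sum_(x <- s) x).
  by apply: sum_seq_ge0 => x xs; case: (root x) => //; rewrite !inE xs !orbT.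
have := coord_height v; rewrite e !big_cons !heightD; have := height_ge0 s0.
by move: (height _) (height b) (height c) bh ch => r s1 s2; lia.
Qed.

Lemma minimal_has_b2 q th a b : (forall v, q v != 0) -> fundamental a ->
  (exists2 i, i \in supp a & symf a (coord_vec i) != 0) ->
  Nqt q th b -> nonneg (a - b) -> symf b (a - b) = -1 ->
  (forall i, symf b (coord_vec i) <= 0) -> height b <= height (a - b) ->
  has_b1 q th a \/ has_b2 q th a.
Proof.
move=> q0 fa nrad Nb c0 bc ble hbc; have [b0 _ _] := Nb.
have [L [j [k [sp bj cb alt]]]] := minimal_shape fa nrad b0 c0 bc ble hbc.
pose J := supp b.
have b_out v : v \notin J -> b v = 0 by rewrite inE negbK => /eqP.
have jJ : j \in J by rewrite inE bj.
have bn : b != 0 by apply/eqP => b00; have := bj; rewrite b00 ffunE.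
have fb : fundamental b by [].
have Rb : Rqt q th b := fundamental_Rqt fb Nb.
case: alt => [ab|[m m2 abm]].
  left; exists J, L, j, k; split=> //; first by rewrite ab.
  rewrite (_ : restrict J a = restrict J b) ?extend0_restrict //.
  by apply/ffunP => v; rewrite !ffunE ab // (valP v).
right; exists J, L, j, k.
pose d := restrict J b.
have dE (v : vert (subquiver J)) : d v = b (val v) by rewrite ffunE.
have dpos (v : vert (subquiver J)) : 0 < d v by rewrite dE -(supp_gt0 _ b0); exact: (valP v).
have drad (v : vert (subquiver J)) : symf d (coord_vec v) = 0.
  by rewrite symf_restrict //; case: (abm (val v) (valP v)).
have dj : d (Sub j jJ) = 1 by rewrite dE.
have cJ := connected_restrict cb.
have suppd : supp d = [set: vert (subquiver J)].
  by apply/setP => v; rewrite !inE gt_eqF.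
split=> //; first exact: affine_of_radical dpos drad cJ dj.
exists m, d; split=> //.
- split.
    exists d; split; last by left; constructor.
    split; [|by move=> v; apply: ltW|by rewrite suppd|by move=> v; rewrite drad].
    by apply/eqP => d0; have := dpos (Sub j jJ); rewrite d0 ffunE ltxx.
  (* Indivisibility is read off at [j], where [d] is 1. *)
  move=> n c dc; have : d (Sub j jJ) = c (Sub j jJ) *+ n by rewrite dc ffunMnE.
  rewrite dj -mulr_natr natz => /(congr1 absz)/esym/eqP.
  by rewrite abszM muln_eq1 => /andP[_ /eqP].
- by rewrite extend0_restrict.
- apply/ffunP => v; rewrite ffunMnE [LHS]ffunE dE (abm _ (valP v)).1 -mulr_natr natz //.
- by exists jJ.
Qed.

(** Suppose (b, e_i) > 0. By [pairing_lt0] the pairing for b - e_i is still at most -1, and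
    expanding it forces (b, e_i) = 1 and (a, e_i) = 0: the reflection at [i] fixes [a] and lowers
    [b] by e_i. If it is admissible, parameters and representation move along; if not, e_i lies in
    N_{q,theta} and may be subtracted for the same parameters. The summands [b] and [a - b] play
    symmetric roles, so the lower one is always the one treated. *)
Lemma descent a : fundamental a -> (exists2 i, i \in supp a & symf a (coord_vec i) != 0) ->
  forall n q th b, (forall v, q v != 0) -> has_stable ord q th a -> Nqt q th b ->
  b != 0 -> nonneg (a - b) -> a - b != 0 -> symf b (a - b) = -1 -> (`|height b| < n)%N ->
  exists q' th', admissibly_reflected_from q' th' a q th a /\ has_b2 q' th' a
    /\ ~ has_b1 q' th' a.
Proof.
move=> fa nrad; elim/ltn_ind => n IH q th b q0 st Nb bn c0 cn bc bh.
have [b0 _ _] := Nb; have a0 : nonneg a by case: fa.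
have Nc : Nqt q th (a - b) := Nqt_sub q0 (has_stable_Nqt ord_enum st) Nb c0.
have [hbc|hbc] := leP (height b) (height (a - b)); last first.
  have abb : a - (a - b) = b by rewrite subKr.
  apply: (IH `|height b|%N bh q th (a - b)) => //; rewrite ?abb //; first by rewrite symfC.
  by have := height_ge0 c0; move: hbc; move: (height _) (height _) => s t; lia.
have [/existsP[i bi]|/existsPn bi] := boolP [exists i, 0 < symf b (coord_vec i)]; last first.
  exists q, th; split; first by constructor.
  have nb1 := has_stable_no_b1 ord_enum st; split=> //.
  have ble i : symf b (coord_vec i) <= 0 by rewrite leNgt bi.
  by case: (minimal_has_b2 q0 fa nrad Nb c0 bc ble hbc).
have bipos : 0 < b i.
  rewrite lt_def b0 andbT; apply: contraTneq bi => e.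
  by rewrite -leNgt nonneg_symf_coord_out.
have ci2 : cart i i = 2.
  apply: cart_gt0; have := lt_le_trans bi (nonneg_symf_coord_le i b0).
  by rewrite pmulr_rgt0.
have li : loopfree i by apply/loopfree_cart.
have ai : symf a (coord_vec i) <= 0 by case: fa.
pose b' := b - coord_vec i.
have b'0 : nonneg b'.
  move=> v; rewrite /b' ffunE [(- coord_vec i) v]ffunE coordE; have := b0 v.
  have [->|vi] := eqVneq v i; first by move: bipos; move: (b i) => t; lia.
  by rewrite subr0.
have abE : a - b' = (a - b) + coord_vec i by rewrite /b' opprB addrCA [LHS]addrC.
have c'0 : nonneg (a - b').
  by move=> v; rewrite abE ffunE addr_ge0 // coord_nonneg.
have pair x : symf x (a - x) = symf a x - symf x x by rewrite symfBr symfC.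
have b'n : b' != 0.
  rewrite subr_eq0; apply/eqP => be; move: bc; rewrite pair be symf_coord ci2; lia.
have c'n : a - b' != 0.
  apply: contra_neq (coord_neq0 i); rewrite abE addrC => e.
  exact: nonnegD_eq0 (coord_nonneg i) c0 e.
have lt := pairing_lt0 fa nrad b'0 c'0 b'n c'n.
have E : symf b' (a - b') = symf b (a - b) + symf b (coord_vec i) *+ 2 - symf a (coord_vec i) - 2.
  rewrite !pair /b' !symfBr !symfBl symf_coord ci2 [symf (coord_vec i) b]symfC; ring.
have [bi1 ai0] : symf b (coord_vec i) = 1 /\ symf a (coord_vec i) = 0.
  by move: lt; rewrite E bc; move: bi ai; move: (symf b _) (symf a _) => s t; lia.
have bc' : symf b' (a - b') = -1 by rewrite E bc bi1 ai0.
have hb' : (`|height b'| < `|height b|)%N.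
  have : height b' = height b - 1.
    by apply/eqP; rewrite eq_sym subr_eq -(coord_height i) -heightD /b' subrK.
  have := height_ge0 b0; have := height_ge0 b'0; move: (height _) (height _) => s t; lia.
have [adm|] := boolP ((q i != 1) || (th i != 0)); last first.
  rewrite negb_or !negbK => /andP[/eqP qi /eqP ti].
  apply: (IH _ bh q th b') => //; apply: Nqt_sub => //; split; first exact: coord_nonneg.
    by rewrite qpow_coord.
  by rewrite dotp_coord.
have {}adm : q i != 1 \/ th i != 0 by apply/orP.
have bE : reflection i b = b' by rewrite reflectionE bi1 mulr1z.
have aE : reflection i a = a := reflection_fix ai0.
have st' := has_stable_reflect ord_enum li q0 st adm; rewrite aE in st'.
have Nb' : Nqt (reflect_q i q) (reflect_th i th) b'.
  by rewrite -bE; apply: Nqt_reflect => //; rewrite bE.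
have [q' [th' [ch rest]]] := IH _ bh _ _ b' (reflect_q_neq0 i q0) st' Nb' b'n c'0 c'n bc' hb'.
exists q', th'; split=> //; apply: admissibly_reflected_trans ch _.
by have := admissibly_reflected_back (th := th) a q0 li adm; rewrite aE.
Qed.

Lemma reduction n q th a : (forall v, q v != 0) -> has_stable ord q th a -> (`|height a| < n)%N ->
  exists q' th' c, [/\ admissibly_reflected_from q' th' c q th a, forall v, q' v != 0,
    has_stable ord q' th' c & fundamental c \/ exists2 v, loopfree v & c = coord_vec v].
Proof.
elim/ltn_ind: n q th a => n IH q th a q0 st ah.
have [a0 _ _] := has_stable_Nqt ord_enum st.
have [/existsP[i ai]|/existsPn ai] := boolP [exists i, 0 < symf a (coord_vec i)]; last first.
  exists q, th, a; split=> //; first by constructor.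
  left; split=> //; [exact: has_stable_neq0 st|exact: (has_stable_connected st)|].
  by move=> i; rewrite leNgt ai.
have aipos : 0 < a i.
  rewrite lt_def a0 andbT; apply: contraTneq ai => e.
  by rewrite -leNgt nonneg_symf_coord_out.
have li : loopfree i.
  apply/loopfree_cart/cart_gt0; have := lt_le_trans ai (nonneg_symf_coord_le i a0).
  by rewrite pmulr_rgt0.
have [adm|] := boolP ((q i != 1) || (th i != 0)); last first.
  rewrite negb_or !negbK => /andP[/eqP qi /eqP ti].
  have [|ae] := has_stable_not_admissible ord_enum li st qi ti; first by rewrite leNgt ai.
  by exists q, th, a; split=> //; [constructor|right; exists i].
have {}adm : q i != 1 \/ th i != 0 by apply/orP.
have st' := has_stable_reflect ord_enum li q0 st adm.
have [a'0 _ _] := has_stable_Nqt ord_enum st'.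
have hr : (`|height (reflection i a)| < `|height a|)%N.
  have := height_ge0 a'0; rewrite height_reflection; have := height_ge0 a0.
  by move: (height a) (symf _ _) ai => h s; lia.
have [q' [th' [c [ch q'0 st'' alt]]]] := IH _ ah _ _ _ (reflect_q_neq0 i q0) st' hr.
exists q', th', c; split=> //; apply: admissibly_reflected_trans ch _.
exact: admissibly_reflected_back.
Qed.

Theorem has_stable_trichotomy q th a : (forall v, q v != 0) -> has_stable ord q th a ->
  [\/ Sigma q th a, proper_multiples (Sigma_iso q th) a
    | exists q' th' c, [/\ fundamental c, admissibly_reflected_from q' th' c q th a,
        has_b2 q' th' c & ~ has_b1 q' th' c]].
Proof.
move=> q0 st; have [q' [th' [c [ch q'0 st' alt]]]] := reduction q0 st (ltnSn _).
have Nc := has_stable_Nqt ord_enum st'.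
have fin : Sigma q' th' c \/ proper_multiples (Sigma_iso q' th') c ->
    Sigma q th a \/ proper_multiples (Sigma_iso q th) a.
  by move=> h; have [] := Sigma_transport q'0 ch h.
suff [/fin|] : (Sigma q' th' c \/ proper_multiples (Sigma_iso q' th') c) \/
    exists q'' th'', [/\ fundamental c, admissibly_reflected_from q'' th'' c q' th' c,
        has_b2 q'' th'' c & ~ has_b1 q'' th'' c].
- by case=> h; [apply: Or31|apply: Or32].
- case=> q'' [th'' [fc ch' h2 h1]]; apply: Or33; exists q'', th'', c; split=> //.
  exact: admissibly_reflected_trans ch' ch.
case: alt => [fc|[v lv cv]]; last by left; left; rewrite cv; apply: Sigma_coord; rewrite -?cv.
have [nrad|/exists2P/forallNP rad] := pselect (exists2 i, i \in supp c & symf c (coord_vec i) != 0); last first.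
  left; apply: radical_case => // i ic; apply/eqP/negPn/negP => ne.
  by apply: (rad i).
have [S|nS] := pselect (Sigma q' th' c); first by left; left.
right; have [b [Nb bn b0 bn' bc]] : exists b, [/\ Nqt q' th' b, b != 0, nonneg (c - b),
    c - b != 0 & -1 <= symf b (c - b)].
  apply: contrapT => none; apply: nS; apply: Sigma_of_pairs; first exact: fundamental_Rqt.
  move=> b Nb bn cb cbn; rewrite ltNge; apply/negP => le.
  by apply: none; exists b.
have [bnn _ _] := Nb.
have {}bc : symf b (c - b) = -1.
  by apply/eqP; rewrite eq_le bc andbT; exact: (pairing_lt0 fc nrad bnn b0 bn bn').
have [q'' [th'' [ch' [h2 h1]]]] := descent fc nrad q'0 st' Nb bn b0 bn' bc (ltnSn _).
by exists q'', th''.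
Qed.

End Main.

Local Open Scope complex_scope.

Theorem corollary6p18 (R : realType) (Q : quiver)
    (ord : seq (arr (double_quiver Q))) (q : {ffun vert Q -> R[i]})
    (th alpha : lattice Q)
    (ord_enum : perm_eq ord (enum (arr (double_quiver Q))))
    (q_neq0 : forall v, q v != 0)
    (stable : exists M : mpa_mod ord q,
       theta_stable M th /\ dim_vec (M := M) fullv = alpha) :
  [\/ Sigma q th alpha,
      proper_multiples (Sigma_iso q th) alpha
    | exists (q' : {ffun vert Q -> R[i]}) (th' gamma : lattice Q),
        [/\ fundamental gamma,
            admissibly_reflected_from q' th' gamma q th alpha,
            has_b2 q' th' gamma
          & ~ has_b1 q' th' gamma]].
Proof.
have [M [sM <-]] := stable.
(* The matrix representation reads the defining product in reverse order, which is again an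
   enumeration of the arrows. *)
have po : perm_eq (rev ord) (enum (arr (double_quiver Q))) by rewrite perm_rev.
exact: (has_stable_trichotomy po q_neq0 (theta_stable_has_stable sM)).
Qed.
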